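(* Let $n>2$, let $\Omega\subset\mathbb{R}^n$ be a bounded open set, let $0\le\theta<1$, let $\alpha,\beta$ be positive constants, and let $a:\Omega\times\mathbb{R}\to\mathbb{R}$ be a Carathéodory function such that $$\frac{\alpha}{(1+|s|)^{\theta}}\le a(x,s)\le\beta\qquad\text{for almost every }x\in\Omega\text{ and every }s\in\mathbb{R}.$$ Let $f\in L^m_{weak}(\Omega)$ with $m>(2^* )'$, and let $u\in W_0^{1,2}(\Omega)$ be a solution of $$-\mathrm{div}\,(a(x,u(x))Du(x))=f(x)\ \text{ in }\Omega,\qquad u=0\ \text{ on }\partial\Omega .$$ Then: (i) if $m>\frac n2$, there exists a constant $L=L(n,\alpha,\|f\|_{L^m_{weak}(\Omega)},m,|\Omega|)>0$ such that $|u|\le 2L$ almost everywhere in $\Omega$; (ii) if $m=\frac n2$, there exists a constant $\lambda=\lambda(n,\alpha,\|f\|_{L^m_{weak}(\Omega)},m)>0$ such that $e^{\lambda|u|^{1-\theta}}\in L^1(\Omega)$; (iii) if $(2^* )'<m<\frac n2$, then $u\in L^{m^{**}(1-\theta)}_{weak}(\Omega)$, where $m^{**}=\frac{nm}{n-2m}$.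
   Context: Carathéodory function: $a(\cdot,s)$ is measurable for every $s\in\mathbb{R}$ and $a(x,\cdot)$ is continuous for almost every $x\in\Omega$. Exponents: $2^*=\frac{2n}{n-2}$ is the Sobolev exponent and $(2^* )'=\frac{2n}{n+2}$ is its Hölder conjugate. $|E|$ denotes the Lebesgue measure of $E$. Marcinkiewicz space: for an exponent $r>0$, $L^r_{weak}(\Omega)$ is the set of all measurable functions $g$ on $\Omega$ for which there is a constant $\gamma$ such that $|\{x\in\Omega:|g|>\lambda\}|\le\frac{\gamma}{\lambda^r}$ for all $\lambda>0$; and $\|g\|^r_{L^r_{weak}(\Omega)}$ is the infimum of all $\gamma>0$ for which this holds. Solution: $u\in W_0^{1,2}(\Omega)$ is a solution of the boundary value problem if for every $v\in W_0^{1,2}(\Omega)$, $$\int_\Omega a(x,u)\,Du\cdot Dv\,dx=\int_\Omega f v\,dx .$$ The notation $L=L(\dots)$, $\lambda=\lambda(\dots)$ means that the constant depends on the listed quantities. *)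

(* Defs.v *)
From HB Require Import structures.
From mathcomp Require Import all_boot all_order all_algebra.
From mathcomp Require Import all_classical all_reals all_analysis.

Set Implicit Arguments.
Unset Strict Implicit.
Unset Printing Implicit Defensive.

Import Order.TTheory GRing.Theory Num.Theory.
Import numFieldNormedType.Exports.

Local Open Scope classical_set_scope.
Local Open Scope ring_scope.

(* R^n with the product of the Borel sigma-algebras of its n coordinates. *)
Definition borel_rV (R : realType) (n : nat) : Type := 'rV[R]_n.

Section borel_rV_instances.
Variables (R : realType) (n : nat).

HB.instance Definition _ := Pointed.on (borel_rV R n).

Let coors : 'I_n -> borel_rV R n -> measurableTypeR R :=
  fun i (x : 'rV[R]_n) => x ord0 i.

Let borel_rV_set0 : g_sigma_preimage coors set0.
Proof. exact: sigma_algebra0. Qed.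

Let borel_rV_setC A : g_sigma_preimage coors A -> g_sigma_preimage coors (~` A).
Proof. exact: sigma_algebraC. Qed.

Let borel_rV_bigcup (F : (set (borel_rV R n))^nat) :
  (forall i, g_sigma_preimage coors (F i)) ->
  g_sigma_preimage coors (\bigcup_i (F i)).
Proof. exact: sigma_algebra_bigcup. Qed.

HB.instance Definition _ := @isMeasurable.Build default_measure_display
  (borel_rV R n) (g_sigma_preimage coors)
  borel_rV_set0 borel_rV_setC borel_rV_bigcup.

End borel_rV_instances.

Section row_cons.
Variables (R : realType) (n : nat).

Definition row_cons (p : measurableTypeR R * borel_rV R n) : borel_rV R n.+1 :=
  \row_i oapp ((p.2 : 'rV[R]_n) ord0) p.1 (unlift ord0 i).

Definition row_uncons (v : borel_rV R n.+1) : measurableTypeR R * borel_rV R n :=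
  ((v : 'rV[R]_n.+1) ord0 ord0, \row_j (v : 'rV[R]_n.+1) ord0 (lift ord0 j)).

Lemma row_consK : cancel row_cons row_uncons.
Proof.
case=> x v; rewrite /row_uncons /row_cons; congr pair.
  by rewrite mxE unlift_none.
by apply/rowP => j; rewrite !mxE liftK.
Qed.

Lemma row_unconsK : cancel row_uncons row_cons.
Proof.
move=> v; apply/rowP => i; rewrite mxE.
by case: (unliftP ord0 i) => [j ->|->] //=; rewrite mxE.
Qed.

Lemma measurable_coor m (i : 'I_m) :
  measurable_fun [set: borel_rV R m]
    (fun v : borel_rV R m => (v : 'rV[R]_m) ord0 i : measurableTypeR R).
Proof.
move=> _ Y mY; rewrite setTI; apply: sub_sigma_algebra => /=.
rewrite -bigcup_seq/=; exists i => /=; first by rewrite mem_index_enum.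
by exists Y => //; rewrite setTI.
Qed.

Lemma measurable_fun_borel_rVP d (T : measurableType d) m (f : T -> borel_rV R m) :
  (forall i, measurable_fun [set: T]
     (fun x => (f x : 'rV[R]_m) ord0 i : measurableTypeR R)) ->
  measurable_fun [set: T] f.
Proof.
move=> mf _ A mA; rewrite setTI.
suff : g_sigma_preimage
    (fun i x => (f x : 'rV[R]_m) ord0 i : measurableTypeR R) (f @^-1` A).
  apply: smallest_sub => //; first exact: sigma_algebra_measurable.
  move=> B; rewrite -bigcup_seq/= => -[i _ [C mC <-]].
  exact: mf.
have -> : g_sigma_preimage
    (fun i x => (f x : 'rV[R]_m) ord0 i : measurableTypeR R) =
  preimage_set_system [set: T] f (@measurable _ (borel_rV R m)).
  exact: (g_sigma_preimage_comp
    (fun i (v : borel_rV R m) => (v : 'rV[R]_m) ord0 i : measurableTypeR R) f).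
by exists A => //; rewrite setTI.
Qed.

Lemma measurable_row_cons : measurable_fun setT row_cons.
Proof.
apply: measurable_fun_borel_rVP => i.
case: (unliftP ord0 i) => [j|] ->.
  rewrite (_ : (fun _ => _) = (fun p : measurableTypeR R * borel_rV R n =>
      (p.2 : 'rV[R]_n) ord0 j : measurableTypeR R)).
    by apply: (measurableT_comp (measurable_coor j)).
  by apply/funext => p; rewrite mxE liftK.
rewrite (_ : (fun _ => _) = fst) //.
by apply/funext => p; rewrite mxE unlift_none.
Qed.

Lemma measurable_row_uncons : measurable_fun setT row_uncons.
Proof.
apply: measurable_fun_pair; first exact: measurable_coor.
apply: measurable_fun_borel_rVP => i.
rewrite (_ : (fun _ => _) =
    (fun v : borel_rV R n.+1 => (v : 'rV[R]_n.+1) ord0 (lift ord0 i))).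
  exact: measurable_coor.
by apply/funext => v; rewrite mxE.
Qed.

End row_cons.

Section lebesgue_step.
Context (R : realType) (n : nat).
Variable mu : {sigma_finite_measure set (borel_rV R n) -> \bar R}.

(* The image on R^(n+1) of the product of the Lebesgue measure on R with mu. *)
Definition lebesgue_step : set (borel_rV R n.+1) -> \bar R :=
  pushforward (@lebesgue_measure R \x mu)%E (@row_cons R n).

Let step_measure : {measure set (borel_rV R n.+1) -> \bar R} :=
  measure_function_pushforward__canonical__measure_function_Measure
    (@lebesgue_measure R \x mu)%E (@measurable_row_cons R n).

HB.instance Definition _ := isMeasure.Build _ _ _ lebesgue_step
  (measure0 step_measure) (measure_ge0 step_measure)
  (@measure_semi_sigma_additive _ _ _ step_measure).

Lemma lebesgue_step_sigma_finite : sigma_finite setT lebesgue_step.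
Proof.
have [F TF mF] : sigma_finite setT (@lebesgue_measure R \x mu)%E.
  have /sigma_finiteP[F [TF ndF Foo]] := sigma_finiteT (@lebesgue_measure R).
  have /sigma_finiteP[G [TG ndG Goo]] := sigma_finiteT mu.
  exists (fun k => F k `*` G k) => [|k].
    rewrite -setXTT TF TG predeqE => -[x y]; split.
      move=> [/= [i _ Fix] [j _ Gjy]]; exists (maxn i j) => //; split.
        by move: x Fix; exact/subsetPset/ndF/leq_maxl.
      by move: y Gjy; exact/subsetPset/ndG/leq_maxr.
    by move=> [i _ []/= ? ?]; split; exists i.
  have [? ?] := Foo k; have [? ?] := Goo k.
  split; first exact: measurableX.
  by rewrite product_measure1E// lte_mul_pinfty// ge0_fin_numE.
exists (fun k => @row_uncons R n @^-1` F k) => [|k].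
  by rewrite -preimage_bigcup -TF preimage_setT.
have [mFk Fkoo] := mF k; split.
  by rewrite -[X in measurable X]setTI; exact: measurable_row_uncons.
rewrite /lebesgue_step /pushforward -comp_preimage.
rewrite (_ : _ \o _ = id) ?preimage_id//.
by apply/funext => p /=; rewrite row_consK.
Qed.

HB.instance Definition _ := @Measure_isSigmaFinite.Build _ _ _ lebesgue_step
  lebesgue_step_sigma_finite.

End lebesgue_step.

(* The n-fold product of the Lebesgue measure on R; see borel_lebesgue_box. *)
Fixpoint borel_lebesgue (R : realType) (n : nat) :
    {sigma_finite_measure set (borel_rV R n) -> \bar R} :=
  match n with
  | 0 => @dirac _ (borel_rV R 0) (0 : 'rV[R]_0) R
  | m.+1 => lebesgue_step (borel_lebesgue R m)
  end.

Lemma borel_lebesgue_box (R : realType) (n : nat)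
    (A : 'I_n -> set (measurableTypeR R)) :
  (forall i, measurable (A i)) ->
  borel_lebesgue R n [set v | forall i, A i ((v : 'rV[R]_n) ord0 i)] =
  (\prod_(i < n) @lebesgue_measure R (A i))%E.
Proof.
elim: n A => [|n IH] A mA.
  rewrite big_ord0 /= diracE (_ : _ \in _ = true)//.
  by apply/mem_set => -[].
rewrite big_ord_recl -(IH (fun i => A (lift ord0 i)))//.
rewrite /= /lebesgue_step /pushforward.
rewrite -product_measure1E//; last first.
  rewrite (_ : [set _ | _] = \bigcap_(i in [set: 'I_n])
      ((fun v : borel_rV R n => (v : 'rV[R]_n) ord0 i : measurableTypeR R)
        @^-1` A (lift ord0 i))); last first.
    by apply/seteqP; split => [v Av i _|v Av i]; exact: Av.
  apply: fin_bigcap_measurable => // i _.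
  by rewrite -[X in measurable X]setTI; exact: measurable_coor.
congr product_measure1; apply/seteqP; split => -[x v] /=.
  move=> Av; split=> [|i].
    by have := Av ord0; rewrite mxE unlift_none.
  by have := Av (lift ord0 i); rewrite mxE liftK.
move=> [Ax Av] i; rewrite mxE.
by case: (unliftP ord0 i) => [j ->|->] /=.
Qed.

(* The Lebesgue measure on R^n, on the complete sigma-algebra of the Lebesgue
   measurable sets. *)
Definition lebesgue_rV (R : realType) (n : nat) :=
  @completed_measure_extension _ _ R (borel_lebesgue R n).

HB.instance Definition _ (R : realType) (n : nat) :=
  Measure.on (@lebesgue_rV R n).

Definition lebesgue_space (R : realType) (n : nat) :=
  caratheodory_type (mu_ext (borel_lebesgue R n)).

Section sobolev.
Context (R : realType) (n : nat).
Local Notation E := 'rV[R]_n.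
Local Notation T := (lebesgue_space R n).
Local Notation mu := (@lebesgue_rV R n).
Implicit Types (Omega : set E) (u v phi : E -> R) (Du Dv : E -> E).

Definition volume Omega : R := fine (mu Omega).

Definition dotprod (x y : E) : R := \sum_(i < n) x ord0 i * y ord0 i.

Definition square_integrable Omega u : Prop :=
  measurable_fun (Omega : set T) (u : T -> R) /\
  (\int[mu]_(x in Omega) (u x ^+ 2)%:E < +oo)%E.

Definition L2_cvg Omega (phi : nat -> E -> R) u : Prop :=
  (\int[mu]_(x in Omega) ((phi k x - u x) ^+ 2)%:E)%E @[k --> \oo] --> 0%E.

Definition partial (i : 'I_n) phi : E -> R := 'D_(delta_mx ord0 i) phi.

Definition smooth phi : Prop := forall s : seq 'I_n,
  continuous (foldr partial phi s) /\
  forall (i : 'I_n) (x : E), derivable (foldr partial phi s) x (delta_mx ord0 i).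

Definition test_function Omega phi : Prop :=
  [/\ smooth phi, compact (closure [set x | phi x != 0]) &
      closure [set x | phi x != 0] `<=` Omega].

(* u belongs to W^{1,2}(Omega), with weak gradient Du. *)
Definition sobolev12 Omega u Du : Prop :=
  [/\ square_integrable Omega u,
      forall i : 'I_n, square_integrable Omega (fun x => Du x ord0 i) &
      forall (phi : E -> R) (i : 'I_n), test_function Omega phi ->
        (\int[mu]_(x in Omega) (u x * partial i phi x)%:E =
         - \int[mu]_(x in Omega) (Du x ord0 i * phi x)%:E)%E].

(* u belongs to W_0^{1,2}(Omega), the closure of the test functions in
   W^{1,2}(Omega), and has weak gradient Du. *)
Definition sobolev12_0 Omega u Du : Prop :=
  sobolev12 Omega u Du /\
  exists phi : nat -> E -> R,
    [/\ forall k, test_function Omega (phi k),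
        L2_cvg Omega phi u &
        forall i : 'I_n,
          L2_cvg Omega (fun k => partial i (phi k)) (fun x => Du x ord0 i)].

Definition caratheodory_function Omega (a : E -> R -> R) : Prop :=
  (forall s : R, measurable_fun (Omega : set T) ((a ^~ s) : T -> R)) /\
  {ae mu, forall x, Omega x -> continuous (a x)}.

(* u belongs to W_0^{1,2}(Omega) and solves - div (a(x, u) Du) = f weakly. *)
Definition dirichlet_solution Omega (a : E -> R -> R) (f u : E -> R) : Prop :=
  exists Du : E -> E, sobolev12_0 Omega u Du /\
    forall v Dv, sobolev12_0 Omega v Dv ->
      (\int[mu]_(x in Omega) (a x (u x) * dotprod (Du x) (Dv x))%:E =
       \int[mu]_(x in Omega) (f x * v x)%:E)%E.

Definition weak_bound Omega (r : R) (g : E -> R) (gamma : R) : Prop :=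
  forall lambda : R, 0 < lambda ->
    (mu (Omega `&` [set x | lambda < `|g x| ]%R) <= (gamma / lambda `^ r)%:E)%E.

Definition Lweak Omega (r : R) (g : E -> R) : Prop :=
  measurable_fun (Omega : set T) (g : T -> R) /\
  exists gamma : R, weak_bound Omega r g gamma.

Definition Lweak_norm Omega (r : R) (g : E -> R) : R :=
  inf [set gamma | 0 < gamma /\ weak_bound Omega r g gamma] `^ r^-1.

End sobolev.

(* (2^* )' = 2 n / (n + 2), the Hoelder conjugate of 2^* = 2 n / (n - 2) *)
Definition sobolev_exponent_conj (R : realType) (n : nat) : R :=
  2 * n%:R / (n%:R + 2).

Definition double_star (R : realType) (n : nat) (m : R) : R :=
  n%:R * m / (n%:R - 2 * m).

(* Main.v *)
Require Import Defs.
From HB Require Import structures.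
From mathcomp Require Import all_boot all_order all_algebra.
From mathcomp Require Import all_classical all_reals all_analysis.
From mathcomp Require Import measurable_realfun ring lra zify.

(* Put H(t) = int_0^t (1 + r)^(-theta) dr and M(s) = |{H(|u|) > s}|. Testing the
   equation with a C^1 truncation v of H(u) between the levels s and s + d, the
   lower bound on a cancels the degeneracy and gives
     int |Dv|^2 <= (C / d) int_{H(|u|) > s} |f| <= (C' / d) M(s)^(1 - 1/m).
   A Faber-Krahn type inequality |{|v| >= 3/2}| <= C |{v <> 0}|^(2/n) int |Dv|^2
   replaces the Sobolev inequality; it follows by averaging |v(x + h) - v(x)|^2
   over h in a cube of volume comparable to |{v <> 0}|. Together,
     M(s + d) <= (C / d) M(s)^(1 + 2/n - 1/m),
   and the iteration lemma of Stampacchia makes M vanish beyond a finite level,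
   decay exponentially, or decay like a power, according to whether the exponent
   is larger than, equal to or smaller than 1. *)

Set Implicit Arguments.
Unset Strict Implicit.
Unset Printing Implicit Defensive.
Import Order.TTheory GRing.Theory Num.Theory.
Import numFieldNormedType.Exports.
Local Open Scope classical_set_scope.
Local Open Scope ring_scope.

(** * Lebesgue measure on R^n *)

(** An inequality between measures is all the iteration consumes, namely the sizes of [{v <> 0}] and
    [{|v| >= 3/2}], and its proof rests on translation invariance, Tonelli and Cauchy-Schwarz alone.
    It holds at level 1 for test functions; passing to [v] by L^2 convergence loses 1/2, whence the
    level 3/2. The truncations are C^1 and not piecewise linear because the chain rule in W_0^{1,2}
    is obtained by approximating their derivative uniformly by polynomials: a polynomial without
    constant term maps test functions to test functions. The power of M is [1 - 1/m] from [f] plus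
    [2/n] from Faber-Krahn. Its excess over 1, [2/n - 1/m], has the sign of [m - n/2], and when
    negative it is [-1/m^{**}]: this puts H(|u|) in weak L^{m^{**}}, and H(t) grows like
    [t^(1 - theta)]. Two measures are in play. The Borel product measure carries Fubini and
    translation invariance; Sobolev functions live on its completion. Test functions are Borel, so
    their estimates are proved on the former and transferred. *)

Section borel.
Context (R : realType) (n : nat).

Lemma measurable_box (A : 'I_n -> set R) :
  (forall i, measurable (A i : set (measurableTypeR R))) ->
  measurable ([set v | forall i, A i ((v : 'rV[R]_n) ord0 i)] : set (borel_rV R n)).
Proof.
move=> mA; rewrite (_ : [set _ | _] = \bigcap_(i in [set: 'I_n])
  ((fun v : borel_rV R n => (v : 'rV[R]_n) ord0 i : measurableTypeR R) @^-1` (A i))); last first.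
  by apply/seteqP; split => [v Av i _|v Av i]; exact: Av.
apply: fin_bigcap_measurable => // i _.
by rewrite -[X in measurable X]setTI; exact: measurable_coor.
Qed.

(** Balls of ['rV[R]_n] are boxes, as its norm is the maximum over the coordinates, so an open set
    is the countable union of the boxes with rational centre and radius that it contains. *)
Lemma borel_rV_open (O : set 'rV[R]_n) : open O -> measurable (O : set (borel_rV R n)).
Proof.
move=> oO.
pose B (q : {ffun 'I_n -> rat} * rat) : set (borel_rV R n) :=
  [set v | forall i, ball ((ratr (q.1 i)) : R) (ratr q.2) ((v : 'rV[R]_n) ord0 i)].
pose P := [set q | B q `<=` O].
have -> : (O : set (borel_rV R n)) = \bigcup_q (if q \in P then B q else set0).
  rewrite -bigcup_mkcond.
  apply/seteqP; split => [x Ox|x [q Pq Bqx]]; last exact: Pq.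
  have /nbhs_ballP[e/= e0 eO] : nbhs x O by exact: open_nbhs_nbhs.
  have [r r0 re] : exists2 r : rat, 0 < (ratr r : R) & ratr r < e / 2.
    have /rat_in_itvoo[r] : (0:R) < e / 2 by rewrite divr_gt0.
    by rewrite in_itv/= => /andP[]; exists r.
  have /choice[q qx] (i : 'I_n) :
      exists q : rat, ball (x ord0 i) (ratr r) (ratr q : R).
    have /rat_in_itvoo[p] : x ord0 i - ratr r < x ord0 i + ratr r.
      by rewrite ltrD2l gt0_cp.
    rewrite in_itv/= => /andP[p1 p2]; exists p.
    by rewrite /ball/= ltr_distlC p1 p2.
  exists ([ffun i => q i], r).
    move=> y /= yB; apply: eO => /=; split=> // i j; rewrite (ord1 i).
    have := yB j; rewrite ffunE => /(ball_triangle (qx j)).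
    by apply: le_ball; rewrite -mulr2n -mulr_natr -ler_pdivlMr// ltW.
  by move=> i /=; rewrite ffunE; exact/ball_sym/qx.
apply: countable_bigcupT_measurable => [|q]; first exact: countableP.
case: ifPn => // _.
have mball (i : 'I_n) : measurable (ball (ratr (q.1 i) : R) (ratr q.2) : set (measurableTypeR R)).
  by rewrite ball_itv; exact: measurable_itv.
exact: (measurable_box mball).
Qed.

Lemma continuous_borel_measurable (g : 'rV[R]_n -> R) : continuous g ->
  measurable_fun [set: borel_rV R n] (g : borel_rV R n -> measurableTypeR R).
Proof.
move=> /continuousP cg; apply: (measurability _ (RGenOpens.measurableE R)).
move=> _ [_ [a [b ->] <-]]; rewrite setTI.
by apply: borel_rV_open; apply: cg; exact: interval_open.
Qed.

End borel.

Lemma measurable_translation (R : realType) n (h : 'rV[R]_n) :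
  measurable_fun setT (fun v : borel_rV R n => ((v : 'rV[R]_n) + h) : borel_rV R n).
Proof.
apply: measurable_fun_borel_rVP => i.
rewrite (_ : (fun _ => _) = (fun v : borel_rV R n =>
   ((v : 'rV[R]_n) ord0 i : measurableTypeR R) + h ord0 i)); last first.
  by apply/funext => v; rewrite mxE.
apply: measurable_funD; [exact: measurable_coor|exact: measurable_cst].
Qed.

(** Both sides are measures in [A] that agree on half-open intervals, which determines them. *)
Lemma lebesgue_measure_translation (R : realType) (h : R) (A : set R) : measurable A ->
  @lebesgue_measure R [set x | A (x + h)] = lebesgue_measure A.
Proof.
move=> mA.
have mh : measurable_fun setT (fun x : measurableTypeR R => x + h : measurableTypeR R).
  by apply: measurable_funD => //; exact: measurable_cst.
pose m := measure_function_pushforward__canonical__measure_function_Measure (@lebesgue_measure R) mh.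
apply/esym; apply: (@lebesgue_measure_unique R m) => //= _ [[a b]] _ <-.
rewrite /m /= /pushforward /=.
rewrite (_ : _ @^-1` _ = `]a - h, b - h]%classic); last first.
  by apply/seteqP; split => x; rewrite /= !in_itv/= ltrBlDr lerBrDr.
rewrite !lebesgue_measure_itv/= !lte_fin ltrD2r; case: ifP => // _.
by rewrite -!EFinB; congr (_%:E); ring.
Qed.

(** By induction on the dimension: in the coordinates of [row_cons] the translation acts on each
    factor, and a measure with the right values on rectangles is the product measure. *)
Lemma borel_lebesgue_translation (R : realType) n (h : 'rV[R]_n) (A : set (borel_rV R n)) :
  measurable A ->
  borel_lebesgue R n [set v | A ((v : 'rV[R]_n) + h)] = borel_lebesgue R n A.
Proof.
elim: n h A => [|n IH] h A mA.
  by rewrite (_ : [set v | _] = A)//; apply/funext => v /=; congr A; rewrite [LHS]thinmx0 [RHS]thinmx0.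
pose f (p : measurableTypeR R * borel_rV R n) : measurableTypeR R * borel_rV R n :=
  (p.1 + h ord0 ord0, (p.2 : 'rV[R]_n) + \row_j h ord0 (lift ord0 j)).
have mf : measurable_fun setT f.
  apply: measurable_fun_pair => /=.
    by apply: measurable_funD => //; exact: measurable_cst.
  by apply: (measurableT_comp (measurable_translation _)).
pose m := measure_function_pushforward__canonical__measure_function_Measure
  (@lebesgue_measure R \x borel_lebesgue R n)%E mf.
rewrite /= /lebesgue_step /pushforward /=.
rewrite [RHS](product_measure_unique (m' := m)).
- rewrite /m /= /pushforward/=; congr product_measure1.
  apply/funext => -[x v] /=. congr A; apply/rowP => i; rewrite !mxE.
  by case: (unliftP ord0 i) => [j ->|->] /=; rewrite ?mxE// ?mxE.
- move=> B C mB mC; rewrite /m /= /pushforward/=.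
  rewrite -(lebesgue_measure_translation (h ord0 ord0) mB) -(IH (\row_j h ord0 (lift ord0 j)) _ mC).
  rewrite -product_measure1E//.
    rewrite -[X in measurable X]setTI.
    have : measurable_fun setT (fun x : measurableTypeR R => x + h ord0 ord0 : measurableTypeR R).
      by apply: measurable_funD => //; exact: measurable_cst.
    exact.
  by rewrite -[X in measurable X]setTI; exact: measurable_translation.
- by rewrite -[X in measurable X]setTI; apply: measurable_row_cons.
Qed.

Section integrals.
Context (R : realType) (n : nat).
Local Open Scope ereal_scope.
Local Notation T := (borel_rV R n).
Local Notation mu := (borel_lebesgue R n).

Lemma ge0_integral_translation (h : 'rV[R]_n) (g : T -> \bar R) :
  measurable_fun setT g -> (forall x, 0 <= g x) ->
  \int[mu]_x g ((x : 'rV[R]_n) + h)%R = \int[mu]_x g x.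
Proof.
move=> mg g0.
have := @ge0_integral_pushforward _ _ T T R _ (measurable_translation h) mu setT g measurableT mg.
rewrite preimage_setT => <-//.
apply: eq_measure_integral => [|mh A mA _]; first exact: measurable_translation.
exact: (borel_lebesgue_translation h mA).
Qed.

Lemma lebesgue_rV_borel (A : set T) : measurable A -> lebesgue_rV A = mu A.
Proof. by move=> mA; rewrite /lebesgue_rV /completed_measure_extension /= measurable_mu_extE. Qed.

Lemma lebesgue_rV_measurable (A : set T) : measurable A ->
  measurable (A : set (lebesgue_space R n)).
Proof. exact: caratheodory_measurable_mu_ext. Qed.

(** The identity map from the completed sigma-algebra to the Borel one is measurable and pushes
    [lebesgue_rV] forward to [borel_lebesgue]. Borel integrands can thus be treated with the product
    structure. *)
Lemma lebesgue_rV_ge0_integral (D : set T) (g : T -> \bar R) :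
  measurable D -> measurable_fun D g -> (forall x, D x -> 0 <= g x) ->
  \int[@lebesgue_rV R n]_(x in D) g x = \int[mu]_(x in D) g x.
Proof.
move=> mD mg g0.
have mid : measurable_fun setT (idfun : lebesgue_space R n -> T).
  by move=> _ A mA; rewrite setTI; exact: lebesgue_rV_measurable.
have := @ge0_integral_pushforward _ _ _ T R _ mid (@lebesgue_rV R n) D g mD mg.
rewrite preimage_id => <-//; last by move=> x /set_mem; exact: g0.
apply: eq_measure_integral => A mA _.
exact: (lebesgue_rV_borel mA).
Qed.

End integrals.

(** * Test functions *)

Section smooth.
Context (R : realType) (n : nat).
Local Notation E := 'rV[R]_n.
Implicit Types (Omega : set E) (g h : E -> R) (i : 'I_n).

Local Notation e i := (delta_mx ord0 i : E).

Lemma smooth_partial g i : smooth g -> smooth (partial i g).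
Proof. by move=> sg s; rewrite -foldr_rcons; exact: sg. Qed.

Lemma smooth_continuous g : smooth g -> continuous g.
Proof. by move=> sg; have [] := sg [::]. Qed.

Lemma smooth_derivable g i x : smooth g -> derivable g x (e i).
Proof. by move=> sg; have [_] := sg [::]; exact. Qed.

(* [smooth] quantifies over all iterated partial derivatives at once; indexing
   by the number of derivatives makes sums and products provable by induction. *)
Fixpoint diff_class (k : nat) g : Prop :=
  if k is k'.+1 then [/\ continuous g, forall i x, derivable g x (e i) &
    forall i, diff_class k' (partial i g)] else True.

Lemma diff_classP g : smooth g <-> forall k, diff_class k g.
Proof.
split=> [sg k|cg].
  elim: k g sg => // k IH g sg; split; [exact: smooth_continuous|by move=> *; exact: smooth_derivable|].
  by move=> i; apply/IH/smooth_partial.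
move=> s; elim/last_ind: s g cg => [|s i IH] g cg; first by have [] := cg 1%N.
by rewrite foldr_rcons; apply: IH => k; have [_ _] := cg k.+1; exact.
Qed.

Lemma diff_class_pred k g : diff_class k.+1 g -> diff_class k g.
Proof.
elim: k g => // k IH g [cg dg sg]; split => // i; exact/IH/sg.
Qed.

Lemma partialD g h i : (forall x, derivable g x (e i)) -> (forall x, derivable h x (e i)) ->
  partial i (fun x => g x + h x) = (fun x => partial i g x + partial i h x).
Proof. by move=> dg dh; apply/funext => x; rewrite /partial; exact: (deriveD (dg x) (dh x)). Qed.

Lemma partialM g h i : (forall x, derivable g x (e i)) -> (forall x, derivable h x (e i)) ->
  partial i (fun x => g x * h x) = (fun x => g x * partial i h x + h x * partial i g x).
Proof. by move=> dg dh; apply/funext => x; rewrite /partial; exact: (deriveM (dg x) (dh x)). Qed.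

Lemma partial_cst (c : R) i : partial i (fun=> c) = (fun=> 0).
Proof. by apply/funext => x; rewrite /partial derive_cst. Qed.

Lemma smooth_cst (c : R) : smooth (fun _ : E => c).
Proof.
apply/diff_classP => k; elim: k c => // k IH c; split; first exact: cst_continuous.
- by move=> i x; exact: derivable_cst.
- by move=> i; rewrite partial_cst.
Qed.

Lemma diff_classD k g h : diff_class k g -> diff_class k h -> diff_class k (fun x => g x + h x).
Proof.
elim: k g h => // k IH g h [cg dg sg] [ch dh sh]; split.
- by move=> x; exact: (continuousD (cg x) (ch x)).
- by move=> i x; exact: (derivableD (dg i x) (dh i x)).
- by move=> i; rewrite partialD //; exact: (IH _ _ (sg i) (sh i)).
Qed.

(** Leibniz's rule pairs each function with a derivative of the other, so the undifferentiated
    factor is lowered by [diff_class_pred] before the induction hypothesis applies. *)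
Lemma diff_classM k g h : diff_class k g -> diff_class k h -> diff_class k (fun x => g x * h x).
Proof.
elim: k g h => // k IH g h sg0 sh0.
have [cg dg sg] := sg0; have [ch dh sh] := sh0; split.
- by move=> x; exact: (continuousM (cg x) (ch x)).
- by move=> i x; exact: (derivableM (dg i x) (dh i x)).
- by move=> i; rewrite partialM//; exact: (diff_classD (IH _ _ (diff_class_pred sg0) (sh i)) (IH _
    _ (diff_class_pred sh0) (sg i))).
Qed.

Lemma smoothD g h : smooth g -> smooth h -> smooth (fun x => g x + h x).
Proof. by move=> /diff_classP sg /diff_classP sh; apply/diff_classP => k; exact: diff_classD. Qed.

Lemma smoothM g h : smooth g -> smooth h -> smooth (fun x => g x * h x).
Proof. by move=> /diff_classP sg /diff_classP sh; apply/diff_classP => k; exact: diff_classM. Qed.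

Lemma smooth_horner (p : {poly R}) g : smooth g -> smooth (fun x => p.[g x]).
Proof.
move=> sg; elim/poly_ind: p => [|p c IH].
  rewrite (_ : (fun _ => _) = fun=> 0); first exact: smooth_cst.
  by apply/funext => x; rewrite horner0.
rewrite (_ : (fun _ => _) = fun x => p.[g x] * g x + c).
  by apply: smoothD; [exact: smoothM|exact: smooth_cst].
by apply/funext => x; rewrite !hornerE.
Qed.

Lemma partial_horner (p : {poly R}) g i : smooth g ->
  partial i (fun x => p.[g x]) = (fun x => p^`().[g x] * partial i g x).
Proof.
move=> sg; have dg x : derivable g x (e i) by exact: smooth_derivable.
elim/poly_ind: p => [|p c IH].
  rewrite (_ : (fun _ => _) = fun=> 0) ?partial_cst.
    by apply/funext => x; rewrite deriv0 horner0 mul0r.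
  by apply/funext => x; rewrite horner0.
have sp := smooth_horner p sg.
rewrite (_ : (fun _ => _) = fun x => p.[g x] * g x + c); last first.
  by apply/funext => x; rewrite !hornerE.
rewrite partialD; last 2 first.
- by move=> x; apply: smooth_derivable; exact: smoothM.
- by move=> x; exact: derivable_cst.
rewrite partial_cst partialM//; last by move=> x; exact: smooth_derivable.
rewrite IH; apply/funext => x.
by rewrite derivD derivC addr0 derivM derivX mulr1 hornerD horner0 addr0 hornerD hornerMX; ring.
Qed.

Lemma test_function_smooth Omega g : test_function Omega g -> smooth g.
Proof. by case. Qed.

(** Off its closed support [g] vanishes in a neighbourhood of the point, hence so does its
    derivative there. *)
Lemma partial_neq0 g i : [set x | partial i g x != 0] `<=` closure [set x | g x != 0].
Proof.
move=> x /= gx0; apply: contrapT => ncl.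
have oc : open (~` closure [set x | g x != 0]) by apply: closed_openC; exact: closed_closure.
move/negP: gx0; apply; apply/eqP.
rewrite /partial; transitivity ('D_(e i) (cst 0) x : R); last by rewrite derive_cst.
have nx : nbhs x (~` closure [set x | g x != 0]) by exact: open_nbhs_nbhs.
apply: near_eq_derive; near=> y.
have : (~` closure [set x | g x != 0]) y by near: y.
move=> ny; apply/eqP/negPn/negP => gy0; apply: ny; exact: subset_closure.
Unshelve. all: by end_near. Qed.

Lemma test_function_sub Omega g h : test_function Omega g -> smooth h ->
  [set x | h x != 0] `<=` closure [set x | g x != 0] -> test_function Omega h.
Proof.
move=> [sg cg gO] sh hg.
have cl : closure [set x | h x != 0] `<=` closure [set x | g x != 0].
  rewrite [X in _ `<=` X](closure_id _).1; first exact: closureS.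
  exact: closed_closure.
split => //; last exact: subset_trans gO.
by apply: subclosed_compact cg cl; exact: closed_closure.
Qed.

Lemma test_function_partial Omega g i : test_function Omega g -> test_function Omega (partial i g).
Proof.
move=> tg; apply: (test_function_sub tg); last exact: partial_neq0.
exact/smooth_partial/test_function_smooth/tg.
Qed.

Lemma test_function_horner Omega (p : {poly R}) g : test_function Omega g -> p.[0] = 0 ->
  test_function Omega (fun x => p.[g x]).
Proof.
move=> tg p0; apply: (test_function_sub tg); first exact/smooth_horner/test_function_smooth/tg.
move=> x /= px; apply: subset_closure => /=; apply: contraNneq px => ->; exact/eqP.
Qed.

Lemma test_functionM Omega g h : test_function Omega g -> smooth h ->
  test_function Omega (fun x => g x * h x).
Proof.
move=> tg sh; apply: (test_function_sub tg).
  by apply: smoothM => //; exact: test_function_smooth tg.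
move=> x /= px; apply: subset_closure => /=; apply: contraNneq px => ->; by rewrite mul0r.
Qed.

End smooth.

Section balls.
Context (R : realType) (n : nat).
Local Notation E := 'rV[R]_n.
Local Notation mu := (borel_lebesgue R n).

Lemma norm_coord_le (x : E) (i : 'I_n) : `|x ord0 i| <= `|x|.
Proof.
have /mapP[j Hj ->] : `|x ord0 i| \in [seq `|x y.1 y.2| | y : 'I_1 * 'I_n].
  by apply/mapP; exists (ord0, i) => //=; rewrite mem_enum.
by rewrite [leRHS]/Num.norm /= mx_normrE; apply/bigmax_geP; right => /=; exists j.
Qed.

Lemma borel_measurable_ball (c : R) :
  measurable ([set x | `|(x : E)| <= c] : set (borel_rV R n)).
Proof.
rewrite -[X in measurable X]setCK; apply: measurableC; apply: borel_rV_open.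
rewrite (_ : ~` _ = (fun x : E => `|x|) @^-1` [set r | c < r]).
  by apply: open_comp; [move=> x _; exact: norm_continuous|exact: open_gt].
by apply/seteqP; split => x /=; rewrite ltNge => /negP.
Qed.

Lemma borel_lebesgue_cube (a b : R) : a <= b ->
  mu [set v | forall i, `[a, b]%classic ((v : E) ord0 i)] = ((b - a) ^+ n)%:E.
Proof.
move=> ab.
rewrite (borel_lebesgue_box (A := fun=> `[a, b]%classic))//.
rewrite (eq_bigr (fun=> (b - a)%:E)); last first.
  move=> i _; rewrite lebesgue_measure_itv/= lte_fin.
  by move: ab; rewrite le_eqVlt => /predU1P[->|->]; rewrite ?ltxx ?subrr// EFinB.
elim: n => [|m IH]; first by rewrite big_ord0 expr0.
by rewrite big_ord_recl IH exprS EFinM.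
Qed.

Lemma borel_lebesgue_ball_fin (c : R) : (mu [set x | `|(x : E)| <= c]%R < +oo)%E.
Proof.
have [c0|c0] := leP 0 c; last first.
  rewrite (_ : [set x | _] = set0) ?measure0 ?ltry//.
  by apply/seteqP; split => x //=; rewrite leNgt (lt_le_trans c0).
apply: (@le_lt_trans _ _ (((c - (- c)) ^+ n)%:E)); last exact: ltry.
rewrite -borel_lebesgue_cube; last by rewrite ge0_cp.
apply: le_measure; rewrite ?inE.
- exact: borel_measurable_ball.
- by apply: (@measurable_box R n (fun=> `[- c, c]%classic)) => i; exact: measurable_itv.
- move=> x /= xc i; rewrite /= in_itv/= -ler_norml.
  exact: le_trans (norm_coord_le _ _) xc.
Qed.

End balls.

Section quotients.
Context (R : realType) (n : nat).
Local Notation E := 'rV[R]_n.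
Local Notation T := (borel_rV R n).
Local Notation mu := (borel_lebesgue R n).
Implicit Types (Omega : set E) (g h : E -> R) (i : 'I_n).
Local Notation e i := (delta_mx ord0 i : E).

Lemma test_function_support Omega g : test_function Omega g ->
  exists2 B : R, 0 < B & forall x, g x != 0 -> `|x| <= B.
Proof.
move=> [_ /compact_bounded[M [_ MB]] _].
exists (Num.max M 0 + 1); first by rewrite ltr_wpDl// le_max lexx orbT.
move=> x gx0; apply: (MB (Num.max M 0 + 1)); last exact: subset_closure.
by rewrite ltr_pwDr// le_max lexx.
Qed.

Lemma test_function_bounded Omega g : test_function Omega g ->
  exists2 M : R, 0 < M & forall x, `|g x| <= M.
Proof.
move=> [sg cg _].
have cg' : continuous g := smooth_continuous sg.
have : compact (g @` closure [set x | g x != 0]).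
  by apply: continuous_compact => //; exact: continuous_subspaceT.
move=> /compact_bounded[M [_ MB]].
exists (Num.max M 0 + 1); first by rewrite ltr_wpDl// le_max lexx orbT.
move=> x; have [->|gx0] := eqVneq (g x) 0.
  by rewrite normr0 addr_ge0// le_max lexx orbT.
apply: (MB (Num.max M 0 + 1)); first by rewrite ltr_pwDr// le_max lexx.
by exists x => //; exact: subset_closure.
Qed.

Lemma is_derive_line g i (x : E) (s : R) : derivable g (x + s *: e i) (e i) ->
  is_derive s 1 (fun s : R => g (x + s *: e i)) (partial i g (x + s *: e i)).
Proof.
move=> dg.
have H : (fun h : R => h^-1 *: (((fun s : R => g (x + s *: e i)) \o shift s) (h *: 1) - g (x + s *:
  e i)))
    = (fun h : R => h^-1 *: ((g \o shift (x + s *: e i)) (h *: e i) - g (x + s *: e i))).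
  apply/funext => h /=; congr (_ *: (g _ - _)).
  by rewrite [h *: 1]mulr1 scalerDl addrCA.
apply: DeriveDef; first by rewrite /derivable H.
by rewrite /partial /derive H.
Qed.

Lemma smooth_lipschitz g i (M : R) : smooth g -> (forall x, `|partial i g x| <= M) ->
  forall (x : E) (t : R), 0 <= t -> `|g (x + t *: e i) - g x| <= M * t.
Proof.
move=> sg gM x t t0.
have D (s : R) : is_derive s 1 (fun s : R => g (x + s *: e i)) (partial i g (x + s *: e i)).
  by apply: is_derive_line; exact: smooth_derivable.
have cg : {within `[0, t], continuous (fun s : R => g (x + s *: e i))}.
  apply: continuous_subspaceT => s.
  have [ds _] := D s.
  by apply: differentiable_continuous; exact/derivable1_diffP.
have [c _] := MVT_segment t0 (fun s _ => D s) cg.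
rewrite scale0r addr0 subr0 => ->.
by rewrite normrM (ger0_norm t0) ler_wpM2r.
Qed.

End quotients.

(** * Translations of test functions and the Faber-Krahn inequality *)

Lemma cvg_EFin_comp (R : realType) (F : R -> R) (u : nat -> R) (l : R) : {for l, continuous F} ->
  u k @[k --> \oo] --> l -> (F (u k))%:E @[k --> \oo] --> (F l)%:E.
Proof.
move=> cF ul; apply: cvg_EFin; first exact: nearW.
exact: (@continuous_cvg _ _ _ _ _ u F l cF ul).
Qed.

Section quotients_limit.
Context (R : realType) (n : nat).
Local Notation E := 'rV[R]_n.
Local Notation T := (borel_rV R n).
Local Notation mu := (borel_lebesgue R n).
Implicit Types (Omega : set E) (g h : E -> R) (i : 'I_n).
Local Notation e i := (delta_mx ord0 i : E).

Definition dquot g i (h : R) (x : E) : R := h^-1 * (g (x + h *: e i) - g x).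

Lemma cvg_dquot g i (x : E) (h : nat -> R) : derivable g x (e i) ->
  (forall k, h k != 0) -> h k @[k --> \oo] --> 0 ->
  dquot g i (h k) x @[k --> \oo] --> partial i g x.
Proof.
move=> dg h0 hc.
pose q (h : R) := h^-1 *: ((g \o shift x) (h *: e i) - g x).
rewrite (_ : (fun k => _) = q \o h); last first.
  by apply/funext => k; rewrite /= /q /dquot [x + _]addrC.
exact: (cvgr_dnbhsP q 0 (partial i g x)).1 dg h (conj h0 hc).
Qed.

Lemma continuous_shift g (h : E) : continuous g -> continuous (fun x : E => g (x + h)).
Proof.
move=> cg x; apply: (@continuous_comp _ _ _ (fun x : E => x + h) g); last exact: cg.
by apply: (@continuousD _ _ _ (fun x : E => x) (fun=> h)); [exact: cvg_id|exact: cst_continuous].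
Qed.

Lemma continuous_dquot g i (h : R) : continuous g -> continuous (dquot g i h).
Proof.
move=> cg x.
have H1 : {for x, continuous (fun _ : E => h^-1 : R)} by exact: cst_continuous.
have H2 := continuousB (@continuous_shift g (h *: e i) cg x) (cg x).
exact: (continuousM H1 H2).
Qed.

Lemma integrable_ball (C B : R) :
  mu.-integrable setT (fun x : T => (C * \1_[set x | `|(x : E)| <= B] x)%:E).
Proof.
pose K : set T := [set x | `|(x : E)| <= B].
have mK : measurable K by exact: borel_measurable_ball.
rewrite -/K; apply/integrableP; split.
  apply/measurable_EFinP; apply: measurable_funM => //; exact: measurable_cst.
rewrite (eq_integral (fun x => (`|C| * \1_K x)%:E)); last first.
  by move=> x _; rewrite abse_EFin normrM [X in _ * X]ger0_norm.
rewrite (integralZl_indic _ (fun=> K))//; last by move=> H; exfalso; move: H; rewrite ltNge normr_ge0.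
rewrite integral_indic// setIT.
by rewrite lte_mul_pinfty// ?lee_fin// borel_lebesgue_ball_fin.
Qed.

Lemma integrable_bounded_support g (C B : R) : continuous g ->
  (forall x, `|g x| <= C) -> (forall x, g x != 0 -> `|x| <= B) ->
  mu.-integrable setT (fun x : T => (g x)%:E).
Proof.
move=> cg gC gB; apply: le_integrable (integrable_ball C B) => //.
  by apply/measurable_EFinP; exact: continuous_borel_measurable.
move=> x _ /=; rewrite lee_fin.
have [->|gx0] := eqVneq (g x) 0; first by rewrite normr0.
rewrite indicE mem_set/=; last exact: gB.
by rewrite mulr1 (le_trans (gC x))// ler_norm.
Qed.

Lemma integrable_test_function Omega g : test_function Omega g ->
  mu.-integrable setT (fun x : T => (g x)%:E).
Proof.
move=> tg; have [B _ gB] := test_function_support tg.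
have [C _ gC] := test_function_bounded tg.
apply: integrable_bounded_support gC gB.
exact/smooth_continuous/(test_function_smooth tg).
Qed.

Lemma integral_translation (h : E) (g : T -> \bar R) : measurable_fun setT g ->
  (\int[mu]_x g ((x : E) + h)%R = \int[mu]_x g x)%E.
Proof.
move=> mg; rewrite integralE [RHS]integralE.
have mp : measurable_fun setT g^\+%E by exact: measurable_funepos.
have mn : measurable_fun setT g^\-%E by exact: measurable_funeneg.
rewrite -(ge0_integral_translation h mp (funepos_ge0 g)) -(ge0_integral_translation h mn
  (funeneg_ge0 g)).
by congr (_ - _)%E; apply: eq_integral => x _; rewrite ?funeposE ?funenegE.
Qed.

(** Dominated convergence: by the mean value theorem the quotients are bounded by [M], and [F 0 = 0]
    confines the integrands to a ball that contains the support of [g] enlarged by the largest step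
    [t]. The identity and the square are the two instances of [F] in use. *)
Lemma cvg_integral_dquot Omega g i (F : R -> R) (C M t : R) :
  test_function Omega g -> (forall x, `|partial i g x| <= M) ->
  continuous F -> F 0 = 0 -> (forall y, `|y| <= M -> `|F y| <= C) -> 0 < t ->
  (\int[mu]_x (F (dquot g i (t / k.+1%:R) x))%:E)%E @[k --> \oo] -->
  (\int[mu]_x (F (partial i g x))%:E)%E.
Proof.
move=> tg gM cF F0 FC t0; have [B _ gB] := test_function_support tg.
have sg := test_function_smooth tg.
have cg := smooth_continuous sg.
have tk0 k : 0 < t / k.+1%:R by rewrite divr_gt0.
have [] // := @dominated_convergence _ T R mu setT measurableT
  (fun k x => (F (dquot g i (t / k.+1%:R) x))%:E) (fun x => (F (partial i g x))%:E)
  (fun x : T => (C * \1_[set x | `|(x : E)| <= B + t * `|e i|] x)%:E).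
- move=> k; apply/measurable_EFinP; apply: continuous_borel_measurable => x.
  by apply: (@continuous_comp _ _ _ (dquot g i _) F); [exact: continuous_dquot|exact: cF].
- apply/measurable_EFinP; apply: continuous_borel_measurable => x.
  apply: (@continuous_comp _ _ _ (partial i g) F); last exact: cF.
  exact/smooth_continuous/smooth_partial.
- apply: aeW => x _.
  have H : dquot g i (t / k.+1%:R) x @[k --> \oo] --> partial i g x.
    apply: cvg_dquot; first exact: smooth_derivable.
      by move=> k; rewrite gt_eqF.
    rewrite -[X in _ --> X](mulr0 t); apply: cvgM; first exact: cvg_cst.
    exact: cvg_harmonic.
  exact: (cvg_EFin_comp (cF (partial i g x)) H).
- exact: integrable_ball.
- apply: aeW => x k _ /=; rewrite lee_fin.
  have qM : `|dquot g i (t / k.+1%:R) x| <= M.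
    rewrite /dquot normrM ger0_norm; last by rewrite invr_ge0 ltW.
    rewrite mulrC ler_pdivrMr//; exact: smooth_lipschitz (ltW (tk0 k)).
  have [q0|q0] := eqVneq (dquot g i (t / k.+1%:R) x) 0.
    rewrite q0 F0 normr0 mulr_ge0//.
    by rewrite (le_trans _ (FC 0 _))// normr0 (le_trans _ (gM x)).
  rewrite indicE mem_set ?mulr1 ?FC//=.
  have [gx0|gx0] := eqVneq (g x) 0; last first.
    by rewrite (le_trans (gB _ gx0))// lerDl mulr_ge0// ltW.
  have : g (x + (t / k.+1%:R) *: e i) != 0.
    by apply: contraNneq q0 => gx; rewrite /dquot gx0 gx subrr mulr0.
  move/gB => H; rewrite -[x in `|x|](addrK ((t / k.+1%:R) *: e i)).
  rewrite (le_trans (ler_normB _ _))// lerD// normrZ ler_wpM2r//.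
  rewrite ger0_norm ?(ltW (tk0 k))// ler_pdivrMr// ler_peMr ?(ltW t0)//.
  by rewrite (_ : 1 = 1%:R)// ler_nat.
Qed.

End quotients_limit.

Section consequences.
Context (R : realType) (n : nat).
Local Notation E := 'rV[R]_n.
Local Notation T := (borel_rV R n).
Local Notation mu := (borel_lebesgue R n).
Implicit Types (Omega : set E) (g h : E -> R) (i : 'I_n).
Local Notation e i := (delta_mx ord0 i : E).

(** Translation invariance makes every difference quotient integrate to 0, and this passes to the
    limit. *)
Lemma integral_partial Omega g i : test_function Omega g ->
  (\int[mu]_x (partial i g x)%:E = 0)%E.
Proof.
move=> tg; have sg := test_function_smooth tg; have cg := smooth_continuous sg.
have [M M0 gM] := test_function_bounded (test_function_partial i tg).
have := @cvg_integral_dquot R n Omega g i idfun M M 1 tg gM _ erefl _ ltr01.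
move=> /(_ (fun=> cvg_id) (fun (y : R) (H : `|y| <= M) => H)).
rewrite (_ : (fun k : nat => _) = fun=> 0%E).
  by move=> /cvg_unique -/(_ _ _ (cvg_cst _)) ->.
apply/funext => k; set h := 1 / _ => /=; rewrite /dquot.
have ig := integrable_test_function tg.
have mg : measurable_fun setT (fun x : T => (g x)%:E) by case/integrableP: ig.
have igh : mu.-integrable setT (fun x : T => (g ((x : E) + h *: e i))%:E).
  apply/integrableP; split.
    apply/measurable_EFinP; apply: continuous_borel_measurable.
    exact: continuous_shift.
  have mag : measurable_fun setT (fun x : T => `|(g x)%:E|%E) by exact: measurableT_comp.
  rewrite (integral_translation (h *: e i) mag).
  by case/integrableP: ig.
rewrite (_ : (fun x => _) = (fun x : T => (h^-1)%:E * ((g ((x : E) + h *: e i))%:E - (g x)%:E))%E)//.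
rewrite integralZl//; last exact: integrableB.
rewrite integralB// (integral_translation (h *: e i) mg) subee ?mule0//.
exact: integrable_fin_num.
Qed.

Lemma sume_cst (N : nat) (c : \bar R) : (0 <= c)%E -> (\sum_(j < N) c = N%:R%:E * c)%E.
Proof.
move=> c0; elim: N => [|N IH]; first by rewrite big_ord0 mul0e.
by rewrite big_ord_recr/= IH -natr1 EFinD ge0_muleDl ?lee_fin// mul1e.
Qed.

(** Cauchy-Schwarz against the constant sequence 1. *)
Lemma sqr_sum_le (N : nat) (a : nat -> R) :
  (\sum_(i < N) a i) ^+ 2 <= N%:R * \sum_(i < N) (a i) ^+ 2.
Proof.
elim: N => [|N IH]; first by rewrite !big_ord0 expr0n mulr0.
rewrite !big_ord_recr/=; set S := \sum_(i < N) _; set Q := \sum_(i < N) _.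
rewrite -natr1.
have Q0 : 0 <= Q by apply: sumr_ge0 => i _; exact: sqr_ge0.
case: N => [|N] in S Q IH Q0 *; first by rewrite /S /Q !big_ord0; lra.
have N0 : 0 < N.+1%:R :> R by [].
move: IH; rewrite -/S -/Q; move: N0 Q0; generalize (N.+1%:R : R) S Q (a N.+1) => {S Q} r S Q b r0 Q0 SQ.
(* Expand [(S - r b)^2 >= 0] and use [S^2 <= r Q]. The factor [r] is cancelled next, which is why
   the empty sum was treated apart. *)
have H : 0 <= r * (Q + r * b ^+ 2 - 2 * S * b).
  have : 0 <= (S - r * b) ^+ 2 by exact: sqr_ge0.
  nra.
by move: H; rewrite pmulr_rge0//; nra.
Qed.

(* Splitting the shift into [k + 1] equal steps bounds the left-hand side by
   difference quotients of step [t / (k + 1)]; then [k] tends to infinity. *)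
Lemma integral_shift_sqr_le Omega g i (t : R) : test_function Omega g -> 0 <= t ->
  (\int[mu]_x ((g (x + t *: e i)%R - g x) ^+ 2)%:E <=
   (t ^+ 2)%:E * \int[mu]_x (partial i g x ^+ 2)%:E)%E.
Proof.
move=> tg; rewrite le_eqVlt => /predU1P[<-|t0].
  rewrite expr0n mul0e (eq_integral (fun=> 0%E)) ?integral0//.
  by move=> x _; rewrite scale0r addr0 subrr expr0n.
have sg := test_function_smooth tg; have cg := smooth_continuous sg.
have [M M0 gM] := test_function_bounded (test_function_partial i tg).
have := @cvg_integral_dquot R n Omega g i (fun y => y ^+ 2) (M ^+ 2) M t tg gM _ _ _ t0.
have H1 : continuous (fun y : R => y ^+ 2) by move=> y; exact: exprn_continuous.
have H2 y : `|y| <= M -> `|y ^+ 2| <= M ^+ 2.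
  by move=> yM; rewrite normrX lerXn2r ?nnegrE// ltW.
move=> /(_ H1 (expr0n _ _) H2) H3.
have mF (h : R) : measurable_fun setT (fun x : T => ((g ((x : E) + h *: e i) - g x) ^+ 2)%:E).
  apply/measurable_EFinP; apply: measurable_funX.
  apply: measurable_funB; apply: continuous_borel_measurable => //.
  exact: continuous_shift.
have H4 k : (\int[mu]_x ((g ((x : E) + t *: e i)%R - g x) ^+ 2)%:E <=
  (t ^+ 2)%:E * \int[mu]_x (dquot g i (t / k.+1%:R) x ^+ 2)%:E)%E.
  set h := t / _; pose N := k.+1.
  have hN : h * N%:R = t by rewrite /h mulfVK.
  have h0 : 0 < h by rewrite divr_gt0.
  pose d (j : nat) (x : E) := g (x + (j.+1%:R * h) *: e i) - g (x + (j%:R * h) *: e i).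
  have dE j x : d j x = g (x + (j%:R * h) *: e i + h *: e i) - g (x + (j%:R * h) *: e i).
    by rewrite /d -addrA -scalerDl -natr1 mulrDl mul1r.
  have md j : measurable_fun setT (fun x : T => (d j x ^+ 2)%:E).
    apply/measurable_EFinP; apply: measurable_funX.
    by apply: measurable_funB; apply: continuous_borel_measurable; exact: continuous_shift.
  apply: (@le_trans _ _ (\int[mu]_x (N%:R%:E * \sum_(j < N) (d j x ^+ 2)%:E))%E).
    apply: ge0_le_integral => //.
    - by move=> x _; rewrite lee_fin sqr_ge0.
    - by apply: measurable_funeM; apply: emeasurable_sum.
    - move=> x _; rewrite sumEFin -EFinM lee_fin; apply: le_trans (sqr_sum_le N (fun j => d j x)).
      rewrite -(big_mkord xpredT (fun j => d j x)) telescope_sumr//.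
      by rewrite mul0r scale0r addr0 [_ * h]mulrC hN.
  rewrite ge0_integralZl//; last 2 first.
  - exact: emeasurable_sum.
  - by move=> x _; apply: sume_ge0 => j _; rewrite lee_fin sqr_ge0.
  rewrite ge0_integral_sum//; last by move=> j x _; rewrite lee_fin sqr_ge0.
  (* The [N] squared increments are translates of a single one, so they have equal integrals. The
     factor [N] of Cauchy-Schwarz and the [N] summands then cancel against [h^2 = (t / N)^2]. *)
  rewrite (eq_bigr (fun=> \int[mu]_x ((g ((x : E) + h *: e i)%R - g x) ^+ 2)%:E)%E); last first.
    move=> j _; rewrite -[RHS](integral_translation ((j%:R * h) *: e i) (mF h)).
    by apply: eq_integral => x _; rewrite dE.
  have -> : (\int[mu]_x ((g ((x : E) + h *: e i)%R - g x) ^+ 2)%:E =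
      (h ^+ 2)%:E * \int[mu]_x (dquot g i h x ^+ 2)%:E)%E.
    rewrite -ge0_integralZl//; last 3 first.
    - apply/measurable_EFinP; apply: measurable_funX; apply: continuous_borel_measurable.
      exact: continuous_dquot.
    - by move=> x _; rewrite lee_fin sqr_ge0.
    - by rewrite lee_fin sqr_ge0.
    apply: eq_integral => x _; rewrite -EFinM -exprMn /dquot mulVKf//.
    by rewrite gt_eqF.
  rewrite sume_cst; last first.
    by apply: mule_ge0; rewrite ?lee_fin ?sqr_ge0// integral_ge0// => x _; rewrite lee_fin sqr_ge0.
  rewrite !muleA -!EFinM.
  by rewrite (_ : N%:R * N%:R * h ^+ 2 = t ^+ 2)// -hN; ring.
have H5 : (((t ^+ 2)%:E * \int[mu]_x (dquot g i (t / k.+1%:R) x ^+ 2)%:E)%E @[k --> \oo]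
    --> ((t ^+ 2)%:E * \int[mu]_x (partial i g x ^+ 2)%:E)%E) by exact: cvgeZl.
by apply: cvge_ge H5; exact: nearW.
Qed.

End consequences.

Section levels.
Context d (T : measurableType d) (R : realType) (D : set T) (f : T -> R) (c : R).
Hypotheses (mD : measurable D) (mf : measurable_fun D f).

Let mn : measurable_fun D (fun x => `|f x| : measurableTypeR R).
Proof. exact: (measurableT_comp (@normr_measurable R setT) mf). Qed.

Lemma measurable_level_ge : measurable (D `&` [set x | c <= `|f x|]).
Proof.
rewrite (_ : [set x | _] = (fun x => `|f x|) @^-1` `[c, +oo[); first exact: mn.
by apply/seteqP; split => x /=; rewrite in_itv/= andbT.
Qed.

Lemma measurable_level_gt : measurable (D `&` [set x | c < `|f x|]).
Proof.
rewrite (_ : [set x | _] = (fun x => `|f x|) @^-1` `]c, +oo[); first exact: mn.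
by apply/seteqP; split => x /=; rewrite in_itv/= andbT.
Qed.

End levels.

Section faber_krahn.
Context (R : realType) (n : nat).
Local Notation E := 'rV[R]_n.
Local Notation T := (borel_rV R n).
Local Notation mu := (borel_lebesgue R n).
Implicit Types (Omega : set E) (g : E -> R) (i : 'I_n).
Local Notation e i := (delta_mx ord0 i : E).

(** The shift is performed one coordinate at a time through the partial shifts [p j]. Cauchy-Schwarz
    over the [n] legs gives the factor [n], and each leg is, up to a translation, a shift of length
    at most [r] along one axis. *)
Lemma integral_shift_cube_le Omega g (r : R) (h : E) : test_function Omega g ->
  (forall i, `[0, r]%classic (h ord0 i)) ->
  (\int[mu]_x ((g ((x : E) + h)%R - g x) ^+ 2)%:E <=
   (n%:R * r ^+ 2)%:E * \sum_(i < n) \int[mu]_x (partial i g x ^+ 2)%:E)%E.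
Proof.
move=> tg hr; have sg := test_function_smooth tg; have cg := smooth_continuous sg.
pose p (j : nat) : E := \row_i (if (i < j)%N then h ord0 i else 0).
have pS (j : 'I_n) : p j.+1 = h ord0 j *: e j + p j.
  apply/rowP => i; rewrite !mxE eqxx/= ltnS leq_eqVlt.
  have [->|ij] := eqVneq i j; first by rewrite eqxx ltnn mulr1 addr0.
  by rewrite val_eqE (negbTE ij) mulr0 add0r.
have p0 : p 0%N = 0 by apply/rowP => i; rewrite !mxE.
have pn : p n = h by apply/rowP => i; rewrite !mxE ltn_ord.
pose d (j : nat) (x : E) := g (x + p j.+1) - g (x + p j).
have cs (a : E) : continuous (fun x : E => g (x + a)) by exact: continuous_shift.
have md j : measurable_fun setT (fun x : T => (d j x ^+ 2)%:E).
  apply/measurable_EFinP; apply: measurable_funX.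
  by apply: measurable_funB; apply: continuous_borel_measurable; exact: cs.
apply: (@le_trans _ _ (\int[mu]_x (n%:R%:E * \sum_(j < n) (d j x ^+ 2)%:E))%E).
  apply: ge0_le_integral => //.
  - by move=> x _; rewrite lee_fin sqr_ge0.
  - apply/measurable_EFinP; apply: measurable_funX.
    by apply: measurable_funB; apply: continuous_borel_measurable => //; exact: cs.
  - by apply: measurable_funeM; apply: emeasurable_sum.
  - move=> x _; rewrite sumEFin -EFinM lee_fin.
    apply: le_trans (sqr_sum_le n (fun j => d j x)).
    rewrite -(big_mkord xpredT (fun j => d j x)) (telescope_sumr (fun j => g ((x : E) + p j)))//.
    by rewrite p0 pn addr0.
rewrite ge0_integralZl//; last 2 first.
- exact: emeasurable_sum.
- by move=> x _; apply: sume_ge0 => j _; rewrite lee_fin sqr_ge0.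
rewrite ge0_integral_sum//; last by move=> j x _; rewrite lee_fin sqr_ge0.
rewrite EFinM -muleA; apply: lee_wpmul2l; first by rewrite lee_fin.
rewrite ge0_sume_distrr; last first.
  by move=> i _; apply: integral_ge0 => x _; rewrite lee_fin sqr_ge0.
apply: lee_sum => i _.
have /andP[h0 hi] : 0 <= h ord0 i <= r by have := hr i; rewrite /= in_itv.
have := integral_shift_sqr_le i tg h0.
have mF : measurable_fun setT (fun x : T => ((g ((x : E) + h ord0 i *: e i) - g x) ^+ 2)%:E).
  apply/measurable_EFinP; apply: measurable_funX.
  by apply: measurable_funB; apply: continuous_borel_measurable => //; exact: cs.
rewrite -(integral_translation (p i) mF) => H.
apply: (@le_trans _ _ ((h ord0 i ^+ 2)%:E * \int[mu]_x (partial i g x ^+ 2)%:E)%E).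
  apply: le_trans H; rewrite le_eqVlt; apply/orP; left; apply/eqP.
  by apply: eq_integral => x _; rewrite /d pS addrA [(x : E) + _ + _]addrAC.
apply: lee_wpmul2r; first by apply: integral_ge0 => x _; rewrite lee_fin sqr_ge0.
by rewrite lee_fin lerXn2r// nnegrE (le_trans h0).
Qed.

Lemma measurable_row_add : measurable_fun setT (fun q : T * T => ((q.1 : E) + (q.2 : E)) : T).
Proof.
apply: measurable_fun_borel_rVP => i.
rewrite (_ : (fun _ => _) = (fun q : T * T => ((q.1 : E) ord0 i : measurableTypeR R) + ((q.2 : E)
  ord0 i : measurableTypeR R))); last first.
  by apply/funext => v; rewrite mxE.
by apply: measurable_funD; apply: (measurableT_comp (measurable_coor i)).
Qed.

(* Average [|g (x + h) - g x|^2] over [h] in a cube of volume [2 N]: where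
   [|g x| >= 1], at least half of the translates satisfy [|g (x + h)| < 1 / 2]. *)
Lemma faber_krahn_test Omega g (N : R) : test_function Omega g -> (0 < n)%N -> 0 < N ->
  (mu [set x | 2^-1 <= `|g x|]%R <= N%:E)%E ->
  (mu [set x | 1 <= `|g x|]%R <=
    (8 * n%:R * ((2 * N) `^ (n%:R^-1)) ^+ 2)%:E * \sum_(i < n) \int[mu]_x (partial i g x ^+ 2)%:E)%E.
Proof.
move=> tg n0 N0 BN; have sg := test_function_smooth tg; have cg := smooth_continuous sg.
set S := (\sum_(i < n) _)%E; set r := (2 * N) `^ _.
have S0 : (0 <= S)%E.
  by apply: sume_ge0 => i _; apply: integral_ge0 => x _; rewrite lee_fin sqr_ge0.
have r0 : 0 <= r by exact: powR_ge0.
have rn : r ^+ n = 2 * N.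
  by rewrite -powR_mulrn// /r -powRrM mulVf ?powRr1// ?mulr_ge0 ?ltW// pnatr_eq0 -lt0n.
pose Q : set T := [set v | forall i, `[0, r]%classic ((v : E) ord0 i)].
have muQ : mu Q = (2 * N)%:E by rewrite borel_lebesgue_cube// subr0 rn.
have mQ : measurable Q by apply: (@measurable_box R n (fun=> `[0, r]%classic)) => i; exact:
  measurable_itv.
have mg : measurable_fun setT (g : T -> measurableTypeR R) by exact: continuous_borel_measurable.
have mlev (c : R) : measurable ([set x | c <= `|g x|] : set T).
  by rewrite -[X in measurable X]setTI; exact: (measurable_level_ge c measurableT mg).
pose A : set T := [set x | 1 <= `|g x|]; pose B : set T := [set x | 2^-1 <= `|g x|].
have mA : measurable A by exact: mlev.
have mB : measurable B by exact: mlev.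
pose F (q : T * T) := (\1_A q.1 * \1_Q q.2 * (g ((q.1 : E) + (q.2 : E)) - g q.1) ^+ 2)%:E.
have F0 q : (0 <= F q)%E by rewrite lee_fin mulr_ge0// sqr_ge0.
have mF : measurable_fun setT F.
  apply/measurable_EFinP; apply: measurable_funM.
    by apply: measurable_funM; apply: measurableT_comp.
  have m1 := measurableT_comp mg measurable_row_add.
  have m2 : measurable_fun setT (g \o (@fst T T)) by exact: measurableT_comp mg (@measurable_fst _
    _ T T).
  by apply: measurable_funX; exact: (measurable_funB m1 m2).
(* For [x] in [A], the [h] in [Q] with [x + h] outside [B] have measure at least [2 N - N], and each
   contributes at least [(1 - 1/2)^2]. *)
have low : ((N / 4)%:E * mu A <= \int[mu]_x \int[mu]_h F (x, h))%E.
  rewrite -[A]setIT -integral_indic// -ge0_integralZl//; last 2 first.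
    by apply/measurable_EFinP.
    by rewrite lee_fin divr_ge0// ltW.
  apply: ge0_le_integral => //.
  - by move=> x _; rewrite -EFinM lee_fin mulr_ge0// divr_ge0// ltW.
  - by apply: measurable_funeM; apply/measurable_EFinP.
  - exact: (measurable_fun_fubini_tonelli_F F mF).
  move=> x _; rewrite indicE; case: (boolP (x \in A)) => [/set_mem xA|_]; last first.
    by rewrite mule0; apply: integral_ge0.
  rewrite mule1.
  pose Bx : set T := [set h | B ((h : E) + (x : E))].
  have mBx : measurable Bx.
    by rewrite -[X in measurable X]setTI; exact: measurable_translation.
  have muBx : (mu Bx <= N%:E)%E by rewrite borel_lebesgue_translation.
  have QBx : (N%:E <= mu (Q `\` Bx))%E.
    rewrite measureD//; last by rewrite [X in (X < _)%E]muQ ltry.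
    rewrite [X in (_ <= X - _)%E]muQ leeBrDr; last first.
      rewrite ge0_fin_numE// (le_lt_trans _ (ltry (2 * N)))// -muQ.
      by apply: le_measure; rewrite ?inE//; exact: measurableI.
    rewrite (_ : 2 * N = N + N); last by ring.
    rewrite EFinD leeD2l// (le_trans _ muBx)//.
    by apply: le_measure; rewrite ?inE//; exact: measurableI.
  apply: (@le_trans _ _ (\int[mu]_h (4^-1 * \1_(Q `\` Bx) h)%:E)%E).
    rewrite (integralZl_indic _ (fun=> Q `\` Bx))//; last 2 first.
      by rewrite invr_lt0 ltNge ler0n.
      exact: measurableD.
    rewrite integral_indic//; last exact: measurableD.
    by rewrite setIT EFinM muleC; apply: lee_wpmul2l.
  apply: ge0_le_integral => //.
  - apply/measurable_EFinP; apply: measurable_funM => //.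
    by apply: measurable_indic; exact: measurableD.
  - exact: (measurableT_comp mF (measurable_pair1 _)).
  move=> h _; rewrite lee_fin [\1_(Q `\` Bx) h]indicE.
  case: (boolP (h \in _)) => [/set_mem[Qh nBh]|_]; last first.
    by rewrite mulr0 mulr_ge0// sqr_ge0.
  rewrite /= !indicE !mem_set// !mul1r mulr1.
  move: xA nBh; rewrite /A /Bx /B /= => xA /negP; rewrite -ltNge addrC => nBh.
  have d := lerB_dist (g x) (g ((x : E) + (h : E))).
  rewrite -[X in _ <= X]real_normK ?num_real// distrC.
  have H : 2^-1 <= `|g x - g ((x : E) + (h : E))| by lra.
  by rewrite (_ : 4^-1 = 2^-1 ^+ 2); [rewrite lerXn2r ?nnegrE|field].
(* In the other order of integration each [h] in [Q] contributes at most the bound of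
   [integral_shift_cube_le]. Dividing [2 N n r^2] by [N / 4] produces the constant [8 n r^2]. *)
have up : (\int[mu]_h \int[mu]_x F (x, h) <= (2 * N)%:E * ((n%:R * r ^+ 2)%:E * S))%E.
  have K0 : (0 <= (n%:R * r ^+ 2)%:E * S)%E.
    by apply: mule_ge0 => //; rewrite lee_fin mulr_ge0// sqr_ge0.
  rewrite -muQ -[Q]setIT -integral_indic// -ge0_integralZr//; last exact/measurable_EFinP.
  apply: ge0_le_integral => //.
  - by move=> h _; apply: integral_ge0.
  - exact: (measurable_fun_fubini_tonelli_G F mF).
  - by apply: emeasurable_funM => //; exact/measurable_EFinP.
  move=> h _; rewrite indicE; case: (boolP (h \in Q)) => [/set_mem hQ|hQ]; last first.
    rewrite mul0e (eq_integral (fun=> 0%E)) ?integral0// => x _.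
    by rewrite /F /= [\1_Q h]indicE (negbTE hQ) mulr0 mul0r.
  rewrite mul1e; apply: le_trans (integral_shift_cube_le tg hQ).
  apply: ge0_le_integral => //.
  - exact: (measurableT_comp mF (measurable_pair2 _)).
  - apply/measurable_EFinP; apply: measurable_funX; apply: measurable_funB => //.
    by apply: continuous_borel_measurable; exact: continuous_shift.
  - move=> x _; rewrite lee_fin ler_piMl ?sqr_ge0//.
have := le_trans low; rewrite fubini_tonelli// => /(_ _ up).
rewrite -/A => H.
have N4 : 0 < N / 4 by rewrite divr_gt0.
rewrite -(@lee_pmul2l _ (N / 4)%:E) ?lte_fin//; apply: (le_trans H).
by rewrite !muleA -!EFinM le_eqVlt; apply/orP; left; apply/eqP; congr (_%:E * _)%E; field.
Qed.

End faber_krahn.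

(** * Uniform approximation by polynomials *)

Section weierstrass.
Context {R : realType}.

(** Heine's theorem from the covering form of compactness. Only [x] is confined to the segment: half
    of each radius is kept in reserve to reach [y]. *)
Lemma segment_unif_continuous (F : R -> R) (a b eps : R) : continuous F -> 0 < eps ->
  exists2 d : R, 0 < d &
    forall x y, x \in `[a, b] -> `|y - x| < d -> `|F y - F x| < eps.
Proof.
move=> cF e0.
have /compact_near_coveringP K := @segment_compact R a b.
have : \forall d \near (0:R)^'+, `[a, b]%classic `<=`
    (fun x => forall y, `|y - x| < d -> `|F y - F x| < eps).
  apply: K => x _.
  have e2 : 0 < eps / 2 by rewrite divr_gt0.
  have /cvgrPdist_lt/(_ _ e2)/nbhs_ballP[h /= h0 hF] := cF x.
  have h2 : 0 < h / 2 by rewrite divr_gt0.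
  exists (ball x (h / 2), [set d | d < h / 2]) => /=.
    split; first exact: nbhsx_ballx.
    exact: nbhs_right_lt.
  move=> [x' d] /= [xx' dh] y yx'.
  have H1 : `|F x - F x'| < eps / 2.
    by apply: hF; apply: le_ball xx'; rewrite ler_pdivrMr// ler_peMr ?ltW// ltr1n.
  have H2 : `|F x - F y| < eps / 2.
    apply: hF; rewrite /ball/= (_ : x - y = (x - x') - (y - x')); last by ring.
    rewrite (le_lt_trans (ler_normB _ _))// (splitr h) ltrD// (lt_trans yx')//.
  rewrite (_ : F y - F x' = (F x - F x') - (F x - F y)); last by ring.
  by rewrite (le_lt_trans (ler_normB _ _))// (splitr eps) ltrD.
move=> H.
near (0:R)^'+ => d; exists d => // x y.
move=> xab; have : `[a, b]%classic `<=` (fun x => forall y, `|y - x| < d -> `|F y - F x| < eps).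
  by near: d.
by move=> /(_ x xab); exact.
Unshelve. all: by end_near. Qed.

(* The Bernstein polynomial of degree [N] with values [phi k] in place of
   [f (k / N)]; Pascal's rule replaces the explicit binomial sum. *)
Fixpoint bernstein (N : nat) (phi : nat -> R) : {poly R} :=
  if N is N'.+1 then 'X * bernstein N' (phi \o S) + (1 - 'X) * bernstein N' phi
  else (phi 0%N)%:P.

Lemma bernsteinS N phi x : (bernstein N.+1 phi).[x] =
  x * (bernstein N (phi \o S)).[x] + (1 - x) * (bernstein N phi).[x].
Proof. by rewrite /= hornerD !hornerM hornerD hornerN hornerX hornerC. Qed.

Lemma bernstein_lin N (c a : R) phi psi x :
  (bernstein N (fun k => c + a * phi k - psi k)).[x] =
  c + a * (bernstein N phi).[x] - (bernstein N psi).[x].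
Proof.
elim: N phi psi => [|N IH] phi psi; first by rewrite /= !hornerC.
by rewrite !bernsteinS -/(bernstein _ _) IH (IH (phi \o S) (psi \o S)); ring.
Qed.

(** Each step of the recursion is a convex combination, so positivity at the nodes is inherited. *)
Lemma bernstein_ge0 N phi x : 0 <= x <= 1 -> (forall k, (k <= N)%N -> 0 <= phi k) ->
  0 <= (bernstein N phi).[x].
Proof.
move=> /andP[x0 x1]; elim: N phi => [|N IH] phi p0; first by rewrite /= hornerC p0.
by rewrite bernsteinS addr_ge0// mulr_ge0// ?subr_ge0// IH// => k kN; apply: p0 => //=; exact: leqW.
Qed.

(** The second moment about [c] of a binomial variable with parameters [N] and [x]: variance plus
    squared bias. Shifting the nodes by one replaces [c] by [c - 1], so the induction runs over all
    [c]. *)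
Lemma bernstein_variance N (c : R) x :
  (bernstein N (fun k => (k%:R - c) ^+ 2)).[x] = N%:R * (x * (1 - x)) + (N%:R * x - c) ^+ 2.
Proof.
elim: N c => [|N IH] c; first by rewrite /= hornerC; ring.
rewrite bernsteinS IH (_ : _ \o _ = (fun k : nat => (k%:R - (c - 1)) ^+ 2)); last first.
  by apply/funext => k /=; rewrite -natr1; ring.
by rewrite IH -natr1; ring.
Qed.

(** The operator is linear, positive and reproduces constants, so a two-sided bound at the nodes
    passes to the polynomial. *)
Lemma bernstein_close N phi psi (e a v : R) x : 0 <= x <= 1 ->
  (forall k, (k <= N)%N -> `|phi k - v| <= e + a * psi k) ->
  `|(bernstein N phi).[x] - v| <= e + a * (bernstein N psi).[x].
Proof.
move=> x01 H.
have B0 : (bernstein N (fun=> 0)).[x] = 0.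
  by elim: N {H} => [|N IH]; rewrite ?bernsteinS/= ?hornerC// IH !mulr0 addr0.
rewrite ler_norml; apply/andP; split; rewrite -subr_ge0.
  rewrite (_ : _ - _ = (e - v) + a * (bernstein N psi).[x] - (bernstein N (fun k => 0 + (-1) * phi
    k - 0)).[x]); last first.
    by rewrite bernstein_lin B0; ring.
  rewrite -bernstein_lin; apply: bernstein_ge0 => // k kN.
  by have := H _ kN; rewrite ler_norml => /andP[]; lra.
rewrite (_ : _ - _ = (e + v) + a * (bernstein N psi).[x] - (bernstein N phi).[x]); last by ring.
rewrite -bernstein_lin; apply: bernstein_ge0 => // k kN.
by have := H _ kN; rewrite ler_norml => /andP[]; lra.
Qed.

(** Chebyshev's argument: [|F y - F x| <= eps / 2 + K (y - x)^2] at the nodes [y], and the Bernstein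
    average of [(y - x)^2] is a variance, [x (1 - x)] divided by the degree. *)
Lemma weierstrass01 (F : R -> R) (eps : R) : continuous F -> 0 < eps ->
  exists p : {poly R}, forall x : R, 0 <= x <= 1 -> `|p.[x] - F x| <= eps.
Proof.
move=> cF e0; have e2 : 0 < eps / 2 by rewrite divr_gt0.
have [d d0 Fd] := @segment_unif_continuous F 0 1 (eps / 2) cF e2.
have [M FM] : exists M : R, forall x : R, 0 <= x <= 1 -> `|F x| <= M.
  have : compact (F @` `[0, 1]%classic).
    by apply: continuous_compact; [exact: continuous_subspaceT|exact: segment_compact].
  move=> /compact_bounded[M [_ MB]]; exists (M + 1) => x x01.
  by apply: (MB (M + 1)); [rewrite ltrDl|exists x => //=; rewrite in_itv].
have M0 : 0 <= M by rewrite (le_trans _ (FM 0 _))// lexx ler01.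
(* With this [K], the crude bound [2 M] on [|F y - F x|] is below [K (y - x)^2] once
   [|y - x| >= d]. *)
pose K := 2 * M / d ^+ 2.
have K0 : 0 <= K by apply: divr_ge0; [exact: mulr_ge0|exact: sqr_ge0].
have FK (x y : R) : 0 <= x <= 1 -> 0 <= y <= 1 -> `|F y - F x| <= eps / 2 + K * (y - x) ^+ 2.
  move=> x01 y01; have [xy|xy] := ltP `|y - x| d.
    by rewrite (le_trans (ltW (Fd x y _ xy)))// lerDl mulr_ge0// sqr_ge0.
  rewrite (le_trans (ler_normB _ _))// (le_trans (lerD (FM _ y01) (FM _ x01)))//.
  have dxy : d ^+ 2 <= (y - x) ^+ 2.
    by rewrite -[leRHS]real_normK ?num_real// lerXn2r// nnegrE ltW.
  suff : 2 * M <= K * (y - x) ^+ 2 by lra.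
  rewrite /K mulrAC ler_pdivlMr ?exprn_gt0// ler_wpM2l//; exact: mulr_ge0.
have [N NK] : exists N : nat, K / N.+1%:R <= eps / 2.
  exists (Num.truncn (K / (eps / 2))); rewrite ler_pdivrMr// mulrC -ler_pdivrMr//.
  by apply: ltW; exact: Num.Theory.truncnS_gt.
exists (bernstein N.+1 (fun k => F (k%:R / N.+1%:R))) => x x01.
have N0 : 0 < N.+1%:R :> R by [].
apply: le_trans (_ : eps / 2 + (K / N.+1%:R ^+ 2) * (bernstein N.+1 (fun k => (k%:R - N.+1%:R * x)
  ^+ 2)).[x] <= _).
  apply: bernstein_close => // k kN.
  have k01 : 0 <= (k%:R / N.+1%:R : R) <= 1.
    by rewrite divr_ge0//= ler_pdivrMr// mul1r ler_nat.
  apply: le_trans (FK _ _ x01 k01) _.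
  rewrite lerD2l -mulrA ler_wpM2l// le_eqVlt; apply/orP; left; apply/eqP.
  by rewrite -exprVn -exprMn; congr (_ ^+ 2); rewrite mulrBr mulrA mulVf ?gt_eqF// mul1r mulrC.
rewrite bernstein_variance subrr expr0n addr0 [leRHS]splitr lerD2l.
apply: le_trans NK; have /andP[x0 x1] := x01.
have : x * (1 - x) <= 1 by nra.
move=> H; rewrite (_ : _ * _ = K / N.+1%:R * (x * (1 - x))); last first.
  by rewrite expr2 invfM !mulrA; congr (_ * _ * _); rewrite mulfVK ?gt_eqF.
by rewrite ler_piMr// divr_ge0.
Qed.

Lemma weierstrass (F : R -> R) (M eps : R) : continuous F -> 0 < M -> 0 < eps ->
  exists p : {poly R}, forall x : R, `|x| <= M -> `|p.[x] - F x| <= eps.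
Proof.
move=> cF M0 e0.
have cl : continuous (fun x : R => F (2 * M * x - M)).
  move=> x; apply: (@continuous_comp _ _ _ (fun x : R => 2 * M * x - M) F); last exact: cF.
  apply: (@continuousB _ _ _ (fun x : R => 2 * M * x) (fun=> M)); last exact: cst_continuous.
  exact: (@continuousM _ _ (fun=> 2 * M) id x (@cst_continuous _ _ _ x) (@cvg_id _ _)).
have [p pF] := weierstrass01 cl e0.
exists (p \Po ((2 * M)^-1 *: 'X + (2^-1)%:P)) => x xM.
rewrite horner_comp hornerD hornerZ hornerX hornerC.
have := pF ((2 * M)^-1 * x + 2^-1).
rewrite (_ : 2 * M * _ - M = x); last by field; rewrite gt_eqF.
apply; move: xM; rewrite ler_norml => /andP[x1 x2].
rewrite (_ : _ + _ = (x + M) / (2 * M)); last by field; rewrite gt_eqF.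
by rewrite divr_ge0 ?ler_pdivrMr ?mulr_ge0 ?mulr_gt0//=; lra.
Qed.

End weierstrass.

(** * Convergence in L^2 and the chain rule in W_0^{1,2} *)

Lemma ereal_cvg0P (R : realType) (a : nat -> \bar R) : (forall k, 0 <= a k)%E ->
  a k @[k --> \oo] --> 0%E <-> forall e : R, 0 < e -> \forall k \near \oo, (a k <= e%:E)%E.
Proof.
move=> a0; split=> [ac e e0|H]; last first.
  apply/fine_cvgP; split.
    near=> k; rewrite ge0_fin_numE//; apply: (@le_lt_trans _ _ 1%:E); last exact: ltry.
    by near: k; exact: H.
  apply/cvgrPdist_le => e e0; near=> k.
  have : (a k <= e%:E)%E by near: k; exact: H.
  move=> ake; rewrite sub0r normrN ger0_norm ?fine_ge0//= -lee_fin fineK//.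
  by rewrite ge0_fin_numE// (le_lt_trans ake)// ltry.
have Ho : nbhs (0%E : \bar R) [set y | (y < e%:E)%E].
  by apply: open_nbhs_nbhs; split; [exact: open_ereal_lt_ereal|rewrite /= lte_fin].
have H : \forall k \near \oo, (a k < e%:E)%E by exact: ac _ Ho.
by near=> k; apply: ltW; near: k; exact: H.
Unshelve. all: by end_near. Qed.

Section L2.
Context d (T : measurableType d) (R : realType).
Variables (mu : {measure set T -> \bar R}) (D : set T).
Hypothesis mD : measurable D.
Implicit Types (F G : nat -> T -> R) (f g h : T -> R).

(** Applied to squared differences this is convergence in L^2 without a norm or a square root;
    positivity keeps sums and majorants within the theory of nonnegative integrals. *)
Definition nullseq F := [/\ forall k, measurable_fun D (F k),
  forall k x, 0 <= F k x & (\int[mu]_(x in D) (F k x)%:E)%E @[k --> \oo] --> 0%E].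

Definition sqint f := measurable_fun D f /\ (\int[mu]_(x in D) (f x ^+ 2)%:E < +oo)%E.

Lemma integral_ge0_fin f : (forall x, 0 <= f x) -> (0 <= \int[mu]_(x in D) (f x)%:E)%E.
Proof. by move=> f0; apply: integral_ge0 => x _; rewrite lee_fin. Qed.

Lemma nullseq_le F G : nullseq G -> (forall k, measurable_fun D (F k)) ->
  (forall k x, 0 <= F k x) -> (forall k x, D x -> F k x <= G k x) -> nullseq F.
Proof.
move=> [mG G0 Gc] mF F0 FG; split=> //.
apply/ereal_cvg0P => [k|e e0]; first exact: integral_ge0_fin.
move/ereal_cvg0P : Gc => /(_ (fun k => integral_ge0_fin (G0 k)) e e0).
apply: filterS => k; apply: le_trans.
apply: ge0_le_integral => //; try exact/measurable_EFinP.
- by move=> x _; rewrite lee_fin.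
- by move=> x Dx; rewrite lee_fin FG.
Qed.

Lemma nullseqD F G : nullseq F -> nullseq G -> nullseq (fun k x => F k x + G k x).
Proof.
move=> [mF F0 Fc] [mG G0 Gc]; split.
- by move=> k; apply: measurable_funD.
- by move=> k x; rewrite addr_ge0.
rewrite (_ : (fun k => _) = (fun k => \int[mu]_(x in D) (F k x)%:E + \int[mu]_(x in D) (G k
  x)%:E)%E); last first.
  apply/funext => k; rewrite -ge0_integralD//; try exact/measurable_EFinP.
  - by move=> x _; rewrite lee_fin.
  - by move=> x _; rewrite lee_fin.
by rewrite -[X in _ --> X]adde0; apply: cvgeD.
Qed.

Lemma nullseqZ (c : R) F : 0 <= c -> nullseq F -> nullseq (fun k x => c * F k x).
Proof.
move=> c0 [mF F0 Fc]; split.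
- by move=> k; apply: measurable_funM => //; exact: measurable_cst.
- by move=> k x; rewrite mulr_ge0.
rewrite (_ : (fun k => _) = (fun k => c%:E * \int[mu]_(x in D) (F k x)%:E)%E); last first.
  apply/funext => k; rewrite -ge0_integralZl//; first exact/measurable_EFinP.
  by move=> x _; rewrite lee_fin.
by rewrite -[X in _ --> X](mule0 c%:E); apply: cvgeZl.
Qed.

Lemma nullseq_cst (c : nat -> R) f : (forall k, 0 <= c k) -> c k @[k --> \oo] --> 0 ->
  measurable_fun D f -> (forall x, 0 <= f x) -> (\int[mu]_(x in D) (f x)%:E < +oo)%E ->
  nullseq (fun k x => c k * f x).
Proof.
move=> c0 cc mf f0 foo; split.
- by move=> k; apply: measurable_funM => //; exact: measurable_cst.
- by move=> k x; rewrite mulr_ge0.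
rewrite (_ : (fun k => _) = (fun k => (c k * fine (\int[mu]_(x in D) (f x)%:E))%:E)%E); last first.
  apply/funext => k; rewrite EFinM fineK ?ge0_fin_numE ?integral_ge0_fin//.
  rewrite -ge0_integralZl//; [exact/measurable_EFinP|by move=> x _; rewrite lee_fin|by rewrite lee_fin].
apply: cvg_EFin; first exact: nearW.
rewrite -[X in _ --> X](mul0r (fine (\int[mu]_(x in D) (f x)%:E)%E)).
by apply: cvgM => //; exact: cvg_cst.
Qed.

Lemma sqint_measurable f : sqint f -> measurable_fun D (fun x => f x ^+ 2).
Proof. by case=> mf _; exact: measurable_funX. Qed.

Lemma sqint_le f (c : R) g : sqint g -> measurable_fun D f ->
  (forall x, D x -> `|f x| <= c * `|g x|) -> sqint f.
Proof.
move=> sg mf fg; split=> //.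
apply: (@le_lt_trans _ _ (\int[mu]_(x in D) ((c ^+ 2)%:E * (g x ^+ 2)%:E))%E).
  apply: ge0_le_integral => //.
  - by move=> x _; rewrite lee_fin sqr_ge0.
  - by apply/measurable_EFinP; exact: measurable_funX.
  - by apply: measurable_funeM; apply/measurable_EFinP; exact: sqint_measurable.
  move=> x Dx; rewrite -EFinM lee_fin -exprMn.
  rewrite -[leLHS]real_normK ?num_real// -[leRHS]real_normK ?num_real// normrM.
  rewrite lerXn2r ?nnegrE ?mulr_ge0//.
  by rewrite (le_trans (fg x Dx))// ler_wpM2r// ler_norm.
rewrite ge0_integralZl//; last 3 first.
- by apply/measurable_EFinP; exact: sqint_measurable.
- by move=> x _; rewrite lee_fin sqr_ge0.
- by rewrite lee_fin sqr_ge0.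
by rewrite lte_mul_pinfty ?lee_fin ?sqr_ge0//; case: sg.
Qed.

Lemma sqintZ (c : R) f : sqint f -> sqint (fun x => c * f x).
Proof.
move=> sf; apply: (sqint_le (c := `|c|) sf) => [|x _]; last by rewrite normrM.
by apply: measurable_funM; [exact: measurable_cst|case: sf].
Qed.

Lemma integrable_sqintM f g : sqint f -> sqint g ->
  mu.-integrable D (fun x => (f x * g x)%:E).
Proof.
move=> sf sg; have [mf fo] := sf; have [mg go] := sg.
apply: (@le_integrable _ _ _ _ _ mD _ (fun x => ((f x ^+ 2)%:E + (g x ^+ 2)%:E))%E).
- by apply/measurable_EFinP; exact: measurable_funM.
- move=> x _; rewrite -EFinD !abse_EFin lee_fin [leRHS]ger0_norm ?addr_ge0 ?sqr_ge0//.
  rewrite ler_norml; apply/andP; split; have := sqr_ge0 (f x - g x); have := sqr_ge0 (f x + g x); nra.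
- apply: integrableD => //; apply/integrableP; split.
  + by apply/measurable_EFinP; exact: sqint_measurable.
  + by under eq_integral => x _ do rewrite abse_EFin ger0_norm ?sqr_ge0//.
  + by apply/measurable_EFinP; exact: sqint_measurable.
  + by under eq_integral => x _ do rewrite abse_EFin ger0_norm ?sqr_ge0//.
Qed.

(** A weighted Young inequality replaces Hoelder's: [|F h| <= F^2 / dl + dl h^2], where [dl] is so
    small that the second term integrates to at most [e / 2], and the first term is eventually as
    small. *)
Lemma nullseqM F h : (forall k, measurable_fun D (F k)) ->
  nullseq (fun k x => F k x ^+ 2) -> sqint h -> nullseq (fun k x => `|F k x * h x|).
Proof.
move=> mF nF [mh ho]; split.
- by move=> k; apply: measurableT_comp => //; exact: measurable_funM.
- by [].
apply/ereal_cvg0P => [k|e e0]; first exact: integral_ge0_fin.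
set H := (\int[mu]_(x in D) (h x ^+ 2)%:E)%E in ho.
have H0 : (0 <= H)%E by apply: integral_ge0_fin => x; exact: sqr_ge0.
have Hf : H \is a fin_num by rewrite ge0_fin_numE.
have fH0 : 0 <= fine H by exact: fine_ge0.
pose dl := e / 2 / (fine H + 1).
have dl0 : 0 < dl by rewrite !divr_gt0// ltr_wpDl.
have : nullseq (fun k x => dl^-1 * F k x ^+ 2) by apply: nullseqZ; rewrite ?invr_ge0 ?ltW.
move=> [mG G0 /ereal_cvg0P -/(_ (fun k => integral_ge0_fin (G0 k)))].
have e2 : 0 < e / 2 by rewrite divr_gt0.
move=> /(_ _ e2); apply: filterS => k Fk.
apply: (@le_trans _ _ (\int[mu]_(x in D) ((dl^-1 * F k x ^+ 2)%:E + dl%:E * (h x ^+ 2)%:E))%E).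
  apply: ge0_le_integral => //.
  - by apply/measurable_EFinP; apply: measurableT_comp => //; exact: measurable_funM.
  - apply: emeasurable_funD; first exact/measurable_EFinP.
    by apply: measurable_funeM; apply/measurable_EFinP; exact: measurable_funX.
  move=> x _; rewrite -EFinM -EFinD lee_fin.
  have -> : dl^-1 * F k x ^+ 2 = dl * (dl^-1 * F k x) ^+ 2.
    by rewrite exprMn !expr2 !mulrA divff ?gt_eqF// mul1r.
  have -> : `|F k x * h x| = dl * `|(dl^-1 * F k x) * h x|.
    by rewrite -{1}(gtr0_norm dl0) -normrM !mulrA divff ?gt_eqF// mul1r.
  rewrite -mulrDr ler_wpM2l ?(ltW dl0)//; set a := dl^-1 * _.
  rewrite ler_norml; apply/andP; split; have := sqr_ge0 (a - h x); have := sqr_ge0 (a + h x); nra.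
rewrite ge0_integralD//; last 4 first.
- by move=> x _; rewrite lee_fin.
- exact/measurable_EFinP.
- by move=> x _; rewrite -EFinM lee_fin mulr_ge0 ?sqr_ge0// ltW.
- by apply: measurable_funeM; apply/measurable_EFinP; exact: measurable_funX.
rewrite ge0_integralZl//; last 3 first.
- by apply/measurable_EFinP; exact: measurable_funX.
- by move=> x _; rewrite lee_fin sqr_ge0.
- by rewrite lee_fin ltW.
rewrite [in leRHS](splitr e) EFinD leeD// -/H -(fineK Hf) -EFinM lee_fin.
rewrite /dl mulrAC ler_pdivrMr ?ltr_wpDl// ler_wpM2l ?(ltW e2)//.
by rewrite lerDl.
Qed.

Lemma cvg_integralM F f h : (forall k, sqint (F k)) -> sqint f -> sqint h ->
  nullseq (fun k x => (F k x - f x) ^+ 2) ->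
  (\int[mu]_(x in D) (F k x * h x)%:E)%E @[k --> \oo] --> (\int[mu]_(x in D) (f x * h x)%:E)%E.
Proof.
move=> sF sf sh nF.
have mB k : measurable_fun D (fun x => F k x - f x).
  by apply: measurable_funB; [case: (sF k)|case: sf].
have [mN N0 Nc] := nullseqM mB nF sh.
have If : (\int[mu]_(x in D) (f x * h x)%:E)%E \is a fin_num.
  by apply: integrable_fin_num => //; exact: integrable_sqintM.
have IF k : (\int[mu]_(x in D) (F k x * h x)%:E)%E \is a fin_num.
  by apply: integrable_fin_num => //; exact: integrable_sqintM.
apply/sube_cvg0 => //; apply/cvg_abse0P; apply/ereal_cvg0P => // e e0.
move/ereal_cvg0P : Nc => /(_ (fun k => integral_ge0_fin (N0 k)) e e0).
apply: filterS => k; apply: le_trans.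
rewrite -integralB//; try exact: integrable_sqintM.
apply: (le_trans (le_abse_integral _ _ _)) => //.
  apply/measurable_EFinP/measurable_funB; apply: measurable_funM; do ?[by case: (sF k)|by case:
    sf|by case: sh].
by rewrite le_eqVlt; apply/orP; left; apply/eqP; apply: eq_integral => x _; rewrite /= mulrBl.
Qed.

Lemma nneseries_cvg0 (a : nat -> \bar R) : (forall k, 0 <= a k)%E ->
  (\sum_(k <oo) a k < +oo)%E -> a k @[k --> \oo] --> 0%E.
Proof.
move=> a0 aoo.
have H := @nneseries_tail_cvg R a xpredT aoo (fun k _ => a0 k).
apply: (squeeze_cvge _ _ H); last exact: cvg_cst.
apply: nearW => N; rewrite a0/=.
have := @nneseries_lim_ge R a xpredT N N.+1 (fun k _ _ => a0 k).
by rewrite big_nat1.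
Qed.

(** Indices at which the integrals are at most [2^-(k+1)] make the series of the functions
    integrable, hence finite almost everywhere, and the terms of a convergent series tend to 0. The
    condition [k <= s k] is enough to carry limits over to [s]. *)
Lemma nullseq_subseq F : nullseq F -> exists s : nat -> nat, (forall k, (k <= s k)%N) /\
  {ae mu, forall x, D x -> F (s k) x @[k --> \oo] --> 0}.
Proof.
move=> [mF F0 Fc].
have /choice[s Hs] (k : nat) : exists N, (k <= N)%N /\
    (\int[mu]_(x in D) (F N x)%:E <= (1 / (2 ^ k.+1)%:R)%:E)%E.
  have k0 : 0 < 1 / (2 ^ k.+1)%:R :> R by rewrite divr_gt0// ltr0n expn_gt0.
  have H := (ereal_cvg0P (fun k => integral_ge0_fin (F0 k))).1 Fc _ k0.
  have [N [H1 H2]] := filter_ex (filterI (nbhs_infty_ge k) H).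
  by exists N.
exists s; split; first by move=> k; have [] := Hs k.
have mFE k : measurable_fun D (fun x => (F (s k) x)%:E) by exact/measurable_EFinP.
have F0E k x : D x -> (0 <= (F (s k) x)%:E)%E by rewrite lee_fin.
pose S x := (\sum_(k <oo) (F (s k) x)%:E)%E.
have S0 x : D x -> (0 <= S x)%E by move=> Dx; apply: nneseries_ge0 => k _ _; exact: F0E.
have mS : measurable_fun D S.
  exact: (@ge0_emeasurable_sum _ T R D (fun k x => (F (s k) x)%:E) xpredT (fun k x Dx _ => F0E k x
    Dx) (fun k _ => mFE k)).
have iS : mu.-integrable D S.
  apply/integrableP; split=> //.
  rewrite (eq_integral S); last by move=> x /set_mem Dx; rewrite gee0_abs// S0.
  rewrite integral_nneseries//.
  apply: (@le_lt_trans _ _ 1%:E); last exact: ltry.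
  apply: le_trans (epsilon_trick0 xpredT ler01); apply: lee_nneseries => k.
    by move=> _ _; apply: integral_ge0 => x Dx; exact: F0E.
  by move=> _; have [_] := Hs k.
have := integrable_ae mD iS; apply: filterS => x + Dx => /(_ Dx) Sx.
have := @nneseries_cvg0 (fun k => (F (s k) x)%:E) (fun k => F0E k x Dx).
move=> /(_ _)/fine_cvgP[|_ //].
by move: Sx; rewrite ge0_fin_numE ?S0.
Qed.

Lemma nullseq_dominated F g : (forall k, measurable_fun D (F k)) -> (forall k x, 0 <= F k x) ->
  measurable_fun D g -> (\int[mu]_(x in D) (g x)%:E < +oo)%E ->
  (forall k x, D x -> F k x <= g x) ->
  {ae mu, forall x, D x -> F k x @[k --> \oo] --> 0} -> nullseq F.
Proof.
move=> mF F0 mg goo Fg Fae; split=> //.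
have g0 x : D x -> 0 <= g x by move=> Dx; apply: le_trans (Fg 0%N x Dx).
have [] // := @dominated_convergence _ T R mu D mD (fun k x => (F k x)%:E) (fun=> 0%E) (fun x => (g
  x)%:E).
- by move=> k; exact/measurable_EFinP.
- apply: filterS Fae => x + Dx => /(_ Dx) Fx.
  by apply: cvg_EFin => //; exact: nearW.
- apply/integrableP; split; first exact/measurable_EFinP.
  rewrite (eq_integral (fun x => (g x)%:E))// => x /set_mem Dx.
  by rewrite gee0_abs// lee_fin g0.
- by apply: aeW => x k Dx; rewrite gee0_abs lee_fin// Fg.
by move=> _ _; rewrite integral0.
Qed.

End L2.

Lemma mvt_le (R : realType) (f df : R -> R) (M e y z : R) :
  (forall s : R, is_derive s 1 f (df s)) -> (forall s, `|s| <= M -> `|df s| <= e) ->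
  `|y| <= M -> `|z| <= M -> `|f y - f z| <= e * `|y - z|.
Proof.
move=> Df dfe; wlog yz : y z / y <= z.
  move=> H yM zM; have [/H|/ltW/H] := leP y z; first exact.
  by rewrite distrC [`|y - z|]distrC; exact.
move=> yM zM.
have cf : {within `[y, z], continuous f}.
  apply: continuous_subspaceT => s; have [ds _] := Df s.
  by apply: differentiable_continuous; exact/derivable1_diffP.
have [c] := MVT_segment yz (fun s _ => Df s) cf.
rewrite in_itv/= => /andP[yc cz] H.
rewrite distrC H normrM [`|y - z|]distrC ler_wpM2r//; apply: dfe.
move: yM zM; rewrite !ler_norml => /andP[? ?] /andP[? ?]; apply/andP; split; lra.
Qed.

(** Serves to bound [(P (phi) - psi (u))^2] in the chain rule: [e] is the error of the polynomial
    derivative, [Y = |phi|], [a = |u|] and [b = |phi - u|]. Both terms on the right give null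
    sequences, the first because [e] tends to 0. *)
Lemma sqr_chain_le (R : realFieldType) (e B a b Y : R) : 0 <= e -> 0 <= B -> 0 <= b ->
  0 <= Y -> e * Y <= e * a + b ->
  (e * Y + B * b) ^+ 2 <= 4 * e ^+ 2 * a ^+ 2 + (4 + 2 * B ^+ 2) * b ^+ 2.
Proof.
move=> e0 B0 b0 y0 H5.
have H6 : 0 <= e * Y by rewrite mulr_ge0.
have H8 : (e * Y + B * b) ^+ 2 <= 2 * (e * Y) ^+ 2 + 2 * (B * b) ^+ 2.
  by have := sqr_ge0 (e * Y - B * b); nra.
have H9 : (e * Y) ^+ 2 <= (e * a + b) ^+ 2.
  by rewrite lerXn2r// nnegrE (le_trans H6).
have H10 : (e * a + b) ^+ 2 <= 2 * (e * a) ^+ 2 + 2 * b ^+ 2.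
  by have := sqr_ge0 (e * a - b); nra.
apply: (le_trans H8); move: (le_trans H9 H10); rewrite !exprMn; lra.
Qed.

(** The same for gradients: [q = P' (phi) - psi' (phi)], [b = psi' (phi)], [p] is a partial
    derivative of [phi], [D] that of [u], and [z = (psi' (phi) - psi' (u)) D]. The left-hand side is
    then the square of [P' (phi) p - psi' (u) D]. *)
Lemma grad_chain_le (R : realFieldType) (e B q p b D z : R) : 0 <= e -> e <= 1 ->
  `|q| <= e -> `|b| <= B ->
  (q * p + b * (p - D) + z) ^+ 2 <=
  6 * e ^+ 2 * D ^+ 2 + (6 + 3 * B ^+ 2) * (p - D) ^+ 2 + 3 * z ^+ 2.
Proof.
move=> e0 e1 qe bB.
have q2 : q ^+ 2 <= e ^+ 2.
  by rewrite -[leLHS]real_normK ?num_real// lerXn2r ?nnegrE.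
have b2 : b ^+ 2 <= B ^+ 2.
  by rewrite -[leLHS]real_normK ?num_real// lerXn2r ?nnegrE// (le_trans _ bB).
have e2 : e ^+ 2 <= 1 by rewrite expr_le1.
have p2 : p ^+ 2 <= 2 * D ^+ 2 + 2 * (p - D) ^+ 2.
  by have := sqr_ge0 (p - 2 * D); nra.
have H1 : q ^+ 2 * p ^+ 2 <= e ^+ 2 * (2 * D ^+ 2 + 2 * (p - D) ^+ 2).
  by rewrite ler_pM ?sqr_ge0.
have H2 : b ^+ 2 * (p - D) ^+ 2 <= B ^+ 2 * (p - D) ^+ 2 by rewrite ler_wpM2r ?sqr_ge0.
have H3 : e ^+ 2 * (p - D) ^+ 2 <= (p - D) ^+ 2 by rewrite ler_piMl ?sqr_ge0.
have H4 (x y w : R) : (x + y + w) ^+ 2 <= 3 * x ^+ 2 + 3 * y ^+ 2 + 3 * w ^+ 2.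
  by have := sqr_ge0 (x - y); have := sqr_ge0 (y - w); have := sqr_ge0 (x - w); nra.
apply: (le_trans (H4 _ _ _)); rewrite !exprMn.
clear q2 b2 p2 e2 H4; lra.
Qed.

Lemma cvg_sqrB0 (R : realType) (a : nat -> R) (l : R) :
  (a k - l) ^+ 2 @[k --> \oo] --> 0 -> a k @[k --> \oo] --> l.
Proof.
move=> H; apply/cvgrPdist_lt => e e0.
have e2 : 0 < e ^+ 2 by rewrite exprn_gt0.
move/cvgrPdist_lt : H => /(_ _ e2); apply: filterS => k.
rewrite sub0r normrN ger0_norm ?sqr_ge0// -[X in X < _]real_normK ?num_real// distrC.
by rewrite ltr_pXn2r// nnegrE ltW.
Qed.

Lemma is_derive_continuous (R : realType) (f df : R -> R) :
  (forall s : R, is_derive s 1 f (df s)) -> continuous f.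
Proof.
move=> Df s; have [ds _] := Df s.
by apply: differentiable_continuous; exact/derivable1_diffP.
Qed.

Lemma poly_primitive (R : realType) (q : {poly R}) :
  exists p : {poly R}, p^`() = q /\ p.[0] = 0.
Proof.
exists (\poly_(i < (size q).+1) (if i is j.+1 then q`_j / j.+1%:R else 0)); split.
  apply/polyP => i; rewrite coef_deriv coef_poly ltnS.
  case: ltnP => iq /=; first by rewrite -[LHS]mulr_natr mulfVK// pnatr_eq0.
  by rewrite mul0rn nth_default.
by rewrite horner_coef0 coef_poly.
Qed.

Lemma cvg_subseq (T : topologicalType) (a : nat -> T) (l : T) (s : nat -> nat) :
  (forall k, (k <= s k)%N) -> a k @[k --> \oo] --> l -> a (s k) @[k --> \oo] --> l.
Proof.
move=> sk al; apply: (@cvg_comp _ _ _ s a \oo \oo _ _ al).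
move=> P [N _ NP]; exists N => // k /= Nk; apply: NP => /=.
exact: leq_trans Nk (sk k).
Qed.

Section omega.
Context (R : realType) (n : nat).
Local Notation E := 'rV[R]_n.
Local Notation T := (lebesgue_space R n).
Local Notation mu := (@lebesgue_rV R n).
Variable Omega : set E.
Hypothesis oO : open Omega.
Implicit Types (g h phi : E -> R) (i : 'I_n).

Lemma measurable_open_lebesgue : measurable (Omega : set T).
Proof. by apply: lebesgue_rV_measurable; exact: borel_rV_open. Qed.
Local Notation mO := measurable_open_lebesgue.

Lemma measurable_continuous_lebesgue h : continuous h -> measurable_fun (Omega : set T) (h : T -> R).
Proof.
move=> ch; apply: measurable_funTS => _ A mA; rewrite setTI; apply: lebesgue_rV_measurable.
rewrite -[X in measurable X]setTI.
exact: (continuous_borel_measurable ch measurableT mA).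
Qed.

Lemma ge0_integral_supp (f : borel_rV R n -> \bar R) : measurable_fun setT f ->
  (forall x, 0 <= f x)%E -> (forall x, ~ Omega x -> f x = 0%E) ->
  (\int[mu]_(x in Omega) f x = \int[borel_lebesgue R n]_x f x)%E.
Proof.
move=> mf f0 fO; rewrite lebesgue_rV_ge0_integral//; last 2 first.
- exact: borel_rV_open.
- exact: measurable_funTS.
rewrite integral_mkcond; apply: eq_integral => x _; rewrite patchE.
by case: ifPn => // /negP xO; rewrite fO// => Ox; apply: xO; exact: mem_set.
Qed.

Lemma integral_supp h : continuous h -> (forall x, ~ Omega x -> h x = 0) ->
  (\int[mu]_(x in Omega) (h x)%:E = \int[borel_lebesgue R n]_x (h x)%:E)%E.
Proof.
move=> ch hO; rewrite integralE [RHS]integralE.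
have mh : measurable_fun setT (fun x : borel_rV R n => (h x)%:E).
  by apply/measurable_EFinP; exact: continuous_borel_measurable.
congr (_ - _)%E; apply: ge0_integral_supp => [||x /hO h0].
- exact: measurable_funepos.
- exact: funepos_ge0.
- by rewrite funeposE h0 maxxx.
- exact: measurable_funeneg.
- exact: funeneg_ge0.
- by rewrite funenegE h0 oppe0 maxxx.
Qed.

Lemma test_function_out g x : test_function Omega g -> ~ Omega x -> g x = 0.
Proof.
move=> [_ _ gO] xO; apply/eqP/negPn/negP => gx; apply: xO; apply: gO.
exact: subset_closure.
Qed.

Lemma test_function_sqint g : test_function Omega g -> sqint mu Omega g.
Proof.
move=> tg; have sg := test_function_smooth tg; have cg := smooth_continuous sg.
split; first exact: measurable_continuous_lebesgue.
have tgg := test_functionM tg sg.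
have -> : (\int[mu]_(x in Omega) (g x ^+ 2)%:E = \int[mu]_(x in Omega) (g x * g x)%:E)%E.
  by apply: eq_integral => x _; rewrite expr2.
rewrite integral_supp; last 2 first.
- by apply: smooth_continuous; exact: smoothM.
- by move=> x xO; rewrite (test_function_out tg xO) mulr0.
have /integrableP[_] := integrable_test_function tgg.
apply: le_lt_trans; rewrite le_eqVlt; apply/orP; left; apply/eqP.
by apply: eq_integral => x _; rewrite abse_EFin ger0_norm// -expr2 sqr_ge0.
Qed.

(** Leibniz's rule, and the vanishing integral of the derivative of [g phi]. *)
Lemma test_function_ibp g phi i : test_function Omega g -> test_function Omega phi ->
  (\int[mu]_(x in Omega) (g x * partial i phi x)%:E =
   - \int[mu]_(x in Omega) (partial i g x * phi x)%:E)%E.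
Proof.
move=> tg tp; have sg := test_function_smooth tg; have sp := test_function_smooth tp.
have s1 := test_function_sqint tg; have s2 := test_function_sqint tp.
have s3 := test_function_sqint (test_function_partial i tg).
have s4 := test_function_sqint (test_function_partial i tp).
have i1 := integrable_sqintM mO s1 s4.
have i2 := integrable_sqintM mO s3 s2.
have mO' := mO; have f1 := integrable_fin_num mO i1; have f2 := integrable_fin_num mO i2.
suff : (\int[mu]_(x in Omega) (g x * partial i phi x)%:E +
  \int[mu]_(x in Omega) (partial i g x * phi x)%:E = 0)%E.
  by rewrite -(fineK f1) -(fineK f2) -EFinD -EFinN => -[/eqP]; rewrite addr_eq0 => /eqP ->.
rewrite -integralD//.
rewrite -(integral_partial i (test_functionM tg sp)) -integral_supp; last 2 first.
- by apply: smooth_continuous; apply: smooth_partial; exact: smoothM.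
- move=> x; apply: test_function_out; apply: test_function_partial.
  exact: test_functionM.
apply: eq_integral => x _; rewrite partialM; last 2 first.
- by move=> y; exact: smooth_derivable.
- by move=> y; exact: smooth_derivable.
by rewrite -EFinD; congr (_%:E); ring.
Qed.

(* [psi \o phi_k] need not be smooth; a polynomial [P] with [P 0 = 0] and
   derivative close to [dpsi] on the range of [phi_k] keeps [P \o phi_k] a test
   function. *)
Lemma sobolev_chain (u : E -> R) (Du : E -> E) (psi dpsi : R -> R) (B : R) :
  sobolev12_0 Omega u Du -> (forall s : R, is_derive s 1 psi (dpsi s)) -> continuous dpsi ->
  (forall s, `|dpsi s| <= B) -> psi 0 = 0 ->
  sobolev12_0 Omega (fun x => psi (u x)) (fun x => dpsi (u x) *: Du x).
Proof.
move=> [[su sDu _] [phi0 [tphi0 L2u0 L2D0]]] Dpsi cdpsi dpsiB psi0; have mO' := mO.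
have B0 : 0 <= B by rewrite (le_trans _ (dpsiB 0)).
have cpsi := is_derive_continuous Dpsi.
have psiB y z : `|psi y - psi z| <= B * `|y - z|.
  by apply: (@mvt_le _ psi dpsi (Num.max `|y| `|z|)) => //; rewrite le_max lexx ?orbT.
have mu_u : measurable_fun (Omega : set T) (u : T -> R) by case: su.
have mDu i : measurable_fun (Omega : set T) (fun x : T => Du x ord0 i) by case: (sDu i).
have mphi k (tk : test_function Omega (phi0 k)) : measurable_fun (Omega : set T) (phi0 k : T -> R).
  exact/measurable_continuous_lebesgue/smooth_continuous/(test_function_smooth tk).
have N0 : nullseq mu Omega (fun k (x : T) => (phi0 k x - u x) ^+ 2).
  split=> [k|k x|]; [|exact: sqr_ge0|exact: L2u0].
  by apply: measurable_funX; apply: measurable_funB => //; exact: mphi.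
(* The term with [dpsi (phi k x) - dpsi (u x)] is treated by dominated convergence, which calls for
   convergence almost everywhere. *)
have [s [sk aes]] := nullseq_subseq mO N0.
pose phi k := phi0 (s k).
have tphi k : test_function Omega (phi k) by exact: tphi0.
have N1 : nullseq mu Omega (fun k (x : T) => (phi k x - u x) ^+ 2).
  case: N0 => m0 p0 c0; split=> [k|k x|]; [exact: m0|exact: p0|].
  exact: (cvg_subseq sk c0).
have mdphi k i : measurable_fun (Omega : set T) (partial i (phi k) : T -> R).
  apply/measurable_continuous_lebesgue/smooth_continuous/smooth_partial.
  exact/(test_function_smooth (tphi k)).
have N2 i : nullseq mu Omega (fun k (x : T) => (partial i (phi k) x - Du x ord0 i) ^+ 2).
  split=> [k|k x|]; [|exact: sqr_ge0|exact: (cvg_subseq sk (L2D0 i))].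
  by apply: measurable_funX; exact: measurable_funB.
have /choice[M HM] k : exists M : R, 0 < M /\ forall x, `|phi k x| <= M.
  by have [M M0 H] := test_function_bounded (tphi k); exists M.
have ek0 k : 0 < k.+1%:R^-1 :> R by rewrite invr_gt0.
have /choice[P HP] k : exists P : {poly R}, P.[0] = 0 /\
    forall y, `|y| <= M k -> `|P^`().[y] - dpsi y| <= k.+1%:R^-1.
  have [q Hq] := weierstrass cdpsi (HM k).1 (ek0 k).
  by have [p [pq p0]] := poly_primitive q; exists p; rewrite pq.
pose g k (x : E) := (P k).[phi k x].
have tg k : test_function Omega (g k).
  by apply: test_function_horner; [exact: tphi|exact: (HP k).1].
have dgE k i x : partial i (g k) x = (P k)^`().[phi k x] * partial i (phi k) x.
  by rewrite /g partial_horner//; exact: test_function_smooth (tphi k).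
have mg k : measurable_fun (Omega : set T) (g k : T -> R).
  exact/measurable_continuous_lebesgue/smooth_continuous/(test_function_smooth (tg k)).
have mdg k i : measurable_fun (Omega : set T) (partial i (g k) : T -> R).
  apply/measurable_continuous_lebesgue/smooth_continuous/smooth_partial.
  exact/(test_function_smooth (tg k)).
(* [P k] and [psi] both vanish at 0, so the mean value theorem for their difference starts from
   0. *)
have gpsi k x : `|g k x - psi (phi k x)| <= k.+1%:R^-1 * `|phi k x|.
  have D (y : R) : is_derive y 1 (fun y => (P k).[y] - psi y) ((P k)^`().[y] - dpsi y).
    exact: is_deriveB.
  have := @mvt_le R _ _ (M k) (k.+1%:R^-1) (phi k x) 0 D (HP k).2 ((HM k).2 x).
  by rewrite (HP k).1 psi0 !subr0 normr0; apply; apply: ltW; exact: (HM k).1.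
have mpsi : measurable_fun (Omega : set T) (fun x : T => psi (u x)).
  by apply: measurableT_comp => //; exact: continuous_measurable_fun.
have mdpsi : measurable_fun (Omega : set T) (fun x : T => dpsi (u x)).
  by apply: measurableT_comp => //; exact: continuous_measurable_fun.
have mdpsik k : measurable_fun (Omega : set T) (fun x : T => dpsi (phi k x)).
  by apply: measurableT_comp; [exact: continuous_measurable_fun|exact: mphi].
have spsi : sqint mu Omega (fun x : T => psi (u x)).
  apply: (sqint_le mO (c := B) su) => // x _.
  by have := psiB (u x) 0; rewrite psi0 !subr0.
have sdpsi i : sqint mu Omega (fun x : T => dpsi (u x) * Du x ord0 i).
  apply: (sqint_le mO (c := B) (sDu i)) => [|x _]; first exact: measurable_funM.
  by rewrite normrM ler_wpM2r.
have harm2 : (k.+1%:R^-1 ^+ 2 : R) @[k --> \oo] --> 0.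
  rewrite -[X in _ --> X](mulr0 0); apply: cvgM; exact: cvg_harmonic.
have N3 : nullseq mu Omega (fun k (x : T) => (g k x - psi (u x)) ^+ 2).
  have Na : nullseq mu Omega (fun k (x : T) => (4 * k.+1%:R^-1 ^+ 2) * (u x ^+ 2)).
    apply: (nullseq_cst mO (c := fun k => 4 * k.+1%:R^-1 ^+ 2)).
    - by move=> k; rewrite mulr_ge0 ?sqr_ge0.
    - by rewrite -[X in _ --> X](mulr0 4); apply: cvgM => //; exact: cvg_cst.
    - exact: measurable_funX.
    - by move=> x; exact: sqr_ge0.
    - by case: su.
  have Nb : nullseq mu Omega (fun k (x : T) => (4 + 2 * B ^+ 2) * ((phi k x - u x) ^+ 2)).
    apply: (nullseqZ mO); [by rewrite addr_ge0 ?mulr_ge0 ?sqr_ge0|exact: N1].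
  apply: (nullseq_le mO (nullseqD mO Na Nb)) => [k|k x|k x _]; last 1 first.
  - pose e : R := k.+1%:R^-1; pose G := g k x; pose y := phi k x.
    have H2 : `|G - psi y| <= e * `|y| by exact: gpsi.
    have H1 := psiB y (u x).
    have e1 : e <= 1 by rewrite invf_le1// ler1n.
    have e0 : 0 < e by exact: ek0.
    rewrite -/G -/y -/e.
    have H3 : (G - psi (u x)) ^+ 2 <= (e * `|y| + B * `|y - u x|) ^+ 2.
      have K0 : 0 <= e * `|y| + B * `|y - u x| by rewrite addr_ge0 ?mulr_ge0 ?(ltW e0).
      rewrite -[leLHS]real_normK ?num_real// lerXn2r ?nnegrE//.
      rewrite (_ : G - _ = (G - psi y) + (psi y - psi (u x))); last by ring.
      by rewrite (le_trans (ler_normD _ _))// lerD.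
    apply: (le_trans H3).
    have H4 : `|y| <= `|u x| + `|y - u x|.
      by rewrite (_ : `|y| = `|u x + (y - u x)|) ?ler_normD//; congr (`|_|); ring.
    have H5 : e * `|y| <= e * `|u x| + `|y - u x|.
      rewrite (le_trans (ler_wpM2l (ltW e0) H4))// mulrDr lerD2l ler_piMl//.
    rewrite -[(u x) ^+ 2]real_normK ?num_real// -[(y - u x) ^+ 2]real_normK ?num_real//.
    by apply: sqr_chain_le => //; exact: ltW.
  - by apply: measurable_funX; exact: measurable_funB.
  - exact: sqr_ge0.
have N4 i : nullseq mu Omega (fun k (x : T) => ((dpsi (phi k x) - dpsi (u x)) * Du x ord0 i) ^+ 2).
  apply: (nullseq_dominated mO (g := fun x : T => 4 * B ^+ 2 * (Du x ord0 i) ^+ 2)) => [k|k x|||k x _|].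
  - apply: measurable_funX; apply: measurable_funM; last exact: mDu.
    exact: (measurable_funB (mdpsik k) mdpsi).
  - exact: sqr_ge0.
  - exact: (measurable_funM (measurable_cst _) (measurable_funX 2 (mDu i))).
  - have [m fo] := sqintZ mO (2 * B) (sDu i).
    apply: le_lt_trans fo; rewrite le_eqVlt; apply/orP; left; apply/eqP.
    by apply: eq_integral => x _; congr (_%:E); ring.
  - rewrite exprMn ler_wpM2r ?sqr_ge0// -[leLHS]real_normK ?num_real//.
    rewrite (_ : 4 * B ^+ 2 = (B + B) ^+ 2); last by ring.
    rewrite lerXn2r ?nnegrE ?addr_ge0// (le_trans (ler_normB _ _))// lerD//.
  - apply: filterS aes => x + Ox => /(_ Ox) cx.
    have cphi : phi k x @[k --> \oo] --> u x by exact: cvg_sqrB0.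
    have c1 : dpsi (phi k x) @[k --> \oo] --> dpsi (u x).
      exact: (@continuous_cvg _ _ _ _ _ (fun k => phi k x) dpsi (u x) (cdpsi _) cphi).
    have c2 : (dpsi (phi k x) - dpsi (u x)) * Du x ord0 i @[k --> \oo]
        --> (dpsi (u x) - dpsi (u x)) * Du x ord0 i.
      apply: cvgM; last exact: cvg_cst.
      by apply: cvgB; [exact: c1|exact: cvg_cst].
    rewrite subrr mul0r in c2.
    by rewrite -[X in _ --> X](mulr0 0); apply: cvgM.
have N5 i : nullseq mu Omega (fun k (x : T) => (partial i (g k) x - dpsi (u x) * Du x ord0 i) ^+ 2).
  have Na : nullseq mu Omega (fun k (x : T) => (6 * k.+1%:R^-1 ^+ 2) * (Du x ord0 i ^+ 2)).
    apply: (nullseq_cst mO (c := fun k => 6 * k.+1%:R^-1 ^+ 2)).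
    - by move=> k; rewrite mulr_ge0 ?sqr_ge0.
    - by rewrite -[X in _ --> X](mulr0 6); apply: cvgM => //; exact: cvg_cst.
    - exact: measurable_funX.
    - by move=> x; exact: sqr_ge0.
    - by case: (sDu i).
  have Nb : nullseq mu Omega (fun k (x : T) => (6 + 3 * B ^+ 2) * ((partial i (phi k) x - Du x ord0
    i) ^+ 2)).
    apply: (nullseqZ mO); [by rewrite addr_ge0 ?mulr_ge0 ?sqr_ge0|exact: N2].
  have Nc := nullseqZ mO (ler0n R 3) (N4 i).
  apply: (nullseq_le mO (nullseqD mO (nullseqD mO Na Nb) Nc)) => [k|k x|k x _].
  - apply: measurable_funX; exact: (measurable_funB (mdg k i) (measurable_funM mdpsi (mDu i))).
  - exact: sqr_ge0.
  - rewrite dgE.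
    have -> : (P k)^`().[phi k x] * partial i (phi k) x - dpsi (u x) * Du x ord0 i =
      ((P k)^`().[phi k x] - dpsi (phi k x)) * partial i (phi k) x +
      dpsi (phi k x) * (partial i (phi k) x - Du x ord0 i) +
      (dpsi (phi k x) - dpsi (u x)) * Du x ord0 i by ring.
    apply: grad_chain_le; [exact: ltW|by rewrite invf_le1// ler1n| |exact: dpsiB].
    by apply: (HP k).2; exact: (HM k).2.
have vE i : (fun x : T => (dpsi (u x) *: Du x) ord0 i) = (fun x : T => dpsi (u x) * Du x ord0 i).
  by apply/funext => x; rewrite mxE.
split; last first.
  exists g; split=> //; first by case: N3.
  by move=> i; rewrite vE; case: (N5 i).
split; [exact: spsi|by move=> i; rewrite vE; exact: sdpsi|].
move=> h i th.
have s1 := test_function_sqint (test_function_partial i th).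
have s2 := test_function_sqint th.
have sg k := test_function_sqint (tg k).
have sdg k := test_function_sqint (test_function_partial i (tg k)).
(* The weak derivative identity holds for the test functions [g k], by parts, and both of its sides
   converge. *)
have L := cvg_integralM mO sg spsi s1 N3.
have Rr := cvg_integralM mO sdg (sdpsi i) s2 (N5 i).
have Rr' : (- \int[mu]_(x in Omega) (partial i (g k) x * h x)%:E)%E @[k --> \oo]
    --> (- \int[mu]_(x in Omega) (dpsi (u x) * Du x ord0 i * h x)%:E)%E by exact: cvgeN.
have LE : (fun k => \int[mu]_(x in Omega) (g k x * partial i h x)%:E)%E =
  (fun k => - \int[mu]_(x in Omega) (partial i (g k) x * h x)%:E)%E.
  by apply/funext => k; exact: test_function_ibp.
rewrite LE in L.
have -> := cvg_unique (@ereal_hausdorff R) L Rr';  congr (- _)%E.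
by apply: eq_integral => x _; rewrite mxE.
Qed.

End omega.

(** * The Faber-Krahn inequality in W_0^{1,2} *)

Section markov.
Context d (T : measurableType d) (R : realType).
Variables (mu : {measure set T -> \bar R}) (D : set T).
Hypothesis mD : measurable D.

(** Chebyshev's inequality at level 1/2, whose square is the factor 1/4. *)
Lemma nullseq_markov (F : nat -> T -> R) : (forall k, measurable_fun D (F k)) ->
  nullseq mu D (fun k x => F k x ^+ 2) -> forall e : R, 0 < e ->
  \forall k \near \oo, (mu (D `&` [set x | 2^-1 <= `|F k x|]%R) <= e%:E)%E.
Proof.
move=> mF [_ F0 Fc] e e0; have e4 : 0 < e / 4 by rewrite divr_gt0.
move/ereal_cvg0P : Fc => /(_ (fun k => integral_ge0_fin mu D (F0 k)) _ e4).
apply: filterS => k Fk; set A := _ `&` _.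
have mA : measurable A by exact: (measurable_level_ge _ mD (mF k)).
have H : ((4^-1)%:E * mu A <= (e / 4)%:E)%E.
  apply: le_trans Fk; rewrite -integral_cst//.
  apply: (@le_trans _ _ (\int[mu]_(x in A) (F k x ^+ 2)%:E)%E).
    apply: ge0_le_integral => [|x _|||x [_ /= Fx]].
    - exact: mA.
    - by rewrite lee_fin.
    - exact: measurable_cst.
    - by apply/measurable_EFinP/measurable_funX; apply: measurable_funS (mF k) => // x [].
    - rewrite lee_fin -[leRHS]real_normK ?num_real//.
      by rewrite (_ : 4^-1 = 2^-1 ^+ 2); [rewrite lerXn2r ?nnegrE|field].
  apply: ge0_subset_integral => //.
  - by apply/measurable_EFinP/measurable_funX.
  - by move=> x _; rewrite lee_fin sqr_ge0.
  - by move=> x [].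
have H4 : (0 <= 4%:E :> \bar R)%E by rewrite lee_fin.
have := lee_wpmul2l H4 H.
by rewrite muleA -!EFinM mulfV// mul1e [4 * _]mulrC mulfVK.
Qed.

(** Pointwise, [2 g^2 + 2 (f - g)^2 - f^2 = (f - 2 g)^2]. This replaces the triangle inequality in
    L^2 at the price of a factor 2. *)
Lemma integral_sqr_le (f g : T -> R) : measurable_fun D f -> measurable_fun D g ->
  (\int[mu]_(x in D) (f x ^+ 2)%:E <= 2%:E * \int[mu]_(x in D) (g x ^+ 2)%:E +
    2%:E * \int[mu]_(x in D) ((f x - g x) ^+ 2)%:E)%E.
Proof.
move=> mf mg.
have sq0 (h : T -> R) (x : T) : (0 <= (h x ^+ 2)%:E)%E by rewrite lee_fin sqr_ge0.
have m1 : measurable_fun D (fun x => (g x ^+ 2)%:E).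
  by apply/measurable_EFinP; exact: measurable_funX.
have m2 : measurable_fun D (fun x => ((f x - g x) ^+ 2)%:E).
  by apply/measurable_EFinP; apply: measurable_funX; exact: measurable_funB.
have sq2 x : (0 <= ((f x - g x) ^+ 2)%:E)%E by exact: (sq0 (fun x => f x - g x)).
rewrite -ge0_integralZl// -ge0_integralZl//.
rewrite -ge0_integralD//; last 4 first.
- by move=> x _; rewrite mule_ge0.
- exact: measurable_funeM.
- by move=> x _; rewrite mule_ge0.
- exact: measurable_funeM.
apply: ge0_le_integral => //.
- by apply/measurable_EFinP; exact: measurable_funX.
- by apply: emeasurable_funD; exact: measurable_funeM.
move=> x _; rewrite -!EFinM -EFinD lee_fin.
by have := sqr_ge0 (f x - 2 * g x); nra.
Qed.

End markov.

Section faber_krahn_sobolev.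
Context (R : realType) (n : nat).
Local Notation E := 'rV[R]_n.
Local Notation T := (lebesgue_space R n).
Local Notation mu := (@lebesgue_rV R n).
Variable Omega : set E.
Hypothesis oO : open Omega.

(** Limit of [faber_krahn_test]. Where [v = 0], [|phi k| >= 1/2] forces [|phi k - v| >= 1/2]; where
    [|v| >= 3/2], [|phi k| < 1] does too. By Chebyshev both exceptional sets become negligible, the
    first one fitting into the margin left by the strict bound on [{v <> 0}]. The constant doubles
    from 8 to 16 through [integral_sqr_le]. *)
Lemma faber_krahn (v : E -> R) (Dv : E -> E) (N : R) : (0 < n)%N -> sobolev12_0 Omega v Dv ->
  0 < N -> (mu (Omega `&` [set x | v x != 0]%R) < N%:E)%E ->
  (mu (Omega `&` [set x | 3 / 2 <= `|v x|]%R) <=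
    (16 * n%:R * ((2 * N) `^ (n%:R^-1)) ^+ 2)%:E *
      \sum_(i < n) \int[mu]_(x in Omega) (Dv x ord0 i ^+ 2)%:E)%E.
Proof.
move=> n0 [[sv sDv _] [phi [tphi L2v L2D]]] N0 vN.
have mO : measurable (Omega : set T) := measurable_open_lebesgue oO.
have mv : measurable_fun (Omega : set T) (v : T -> R) by case: sv.
have mphi k : measurable_fun (Omega : set T) (phi k : T -> R).
  exact: (measurable_continuous_lebesgue (smooth_continuous (test_function_smooth (tphi k)))).
have mB k := measurable_funB (mphi k) mv.
have mdphi i k : measurable_fun (Omega : set T) (partial i (phi k) : T -> R).
  exact: (measurable_continuous_lebesgue (smooth_continuous (smooth_partial i (test_function_smooth
    (tphi k))))).
have mDv i : measurable_fun (Omega : set T) (fun x : T => Dv x ord0 i) by case: (sDv i).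
have N1 : nullseq mu Omega (fun k (x : T) => (phi k x - v x) ^+ 2).
  by split=> [k|k x|]; [exact: (measurable_funX 2 (mB k))|exact: sqr_ge0|exact: L2v].
have N2 i : nullseq mu Omega (fun k (x : T) => (partial i (phi k) x - Dv x ord0 i) ^+ 2).
  by split=> [k|k x|]; [exact: (measurable_funX 2 (measurable_funB (mdphi i k) (mDv i)))|exact:
    sqr_ge0|exact: L2D].
set C := 8 * n%:R * ((2 * N) `^ n%:R^-1) ^+ 2.
have C0 : 0 <= C by apply: mulr_ge0; [exact: mulr_ge0|exact: sqr_ge0].
set S := (\sum_(i < n) _)%E.
have mlev (f : E -> R) c (mf : measurable_fun (Omega : set T) (f : T -> R)) :=
  measurable_level_ge c mO mf.
have phiO k (c : R) : 0 < c -> [set x | c <= `|phi k x|] = Omega `&` [set x | c <= `|phi k x|].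
  move=> c0; apply/seteqP; split=> [x /= cx|x []//]; split=> //.
  apply: contrapT => xO; move: cx.
  by rewrite (test_function_out (tphi k) xO) normr0 leNgt c0.
have mlevB k (c : R) : measurable ([set x | c <= `|phi k x|] : set (borel_rV R n)).
  have := @measurable_level_ge _ (borel_rV R n) R setT (phi k) c measurableT.
  rewrite setTI; apply.
  exact: (continuous_borel_measurable (smooth_continuous (test_function_smooth (tphi k)))).
have mv0 : measurable (Omega `&` [set x | v x != 0] : set T).
  rewrite (_ : [set x | _] = v @^-1` (~` [set 0])); last first.
    by apply/seteqP; split => x /= /eqP.
  by apply: mv => //; exact: measurableC.
have vN' : exists2 d : R, 0 < d & (mu (Omega `&` [set x | v x != 0]%R) + d%:E <= N%:E)%E.
  have f : mu (Omega `&` [set x | v x != 0]) \is a fin_num.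
    by rewrite ge0_fin_numE// (lt_trans vN)// ltry.
  exists (N - fine (mu (Omega `&` [set x | v x != 0]))).
    by rewrite subr_gt0 -lte_fin fineK.
  by rewrite -(fineK f) -EFinD lee_fin/= subrKC.
have [dd dd0 Hd] := vN'.
have FKk : \forall k \near \oo, (mu [set x | 1 <= `|phi k x|]%R <=
    C%:E * \sum_(i < n) \int[mu]_(x in Omega) (partial i (phi k) x ^+ 2)%:E)%E.
  have := nullseq_markov mO mB N1 dd0; apply: filterS => k Hk.
  have := @faber_krahn_test R n Omega (phi k) N (tphi k) n0 N0.
  rewrite -!lebesgue_rV_borel//.
  move=> /(_ _)/le_trans; apply; last first.
    rewrite le_eqVlt; apply/orP; left; apply/eqP; congr (_ * _)%E.
    apply: eq_bigr => i _; rewrite integral_supp//.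
      move=> x; apply: (@continuous_comp _ _ _ (partial i (phi k)) (fun y => y ^+ 2)); last exact:
        exprn_continuous.
      exact: (smooth_continuous (smooth_partial i (test_function_smooth (tphi k)))).
    by move=> x xO; rewrite (test_function_out (test_function_partial i (tphi k)) xO) expr0n.
  apply: le_trans Hd; rewrite phiO//.
  apply: (@le_trans _ _ (mu ((Omega `&` [set x | v x != 0]) `|` (Omega `&` [set x | 2^-1 <= `|phi k
    x - v x|])))).
    apply: le_measure; rewrite ?inE.
    - exact: (mlev _ _ (mphi k)).
    - exact: (measurableU _ _ mv0 (mlev _ _ (mB k))).
    - move=> x [Ox /= px]; have [v0|v0] := eqVneq (v x) 0; [right|left]; split=> //=.
      by rewrite v0 subr0.
  apply: (le_trans (measureU2 _ mv0 (mlev _ _ (mB k)))).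
  exact: leeD2l.
have Ek (e : R) : 0 < e -> \forall k \near \oo, forall i,
    (\int[mu]_(x in Omega) (partial i (phi k) x ^+ 2)%:E <=
    2%:E * \int[mu]_(x in Omega) (Dv x ord0 i ^+ 2)%:E + e%:E)%E.
  move=> e0; apply: filter_forall => i; have e2 : 0 < e / 2 by rewrite divr_gt0.
  case: (N2 i) => m2 p2 /ereal_cvg0P -/(_ (fun k => integral_ge0_fin mu Omega (p2 k)) _ e2).
  apply: filterS => k Hk.
  apply: (le_trans (@integral_sqr_le _ T R mu Omega mO _ _ (mdphi i k) (mDv i))).
  apply: leeD2l; rewrite (_ : e = 2 * (e / 2)); last by field.
  by rewrite EFinM; apply: lee_wpmul2l.
have I0 i : (0 <= \int[mu]_(x in Omega) (Dv x ord0 i ^+ 2)%:E)%E.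
  by apply: integral_ge0 => x _; rewrite lee_fin sqr_ge0.
apply/lee_addgt0Pr => e e0.
have e2 : 0 < e / 2 by rewrite divr_gt0.
have Cn0 : 0 < C * n%:R + 1 by rewrite ltr_wpDl// mulr_ge0.
(* The errors in the [n] gradient terms add up and are multiplied by [C]; the [+ 1] keeps the
   divisor positive. *)
have e' : 0 < e / 2 / (C * n%:R + 1) by rewrite divr_gt0.
have [k [F1 [F2 F3]]] := filter_ex (filterI FKk (filterI (Ek _ e') (nullseq_markov mO mB N1 e2))).
have m1 : measurable (Omega `&` [set x | 1 <= `|phi k x|] : set T) := mlev _ _ (mphi k).
have m2 : measurable (Omega `&` [set x | 2^-1 <= `|phi k x - v x|] : set T) := mlev _ _ (mB k).
apply: (@le_trans _ _ (mu ((Omega `&` [set x | 1 <= `|phi k x|]) `|` (Omega `&` [set x | 2^-1 <=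
  `|phi k x - v x|])))).
  apply: le_measure; rewrite ?inE.
  - exact: (mlev _ _ mv).
  - exact: (measurableU _ _ m1 m2).
  - move=> x [Ox /= vx]; have [p1|p1] := leP 1 `|phi k x|; [left|right]; split=> //=.
    by rewrite distrC; have := lerB_dist (v x) (phi k x); lra.
apply: (le_trans (measureU2 _ m1 m2)).
rewrite -phiO//; apply: (le_trans (leeD F1 F3)).
apply: (@le_trans _ _ (C%:E * (2%:E * S + (n%:R * (e / 2 / (C * n%:R + 1)))%:E) + (e / 2)%:E)%E).
  apply: leeD2r; apply: lee_wpmul2l; first by rewrite lee_fin.
  rewrite /S ge0_sume_distrr// [in leRHS]EFinM -sume_cst; last by rewrite lee_fin ltW.
  by rewrite -big_split/=; apply: lee_sum => i _; exact: F2.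
have S0 : (0 <= S)%E by exact: sume_ge0.
rewrite ge0_muleDr ?mule_ge0 ?lee_fin//; last by rewrite mulr_ge0// ltW.
rewrite muleA -addeA; apply: leeD.
  rewrite le_eqVlt; apply/orP; left; apply/eqP; rewrite -EFinM; congr (_%:E * _)%E.
  by rewrite /C; ring.
rewrite -EFinM -EFinD lee_fin [leRHS]splitr lerD2r.
have -> : C * (n%:R * (e / 2 / (C * n%:R + 1))) = C * n%:R * (e / 2) / (C * n%:R + 1) by rewrite !mulrA.
by rewrite ler_pdivrMr// mulrC ler_wpM2l ?(ltW e2)// lerDl.
Qed.

End faber_krahn_sobolev.

(** * Truncations *)

Section profile.
Context (R : realType).
Implicit Types (t y s d theta : R).

(** A quadratic remainder turns differentiability into an inequality that can be checked by cases,
    so that the junctions of a piecewise quadratic function need no one-sided limits. Affine maps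
    are the case [K = 0]. *)
Lemma is_derive_quad (f : R -> R) (x l K : R) :
  (forall h : R, `|f (x + h) - f x - l * h| <= K * h ^+ 2) -> is_derive x 1 f l.
Proof.
move=> fK.
have K0 : 0 <= K by have := fK 1; rewrite expr1n !mulr1; apply: le_trans.
have H : (fun h : R => h^-1 *: ((f \o shift x) (h *: 1) - f x)) @ 0^' --> l.
  apply/cvgrPdist_le => e e0.
  have eK : 0 < e / (K + 1) by rewrite divr_gt0// ltr_wpDl.
  near=> h.
  have h0 : h != 0 by near: h; exact: nbhs_dnbhs_neq.
  have hl : `|h| <= e / (K + 1).
    near: h; apply: nbhs_dnbhs; apply/nbhs_ballP; exists (e / (K + 1)) => //= h.
    by rewrite /ball/= sub0r normrN => /ltW.
  have -> : l - h^-1 *: ((f \o shift x) (h *: 1) - f x) = - ((f (x + h) - f x - l * h) / h).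
    rewrite /= [h *: 1]mulr1 [h + x]addrC [(_ - l * h) / h]mulrBl mulfK// opprB.
    by congr (_ - _); exact: mulrC.
  rewrite normrN normrM normfV ler_pdivrMr ?normr_gt0//.
  apply: (le_trans (fK h)); rewrite -[h ^+ 2]real_normK ?num_real// expr2 mulrA.
  rewrite ler_wpM2r//; apply: (le_trans (ler_wpM2l K0 hl)).
  by rewrite mulrA ler_pdivrMr ?ltr_wpDl// mulrC ler_wpM2l// ?lerDl// ltW.
by apply: DeriveDef; [apply: cvgP H|apply: cvg_lim H].
Unshelve. all: by end_near. Qed.

(* The C^1 step from 0 (for [y <= 0]) to 3/2 (for [y >= 1]) that is quadratic on
   [0, 1/2] and on [1/2, 1]. *)
Definition smoothstep y := 3 * (Num.max 0 y ^+ 2 - 2 * Num.max 0 (y - 2^-1) ^+ 2 + Num.max 0 (y -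
  1) ^+ 2).
Definition dsmoothstep y := 6 * (Num.max 0 y - 2 * Num.max 0 (y - 2^-1) + Num.max 0 (y - 1)).

Lemma is_derive_smoothstep y : is_derive y 1 smoothstep (dsmoothstep y).
Proof.
apply: (@is_derive_quad _ _ _ 24) => h.
have q (z : R) : `|Num.max 0 (z + h) ^+ 2 - Num.max 0 z ^+ 2 - 2 * Num.max 0 z * h| <= h ^+ 2.
  by rewrite ler_norml /Num.max; case: ifP; case: ifP => ? ?; apply/andP; split; nra.
have := q y; have := q (y - 2^-1); have := q (y - 1).
rewrite /smoothstep /dsmoothstep ![y - _ + h]addrAC !ler_norml => /andP[a1 a2] /andP[b1 b2]
  /andP[c1 c2].
by apply/andP; split; lra.
Qed.

Lemma smoothstep_le0 y : y <= 0 -> smoothstep y = 0 /\ dsmoothstep y = 0.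
Proof.
by move=> y0; rewrite /smoothstep /dsmoothstep !max_l//; try lra; split; ring.
Qed.

Lemma smoothstep_ge1 y : 1 <= y -> smoothstep y = 3 / 2.
Proof. by move=> y1; rewrite /smoothstep !max_r; try lra; field. Qed.

Lemma smoothstep_bound y : 0 <= smoothstep y <= 3 / 2.
Proof. rewrite /smoothstep /Num.max; do 3 case: ifP => ?; apply/andP; split; nra. Qed.

Lemma dsmoothstep_bound y : 0 <= dsmoothstep y <= 3.
Proof. rewrite /dsmoothstep /Num.max; do 3 case: ifP => ?; apply/andP; split; lra. Qed.

Lemma dsmoothstep_continuous : continuous dsmoothstep.
Proof.
have cm : continuous (fun y : R => Num.max 0 y).
  move=> y; apply: (@continuous_max _ _ _ _ y); [exact: cst_continuous|exact: cvg_id].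
have cs (c : R) : continuous (fun y : R => Num.max 0 (y - c)).
  move=> y; apply: (@continuous_comp _ _ _ (fun y => y - c) (fun y => Num.max 0 y)); last exact: cm.
  by apply: continuousB; [exact: cvg_id|exact: cst_continuous].
move=> y; exact: (continuousM (@cst_continuous _ _ (6 : R) y) (continuousD (continuousB (cm y)
  (continuousM (@cst_continuous _ _ (2 : R) y) (cs 2^-1 y))) (cs 1 y))).
Qed.

(** The primitive H of the overview in closed form. *)
Definition Hprim theta t := ((1 + t) `^ (1 - theta) - 1) / (1 - theta).

Lemma is_derive_Hprim theta t : theta < 1 -> - 1 < t ->
  is_derive t 1 (Hprim theta) ((1 + t) `^ (- theta)).
Proof.
move=> th1 t1.
have t0 : 0 < 1 + t by lra.
have q0 : 1 - theta != 0 by rewrite subr_eq0 gt_eqF.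
have D1 : is_derive (1 + t) 1 (fun x : R => x `^ (1 - theta)) ((1 - theta) * (1 + t) `^ (1 - theta
  - 1)).
  exact: is_derive1_powR.
have D2 : is_derive t 1 (fun x : R => 1 + x) 1.
  by apply: (@is_derive_quad _ _ _ 0) => h; rewrite mul0r (_ : _ - _ - _ = 0) ?normr0//; ring.
have D3 := @is_derive1_comp _ (fun x : R => x `^ (1 - theta)) (fun x => 1 + x) t _ _ D1 D2.
rewrite /Hprim.
have D4 : is_derive t 1 ((1 - theta)^-1 \*: (((fun x : R => x `^ (1 - theta)) \o (fun x => 1 + x))
  - cst 1))
   ((1 - theta)^-1 *: ((1 - theta) * (1 + t) `^ (1 - theta - 1) * 1 - 0)).
  by apply: is_deriveZ; exact: is_deriveB.
rewrite (_ : (fun t => _) = (1 - theta)^-1 \*: (((fun x : R => x `^ (1 - theta)) \o (fun x => 1 +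
  x)) - cst 1)); last first.
  by apply/funext => x /=; rewrite mulrC.
apply: trigger_derive D4 _.
rewrite subr0 mulr1 /GRing.scale/= mulrA mulVf// mul1r; congr (_ `^ _); ring.
Qed.

Lemma Hprim_le0 theta t : theta < 1 -> t <= 0 -> Hprim theta t <= 0.
Proof.
move=> th1 t0; have q0 : 0 < 1 - theta by lra.
rewrite /Hprim ler_pdivrMr// mul0r subr_le0.
(* [powR] takes the value 1 on negative bases, so [Hprim] is 0 there. *)
have [t1|t1] := ltP (1 + t) 0; first by rewrite lt0_powR1.
rewrite -[leRHS](_ : 1 `^ (1 - theta) = 1); last by rewrite powR1.
by apply: ge0_ler_powR; rewrite ?nnegrE//; [exact: ltW|lra].
Qed.

Lemma Hprim_homo theta t y : theta < 1 -> 0 <= t -> t <= y -> Hprim theta t <= Hprim theta y.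
Proof.
move=> th1 t0 ty; have q0 : 0 < 1 - theta by lra.
rewrite /Hprim ler_pM2r ?invr_gt0// lerD2r.
by apply: ge0_ler_powR; rewrite ?nnegrE; lra.
Qed.

Lemma Hprim0 theta : Hprim theta 0 = 0.
Proof. by rewrite /Hprim addr0 powR1 subrr mul0r. Qed.

Lemma Hprim_ge0 theta t : theta < 1 -> 0 <= t -> 0 <= Hprim theta t.
Proof. by move=> th1 t0; rewrite -(Hprim0 theta) Hprim_homo. Qed.

(** [H(t) >= ln (1 + t)] whatever [theta], by [expR x >= 1 + x] at [x = (1 - theta) ln (1 + t)]. *)
Lemma Hprim_expR theta t : theta < 1 -> 0 <= t -> 1 + t <= expR (Hprim theta t).
Proof.
move=> th1 t0; have q0 : 0 < 1 - theta by lra.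
have t1 : 0 < 1 + t by lra.
rewrite -[leLHS](lnK (x := 1 + t)); last by rewrite posrE.
rewrite ler_expR /Hprim ler_pdivlMr// lerBrDl /powR gt_eqF// mulrC.
exact: expR_ge1Dx.
Qed.

(** From [(1 + t)^(1 - theta) = 1 + (1 - theta) H(t)] and [1 - theta <= 1]; no constant depends on
    [theta]. *)
Lemma Hprim_powR theta t : 0 <= theta < 1 -> 0 <= t -> t `^ (1 - theta) <= 1 + Hprim theta t.
Proof.
move=> /andP[th0 th1] t0; have q0 : 0 < 1 - theta by lra.
have H0 := Hprim_ge0 th1 t0.
apply: (@le_trans _ _ ((1 + t) `^ (1 - theta))).
  by apply: ge0_ler_powR; rewrite ?nnegrE; lra.
have -> : (1 + t) `^ (1 - theta) = 1 + (1 - theta) * Hprim theta t.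
  by rewrite /Hprim mulrC divfK ?gt_eqF// addrCA subrr addr0.
by rewrite lerD2l ler_piMl//; lra.
Qed.

Lemma le0_ler_powR (x y a : R) : 0 <= a -> 0 < x -> x <= y -> y `^ (- a) <= x `^ (- a).
Proof.
move=> a0 x0 xy; rewrite !powRN lef_pV2 ?posrE ?powR_gt0//; last exact: lt_le_trans xy.
by apply: ge0_ler_powR; rewrite ?nnegrE//; apply: ltW => //; exact: lt_le_trans xy.
Qed.

(** By the mean value theorem [H(t) = t (1 + c)^(- theta)] with [c < t]; for [t >= 1],
    [1 + c <= 2 t], and [2^(- theta) >= 1/2]. *)
Lemma Hprim_lower theta t : 0 <= theta < 1 -> 1 <= t -> t `^ (1 - theta) / 2 <= Hprim theta t.
Proof.
move=> /andP[th0 th1] t1; have t0 : 0 < t by lra.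
have D x : x \in `]0, t[%R -> is_derive x 1 (Hprim theta) ((1 + x) `^ (- theta)).
  by rewrite in_itv/= => /andP[x0 _]; apply: is_derive_Hprim => //; lra.
have cH : {within `[0, t], continuous (Hprim theta)}.
  apply: derivable_within_continuous => x; rewrite in_itv/= => /andP[x0 _].
  by have [] : is_derive x 1 (Hprim theta) ((1 + x) `^ (- theta)); [apply: is_derive_Hprim => //; lra|].
have [c] := MVT_segment (ltW t0) D cH.
rewrite in_itv/= => /andP[c0 ct]; rewrite Hprim0 !subr0 => ->.
have -> : t `^ (1 - theta) = t `^ (- theta) * t.
  rewrite addrC powRD ?powRr1 ?(ltW t0)//; first by apply/implyP => _; rewrite gt_eqF.
rewrite mulrAC ler_wpM2r ?(ltW t0)//.
apply: (@le_trans _ _ ((2 * t) `^ (- theta))); last by apply: le0_ler_powR => //; lra.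
rewrite powRM ?(ltW t0)// mulrC ler_wpM2r ?powR_ge0//.
rewrite powRN lef_pV2 ?posrE ?powR_gt0//.
by rewrite -[leRHS](powRr1 (a := 2))//; apply: ler_powR; lra.
Qed.

Section cutoff.
Variables (theta s d : R).
Hypotheses (th1 : theta < 1) (s0 : 0 <= s) (d0 : 0 < d).

Let G t := smoothstep ((Hprim theta t - s) / d).
Let dG t := dsmoothstep ((Hprim theta t - s) / d) * (d^-1 * (1 + t) `^ (- theta)).

(* [G] vanishes wherever [1 + t] may be negative, so the junk values of [powR]
   there are harmless. *)
Let G_le0 t : t <= 0 -> G t = 0 /\ dG t = 0.
Proof.
move=> t0; have := Hprim_le0 th1 t0 => H0.
have [e0 de0] : smoothstep ((Hprim theta t - s) / d) = 0 /\ dsmoothstep ((Hprim theta t - s) / d) = 0.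
  by apply: smoothstep_le0; rewrite ler_pdivrMr// mul0r subr_le0 (le_trans H0).
by rewrite /G /dG e0 de0 mul0r.
Qed.

Let near_neg t : t <= -1 -> \forall x \near t, x <= 0.
Proof.
move=> t1; have : \forall x \near t, x < 0 by apply: lt_nbhsl; lra.
by apply: filterS => x /ltW.
Qed.

Let is_derive_arg t : -1 < t ->
  is_derive t 1 (fun t => (Hprim theta t - s) / d) (d^-1 * (1 + t) `^ (- theta)).
Proof.
move=> t1.
have D : is_derive t 1 (d^-1 \*: (Hprim theta - cst s)) (d^-1 *: ((1 + t) `^ (- theta) - 0)).
  by apply: is_deriveZ; apply: is_deriveB; exact: is_derive_Hprim.
rewrite (_ : (fun t => _) = d^-1 \*: (Hprim theta - cst s)); last first.
  by apply/funext => x /=; rewrite mulrC.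
by apply: trigger_derive D _; rewrite subr0.
Qed.

Let is_derive_G t : is_derive t 1 G (dG t).
Proof.
have [t1|t1] := leP t (-1); last first.
  exact: (is_derive1_comp (is_derive_smoothstep _) (is_derive_arg t1)).
have [_ ->] : G t = 0 /\ dG t = 0 by apply: G_le0; lra.
apply: (@near_eq_is_derive _ _ _ (cst 0) G).
  by have := near_neg t1; apply: filterS => x x0; have [-> _] := G_le0 x0.
Qed.

Let continuous_dG : continuous dG.
Proof.
move=> t; have [t1|t1] := leP t (-1).
  have [_ E] : G t = 0 /\ dG t = 0 by apply: G_le0; lra.
  rewrite /continuous_at E; apply: cvg_near_cst.
  by have := near_neg t1; apply: filterS => x x0; have [_ ->] := G_le0 x0.
have c1 : {for t, continuous (fun t => dsmoothstep ((Hprim theta t - s) / d))}.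
  apply: (@continuous_comp _ _ _ (fun t => (Hprim theta t - s) / d) dsmoothstep); last exact:
    dsmoothstep_continuous.
  have [D _] := is_derive_arg t1.
  by apply: differentiable_continuous; exact/derivable1_diffP.
have c2 : {for t, continuous (fun t : R => (1 + t) `^ (- theta))}.
  apply: (@continuous_comp _ _ _ (fun t : R => 1 + t) (fun x => x `^ (- theta))).
    exact: (continuousD (@cst_continuous _ _ (1 : R) t) (@cvg_id _ (nbhs t))).
  have t0 : 0 < 1 + t by lra.
  have [D _] := is_derive1_powR (- theta) t0.
  by apply: differentiable_continuous; exact/derivable1_diffP.
exact: (continuousM c1 (continuousM (@cst_continuous _ _ d^-1 t) c2)).
Qed.

(** [G] lives on the positive half-line; its odd extension serves both signs of [u], and since one
    of [G t], [G (- t)] always vanishes, [|psi t| = G |t|]. The slope 3 and the height 3/2 are those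
    of [smoothstep], the height being the level at which [faber_krahn] measures [v]. *)
Lemma cutoff_exists : exists psi dpsi : R -> R,
  [/\ forall t : R, is_derive t 1 psi (dpsi t),
      continuous dpsi,
      psi 0 = 0 &
      forall t : R, [/\ 0 <= dpsi t, dpsi t <= 3 / d * (1 + `|t|) `^ (- theta),
        `|psi t| <= 3 / 2, psi t != 0 -> s < Hprim theta `|t| &
        s + d <= Hprim theta `|t| -> 3 / 2 <= `|psi t|]].
Proof.
have Dn t : is_derive t 1 (G \o -%R) (- dG (- t)).
  have Do : is_derive t 1 (-%R : R -> R) (-1).
    by apply: (@is_derive_quad _ _ _ 0) => h; rewrite mul0r (_ : _ - _ - _ = 0) ?normr0//; ring.
  have := is_derive1_comp (is_derive_G (- t)) Do.
  by rewrite mulrN1.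
exists (fun t => G t - G (- t)), (fun t => dG t + dG (- t)); split.
- move=> t; have := is_deriveB (is_derive_G t) (Dn t).
  by rewrite opprK.
- move=> t; apply: (@continuousD _ _ _ dG (fun t => dG (- t))); first exact: continuous_dG.
  by apply: (@continuous_comp _ _ _ -%R dG); [exact: opp_continuous|exact: continuous_dG].
- by rewrite oppr0 subrr.
move=> t.
have E : `|G t - G (- t)| = G `|t| /\ dG t + dG (- t) = dG `|t|.
  have G0 y : 0 <= G y by rewrite /G; have /andP[] := smoothstep_bound ((Hprim theta y - s) / d).
  have [t0|t0] := leP 0 t.
    have [|-> ->] := @G_le0 (- t); first by lra.
    by rewrite subr0 addr0 !ger0_norm.
  have [|-> ->] := @G_le0 t; first by lra.
  by rewrite sub0r add0r normrN (ltr0_norm t0) (ger0_norm (G0 _)).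
have [E1 E2] := E; rewrite E1 E2.
have /andP[dl du] := dsmoothstep_bound ((Hprim theta `|t| - s) / d).
have p0 : 0 <= (1 + `|t|) `^ (- theta) by exact: powR_ge0.
have di : 0 < d^-1 by rewrite invr_gt0.
split.
- by rewrite /dG mulr_ge0// mulr_ge0// ltW.
- by rewrite /dG -mulrA ler_wpM2r// mulr_ge0// ltW.
- by rewrite /G; have /andP[] := smoothstep_bound ((Hprim theta `|t| - s) / d).
- move=> G0; rewrite ltNge; apply/negP => Hs.
  have : G `|t| = 0.
    rewrite /G; have [] // : smoothstep ((Hprim theta `|t| - s) / d) = 0 /\ dsmoothstep ((Hprim
      theta `|t| - s) / d) = 0.
    by apply: smoothstep_le0; rewrite ler_pdivrMr// mul0r subr_le0.
  by move=> E0; move: E1; rewrite E0 => /normr0_eq0 /eqP; rewrite (negbTE G0).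
- move=> Hs; rewrite /G smoothstep_ge1//.
  by rewrite ler_pdivlMr// mul1r; lra.
Qed.

End cutoff.

End profile.

(** * The Stampacchia iteration *)

Section stampacchia.
Context (R : realType).
Variables (M : R -> R) (C V b : R).
Hypotheses (M0 : forall s, 0 <= M s) (Mmono : forall s t, s <= t -> M t <= M s)
  (MV : M 0 <= V) (C0 : 0 <= C) (b0 : 0 <= b)
  (MC : forall s d, 0 <= s -> 0 < d -> M (s + d) <= C / d * M s `^ b).

(** Along the levels [d (1 - 2^-j)] the shrinking gaps cost a factor [2^(j+1)], while the surplus
    power [b - 1] of the bound [V r^j] gains [r^(j (b - 1))]. The choice [r = 2^(-1/(b - 1))] makes
    this gain [2^-j], and the lower bound on [d] closes the induction. *)
Lemma stampacchia_bounded (d : R) : 1 < b -> 0 < V -> 0 < d ->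
  2 * C * V `^ (b - 1) * 2 `^ ((b - 1)^-1) <= d -> M d = 0.
Proof.
move=> b1 V0 d0 Hd; have bm : 0 < b - 1 by lra.
pose r := (2:R) `^ (- (b - 1)^-1).
have r0 : 0 < r by rewrite powR_gt0.
have rb : r `^ (b - 1) = 2^-1.
  by rewrite /r -powRrM mulNr mulVf ?gt_eqF// powR_inv1.
have rV : 2 `^ ((b - 1)^-1) = r^-1 by rewrite /r powRN invrK.
have r1 : r < 1.
  have : 1 `^ ((b - 1)^-1) < (2 : R) `^ ((b - 1)^-1).
    by apply: gt0_ltr_powR; rewrite ?invr_gt0 ?nnegrE ?ltr1n.
  by rewrite powR1 /r powRN invf_lt1 ?powR_gt0.
pose s (j : nat) := d * (1 - 2^-1 ^+ j).
have s0 j : 0 <= s j.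
  rewrite /s mulr_ge0 ?(ltW d0)// subr_ge0 exprn_ile1//.
  by rewrite invf_le1// ler1n.
have sS j : s j.+1 = s j + d * 2^-1 ^+ j.+1 by rewrite /s exprS; field.
have Ms j : M (s j) <= V * r ^+ j.
  elim: j => [|j IH]; first by rewrite /s expr0 subrr mulr0 mulr1.
  have h0 : 0 < (2^-1 : R) ^+ j.+1 by rewrite exprn_gt0.
  have dj : 0 < d * 2^-1 ^+ j.+1 by rewrite mulr_gt0.
  rewrite sS; apply: (le_trans (MC (s0 j) dj)).
  have IH' : M (s j) `^ b <= (V * r ^+ j) `^ b.
    by apply: ge0_ler_powR; rewrite ?nnegrE// mulr_ge0 ?(ltW V0)// exprn_ge0// ltW.
  have D0 : 0 <= C / (d * 2^-1 ^+ j.+1) by rewrite divr_ge0// ltW.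
  apply: (le_trans (ler_wpM2l D0 IH')).
  have -> : (V * r ^+ j) `^ b = V * V `^ (b - 1) * (r ^+ j * 2^-1 ^+ j).
    have x0 : 0 < r ^+ j by rewrite exprn_gt0.
    rewrite [X in _ `^ X = _](_ : b = 1 + (b - 1)); last by ring.
    rewrite [LHS]powRD ?powRr1 ?mulr_ge0 ?(ltW V0) ?(ltW x0)//; last first.
      by apply/implyP => _; rewrite gt_eqF// mulr_gt0.
    rewrite powRM ?(ltW V0) ?(ltW x0)//.
    have -> : (r ^+ j) `^ (b - 1) = 2^-1 ^+ j.
      by rewrite -powR_mulrn ?(ltW r0)// powRAC rb powR_mulrn.
    by ring.
  have -> : C / (d * 2^-1 ^+ j.+1) * (V * V `^ (b - 1) * (r ^+ j * 2^-1 ^+ j)) =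
      V * r ^+ j * (2 * C * V `^ (b - 1) / d).
    have hj : (2^-1 : R) ^+ j != 0 by rewrite expf_neq0.
    rewrite exprS; field; rewrite hj gt_eqF//.
  rewrite (_ : V * r ^+ j.+1 = V * r ^+ j * r); last by rewrite exprS; ring.
  rewrite ler_wpM2l//.
    by rewrite mulr_ge0 ?(ltW V0)// exprn_ge0// ltW.
  by rewrite ler_pdivrMr// -ler_pdivrMl// mulrC -rV.
apply/eqP; rewrite eq_le M0 andbT.
have L : V * r ^+ j @[j --> \oo] --> 0.
  by apply: cvg_geometric; rewrite gtr0_norm.
rewrite -(cvg_lim (@Rhausdorff R) L); apply: limr_ge; first exact: cvgP L.
apply: nearW => j; apply: le_trans (Ms j); apply: Mmono.
by rewrite /s ler_piMr ?(ltW d0)// gerBl exprn_ge0.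
Qed.

(** With exponent 1, a gap of [2 C] halves [M]. *)
Lemma stampacchia_exp (j : nat) : b = 1 -> 0 < C -> M (2 * C * j%:R) <= V * 2^-1 ^+ j.
Proof.
move=> b1 Cp; elim: j => [|j IH]; first by rewrite mulr0 expr0 mulr1.
have C2 : 0 < 2 * C by rewrite mulr_gt0.
have -> : 2 * C * j.+1%:R = 2 * C * j%:R + 2 * C by rewrite -natr1; ring.
apply: (le_trans (MC _ C2)); first by rewrite mulr_ge0 ?mulr_ge0.
rewrite b1 powRr1// exprS (_ : C / (2 * C) = 2^-1); last by field; rewrite gt_eqF.
by rewrite [2^-1 * _ ^+ _]mulrC mulrA [V * _ * _]mulrC ler_wpM2l.
Qed.

(** The decay inequality with gap [s / 2] bounds [s^p M(s)] by [D] times the power [b] of the same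
    quantity at [s / 2], because [p = 1 + p b]. A bound [Z] with [D Z^b <= Z] thus propagates from
    [s <= 1] to [s <= 2^j] for every [j]. *)
Lemma stampacchia_poly (p : R) : 0 < p -> p * (1 - b) = 1 ->
  exists2 Z : R, 0 <= Z & forall s : R, 0 < s -> M s <= Z * s `^ (- p).
Proof.
move=> p0 pb; have V0 : 0 <= V by apply: le_trans MV.
pose D := 2 `^ p * C.
have D0 : 0 <= D by rewrite mulr_ge0// powR_ge0.
have bm : 0 < 1 - b by rewrite -(pmulr_rgt0 _ p0) pb.
(* [Z >= D^p] gives [D Z^b <= Z], as [p (1 - b) = 1]; [Z >= V] starts the induction; the [+ 1] makes
   [Z] positive. *)
pose Z := Num.max V (D `^ p) + 1.
have VZ : V <= Z by rewrite /Z ler_wpDr// le_max lexx.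
have DZ : D `^ p <= Z by rewrite /Z ler_wpDr// le_max lexx orbT.
have Zp : 0 < Z by rewrite /Z ltr_wpDl// le_max V0.
have Z0 := ltW Zp.
have ZD : D * Z `^ b <= Z.
  have D1 : D <= Z `^ (1 - b).
    have E : D = (D `^ p) `^ (1 - b) by rewrite -powRrM pb powRr1.
    rewrite [leLHS]E; apply: ge0_ler_powR => //.
    - exact: ltW.
    - by rewrite nnegrE powR_ge0.
  apply: (@le_trans _ _ (Z `^ (1 - b) * Z `^ b)); first by rewrite ler_wpM2r// powR_ge0.
  by rewrite -powRD ?subrK ?powRr1//; apply/implyP => _; rewrite gt_eqF.
have H (j : nat) (s : R) : 0 < s -> s <= 2 ^+ j -> s `^ p * M s <= Z.
  elim: j s => [|j IH] s sp sj.
    rewrite expr0 in sj; apply: (@le_trans _ _ (1 * V)); last by rewrite mul1r.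
    apply: ler_pM => //; first exact: powR_ge0.
    - have : s `^ p <= 1 `^ p by apply: ge0_ler_powR; rewrite ?nnegrE ?(ltW p0) ?(ltW sp).
      by rewrite powR1.
    - by apply: le_trans MV; apply: Mmono; exact: ltW.
  have h0 : 0 < s / 2 by rewrite divr_gt0.
  have hj : s / 2 <= 2 ^+ j by rewrite ler_pdivrMr// mulrC -exprS.
  have IHh := IH _ h0 hj.
  have := MC (ltW h0) h0; rewrite -splitr => MCs.
  apply: (@le_trans _ _ (s `^ p * (C / (s / 2) * M (s / 2) `^ b))).
    by rewrite ler_wpM2l// powR_ge0.
  apply: le_trans ZD.
  have -> : s `^ p * (C / (s / 2) * M (s / 2) `^ b) = D * ((s / 2) `^ p * M (s / 2)) `^ b.
    have hp : 0 <= (s / 2) `^ p by exact: powR_ge0.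
    rewrite powRM// /D -powRrM.
    have -> : s `^ p = 2 `^ p * (s / 2) `^ p by rewrite -powRM ?(ltW h0)//; congr (_ `^ _); field.
    have -> : (s / 2) `^ p = (s / 2) * (s / 2) `^ (p * b).
      have Ep : p = 1 + p * b by rewrite -[X in X + _]pb; ring.
      rewrite [X in _ `^ X = _]Ep [LHS]powRD ?powRr1 ?(ltW h0)//.
      by apply/implyP => _; rewrite gt_eqF.
    move: (_ `^ (p * b)) (_ `^ b) (_ `^ p) => X Y P2; field; rewrite gt_eqF//.
  rewrite ler_wpM2l//; apply: ge0_ler_powR => //; rewrite nnegrE//.
  by rewrite mulr_ge0// powR_ge0.
exists Z => // s s0.
have [j sj] : exists j : nat, s <= 2 ^+ j.
  exists (Num.truncn s).+1; apply: (@le_trans _ _ (Num.truncn s).+1%:R).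
    by apply: ltW; exact: Num.Theory.truncnS_gt.
  by rewrite -natrX ler_nat ltnW// ltn_expl.
rewrite powRN ler_pdivlMr ?powR_gt0// mulrC; exact: H sj.
Qed.

End stampacchia.

(** * Integrals of weakly bounded functions *)

Section generic.
Context d (T : measurableType d) (R : realType).
Variables (mu : {measure set T -> \bar R}).

Import HBNNSimple.

(** The integral of a nonnegative function is a supremum over the simple functions below it, which
    is monotone without any measurability. *)
Lemma ge0_le_integral_nonmeasurable (D : set T) (f g : T -> \bar R) :
  (forall x, D x -> 0 <= f x)%E -> (forall x, D x -> f x <= g x)%E ->
  (\int[mu]_(x in D) f x <= \int[mu]_(x in D) g x)%E.
Proof.
move=> f0 fg; rewrite !ge0_integralE//; last first.
  by move=> x Dx; exact: le_trans (f0 x Dx) (fg x Dx).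
apply: le_ereal_sup => _ [h hf <-]; exists h => // x.
by apply: le_trans (hf x) _; exact: lee_restrict.
Qed.

(* Spares the measurability of [x |-> a (x, u x)]. *)
Lemma ae_le_integral_nonmeasurable (D : set T) (f g : T -> \bar R) : measurable D ->
  measurable_fun D f -> (forall x, D x -> 0 <= f x)%E ->
  {ae mu, forall x, D x -> (f x <= g x)%E} ->
  (\int[mu]_(x in D) f x <= \int[mu]_(x in D) g x)%E.
Proof.
move=> mD mf f0 [N [mN N0 fgN]].
have fg x : D x -> ~ N x -> (f x <= g x)%E.
  by move=> Dx nN; apply: contrapT => h; apply: nN; apply: fgN => /= /(_ Dx).
rewrite [leRHS]integralE.
have -> : (\int[mu]_(x in D) g^\- x = 0)%E.
  apply/eqP; rewrite eq_le; apply/andP; split; last by apply: integral_ge0 => x _; exact: funeneg_ge0.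
  (* Off [N] one has [g >= f >= 0], so the negative part of [g] lies below this function, which is
     measurable with integral 0. *)
  pose h x : \bar R := if x \in N then +oo%E else 0%E.
  have mh : measurable_fun D h.
    rewrite (_ : h = (fun x => +oo%E * (\1_N x)%:E)%E).
      by apply: measurable_funeM; apply/measurable_EFinP.
    by apply/funext => x; rewrite /h indicE; case: ifP => _; rewrite ?mule1 ?mule0.
  have h0 x : D x -> (0 <= h x)%E by rewrite /h; case: ifP.
  apply: (@le_trans _ _ (\int[mu]_(x in D) h x)%E).
    apply: ge0_le_integral_nonmeasurable => x Dx; first exact: funeneg_ge0.
    rewrite /h; case: ifPn => [_|/negP xN]; first exact: leey.
    have gx : (0 <= g x)%E.
      by rewrite (le_trans (f0 x Dx))// fg// => Nx; apply: xN; exact: mem_set.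
    by rewrite funenegE max_r// oppe_le0.
  rewrite (ge0_negligible_integral mN)// integral0_eq// => x [Dx nN].
  by rewrite /h memNset.
rewrite sube0 (ge0_negligible_integral mN mD mf f0 N0).
apply: (@le_trans _ _ (\int[mu]_(x in D `\` N) g^\+ x)%E).
  apply: ge0_le_integral_nonmeasurable => x [Dx nN]; first exact: f0.
  by rewrite funeposE le_max fg.
rewrite integral_mkcond [leRHS]integral_mkcond.
apply: ge0_le_integral_nonmeasurable => x _.
  by apply: erestrict_ge0 => y _; exact: funepos_ge0.
rewrite !patchE; case: ifPn => [/set_mem[Dx _]|_]; first by rewrite mem_set.
by case: ifP => // _; exact: funepos_ge0.
Qed.

(** The sets [B j] may overlap: where [g > c0], a single term of the series of the [c j] times the
    indicator of [B j] already dominates [g]. Dyadic layers are used for the weakly bounded datum,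
    arithmetic ones for the exponential. *)
Lemma integral_layers_le (D : set T) (g : T -> R) (c0 : R) (c : nat -> R) (B : nat -> set T) :
  measurable D -> measurable_fun D g -> (forall x, 0 <= g x) -> 0 <= c0 ->
  (forall j, 0 <= c j) -> (forall j, measurable (B j)) ->
  (forall x, D x -> g x <= c0 \/ exists j, B j x /\ g x <= c j) ->
  (\int[mu]_(x in D) (g x)%:E <= c0%:E * mu D + \sum_(j <oo) (c j)%:E * mu (B j))%E.
Proof.
move=> mD mg g0 c00 cj mB gc.
pose F j x : \bar R := (c j * \1_(B j) x)%:E.
have F0 j x : (0 <= F j x)%E by rewrite lee_fin mulr_ge0.
have mF j : measurable_fun D (F j).
  apply/measurable_EFinP; apply: measurable_funM; first exact: measurable_cst.
  by apply: measurable_funTS; exact: measurable_indic.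
have mS : measurable_fun D (fun x => \sum_(j <oo) F j x)%E.
  exact: (@ge0_emeasurable_sum _ T R D F xpredT (fun k x _ _ => F0 k x) (fun k _ => mF k)).
have S0 x : (0 <= \sum_(j <oo) F j x)%E by apply: nneseries_ge0.
apply: (@le_trans _ _ (\int[mu]_(x in D) (c0%:E + \sum_(j <oo) F j x))%E).
  apply: ge0_le_integral => //.
  - by move=> x _; rewrite lee_fin.
  - exact/measurable_EFinP.
  - by apply: emeasurable_funD => //; exact: measurable_cst.
  move=> x Dx; case: (gc x Dx) => [gx|[j [Bj gx]]].
    by rewrite (@le_trans _ _ c0%:E)// leeDl.
  apply: (@le_trans _ _ (c j)%:E); first by rewrite lee_fin.
  apply: (@le_trans _ _ (\sum_(j <oo) F j x)%E); last by rewrite leeDr// lee_fin.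
  have -> : (c j)%:E = F j x by rewrite /F indicE mem_set// mulr1.
  rewrite (nneseries_split 0 j.+1)//.
  apply: (@le_trans _ _ (\sum_(0 <= k < 0 + j.+1) F k x)%E); last by rewrite leeDl// nneseries_ge0.
  by rewrite add0n big_nat_recr//= leeDr// sume_ge0.
rewrite ge0_integralD//.
apply: leeD; first by rewrite integral_cst.
rewrite integral_nneseries//; apply: lee_nneseries => j.
  by move=> _ _; exact: integral_ge0.
move=> _; rewrite /F (integralZl_indic mD (fun=> B j))//; last first.
  by move=> h; exfalso; move: h; rewrite ltNge cj.
apply: lee_wpmul2l; first by rewrite lee_fin.
rewrite integral_indic//; apply: le_measure; rewrite ?inE//; exact: measurableI.
Qed.

End generic.

Lemma nneseries_geometric_le (R : realType) (a r : R) : 0 <= a -> 0 <= r < 1 ->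
  (\sum_(j <oo) (a * r ^+ j)%:E <= (a / (1 - r))%:E)%E.
Proof.
move=> a0 /andP[r0 r1]; apply: lime_le.
  by apply: is_cvg_nneseries => j _ _; rewrite lee_fin mulr_ge0// exprn_ge0.
apply: nearW => N; rewrite sumEFin lee_fin.
have r1' : 0 < 1 - r by lra.
rewrite ler_pdivlMr//.
have : \sum_(0 <= i < N) a * r ^+ i = a * (1 - r ^+ N) / (1 - r).
  elim: N => [|N IH]; first by rewrite big_nil expr0 subrr mulr0 mul0r.
  rewrite big_nat_recr//= IH exprS; field; rewrite gt_eqF//.
move=> ->; rewrite divfK ?gt_eqF// ler_piMr// gerBl exprn_ge0//.
Qed.

Lemma dyadic_level (R : realType) (t y : R) : 0 < t -> t < y ->
  exists j : nat, 2 ^+ j * t < y /\ y <= 2 ^+ j.+1 * t.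
Proof.
move=> t0 ty.
have [N HN] : exists N : nat, y <= 2 ^+ N * t.
  exists (Num.truncn (y / t)).+1; rewrite -ler_pdivrMr//.
  apply: (@le_trans _ _ (Num.truncn (y / t)).+1%:R).
    by apply: ltW; exact: Num.Theory.truncnS_gt.
  by rewrite -natrX ler_nat ltnW// ltn_expl.
elim: N HN => [|N IH] HN; first by move: HN; rewrite expr0 mul1r leNgt ty.
have [/IH//|h] := leP y (2 ^+ N * t).
by exists N.
Qed.

(** In the bound of the integral of [|f|] over a set, the 1 stands for the values below a threshold
    and the fraction for the geometric series of the dyadic layers above it. *)
Definition weak_constant (R : realType) (m gam : R) : R :=
  gam `^ m^-1 * (1 + 2 / (1 - 2 `^ (1 - m))).

Lemma weak_constant_gt0 (R : realType) (m gam : R) : 1 < m -> 0 < gam -> 0 < weak_constant m gam.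
Proof.
move=> m1 g0; rewrite mulr_gt0 ?powR_gt0// ltr_wpDr// divr_ge0//.
have : (2 : R) `^ (1 - m) <= 2 `^ 0 by apply: ler_powR; lra.
by rewrite powRr0; lra.
Qed.

Lemma weak_integral_le d (T : measurableType d) (R : realType)
    (mu : {measure set T -> \bar R}) (D A : set T) (f : T -> R) (m gam a : R) :
  measurable D -> measurable A -> A `<=` D -> measurable_fun D f -> 1 < m -> 0 < gam ->
  (forall l : R, 0 < l -> (mu (D `&` [set x | l < `|f x|]%R) <= (gam / l `^ m)%:E)%E) ->
  0 < a -> mu A = a%:E ->
  (\int[mu]_(x in A) (`|f x|)%:E <= (weak_constant m gam * a `^ (1 - m^-1))%:E)%E.
Proof.
move=> mD mA AD mf m1 g0 fw a0 muA.
have m0 : 0 < m by lra.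
(* dyadic layers above the level [t] at which the weak bound equals the measure of [A] *)
pose t := (gam / a) `^ m^-1.
have ga : 0 < gam / a by rewrite divr_gt0.
have t0 : 0 < t by rewrite powR_gt0.
have tm : t `^ m = gam / a by rewrite /t -powRrM mulVf ?gt_eqF// powRr1// ltW.
pose rho := (2 : R) `^ (1 - m).
have r0 : 0 < rho by rewrite powR_gt0.
have r1 : rho < 1.
  have : 2 `^ (1 - m) < 2 `^ 0 :> R.
    rewrite (_ : 1 - m = - (m - 1)); last by ring.
    rewrite powRN powRr0 invf_lt1 ?powR_gt0//.
    have : 1 `^ (m - 1) < (2 : R) `^ (m - 1).
      by apply: gt0_ltr_powR; rewrite ?nnegrE ?ltr1n ?subr_gt0.
    by rewrite powR1.
  by rewrite powRr0.
have mlev (l : R) : measurable (D `&` [set x | l < `|f x|]) := measurable_level_gt l mD mf.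
have := @integral_layers_le _ T R mu A (fun x => `|f x|) t (fun j => 2 ^+ j.+1 * t)
  (fun j => D `&` [set x | 2 ^+ j * t < `|f x|]) mA.
have mfA : measurable_fun A (fun x => `|f x|).
  by apply: measurableT_comp => //; exact: measurable_funS mf.
have c0 (j : nat) : 0 <= 2 ^+ j.+1 * t by rewrite mulr_ge0 ?(ltW t0)// exprn_ge0.
move=> /(_ mfA (fun x => normr_ge0 _) (ltW t0) c0 (fun j => mlev _)) H.
(* Layer [j] costs [2^(j+1) t gam / (2^j t)^m = 2 t a rho^j], because [gam / t^m = a]. *)
apply: (@le_trans _ _ (t%:E * mu A + \sum_(j <oo) (2 * (t * a) * rho ^+ j)%:E)%E).
  apply: le_trans (H _) _.
    move=> x Ax; have [fx|fx] := leP `|f x| t; [by left|right].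
    have [j [j1 j2]] := dyadic_level t0 fx.
    by exists j; split=> //; split=> //; exact: AD.
  apply: leeD => //; apply: lee_nneseries => j.
    by move=> _ _; rewrite mule_ge0// lee_fin.
  move=> _; have l0 : 0 < 2 ^+ j * t by rewrite mulr_gt0// exprn_gt0.
  apply: (@le_trans _ _ ((2 ^+ j.+1 * t)%:E * (gam / (2 ^+ j * t) `^ m)%:E)%E).
    by apply: lee_wpmul2l; [rewrite lee_fin|exact: fw].
  rewrite -EFinM lee_fin le_eqVlt; apply/orP; left; apply/eqP.
  have p0 : 0 < (2:R) ^+ j by rewrite exprn_gt0.
  rewrite powRM ?(ltW t0) ?(ltW p0)// tm.
  have -> : rho ^+ j = 2 ^+ j / (2 ^+ j) `^ m.
    rewrite /rho -powR_mulrn ?powR_ge0// -powRrM mulrC powRrM powR_mulrn//.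
    rewrite powRD ?powRr1 ?(ltW p0)//; first by rewrite powRN.
    by apply/implyP => _; rewrite gt_eqF.
  have P0 : 0 < ((2:R) ^+ j) `^ m by rewrite powR_gt0.
  rewrite exprS; field; rewrite !gt_eqF//.
have ta : 0 <= 2 * (t * a) by rewrite !mulr_ge0 ?ltW.
have r01 : 0 <= rho < 1 by rewrite r1 ltW.
apply: (le_trans (leeD2l _ (nneseries_geometric_le ta r01))).
rewrite muA -EFinM -EFinD lee_fin le_eqVlt; apply/orP; left; apply/eqP.
have -> : weak_constant m gam * a `^ (1 - m^-1) = t * a * (1 + 2 / (1 - rho)).
  rewrite /weak_constant -/rho mulrAC; congr (_ * _).
  rewrite /t [gam / a]mulrC powRM ?invr_ge0 ?(ltW a0) ?(ltW g0)//.
  rewrite powRD ?powRr1 ?(ltW a0)//; last by apply/implyP => _; rewrite gt_eqF.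
  by rewrite -[a^-1](powR_inv1 (ltW a0)) -powRrM mulN1r; ring.
have : 1 - rho != 0 by rewrite subr_eq0 gt_eqF.
by move=> h; field.
Qed.

(** * Decay of the level sets of a solution *)

Section decay.
Context (R : realType) (n : nat).
Local Notation E := 'rV[R]_n.
Local Notation T := (lebesgue_space R n).
Local Notation mu := (@lebesgue_rV R n).
Variables (Omega : set E) (theta alpha beta m gam : R) (a : E -> R -> R) (f u : E -> R).
Hypotheses (n2 : (2 < n)%N) (oO : open Omega) (fO : (mu Omega < +oo)%E)
  (th : 0 <= theta < 1) (al0 : 0 < alpha) (m1 : 1 < m) (gam0 : 0 < gam)
  (aab : {ae mu, forall x, Omega x -> forall s : R,
     alpha / (1 + `|s|) `^ theta <= a x s <= beta})
  (mf : measurable_fun (Omega : set T) (f : T -> R))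
  (fw : weak_bound Omega m f gam)
  (sol : dirichlet_solution Omega a f u).

Let mO : measurable (Omega : set T) := measurable_open_lebesgue oO.

Lemma solution_measurable : measurable_fun (Omega : set T) (u : T -> R).
Proof. by case: sol => Du [[[[]]]]. Qed.

Definition levelset s : set E := Omega `&` [set x | s < Hprim theta `|u x|].

Lemma measurable_Hprim : measurable_fun (Omega : set T) (fun x : T => Hprim theta `|u x|).
Proof.
have mu1 : measurable_fun (Omega : set T) (fun x : T => 1 + `|u x|).
  apply: measurable_funD; first exact: measurable_cst.
  exact: (measurableT_comp (@normr_measurable R setT) solution_measurable).
have mu2 := measurableT_comp (measurable_powR (1 - theta)) mu1.
exact: (measurable_funM (measurable_funB mu2 (@measurable_cst _ _ _ _ _ (1 : R)))
  (@measurable_cst _ _ _ _ _ (1 - theta)^-1)).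
Qed.

Lemma measurable_levelset s : measurable (levelset s : set T).
Proof.
rewrite /levelset (_ : [set x | _] = (fun x => Hprim theta `|u x|) @^-1` `]s, +oo[); last first.
  by apply/seteqP; split => x /=; rewrite in_itv/= andbT.
exact: measurable_Hprim.
Qed.

Lemma levelset_fin s : (mu (levelset s) < +oo)%E.
Proof.
apply: le_lt_trans fO; apply: le_measure; rewrite ?inE.
- exact: measurable_levelset.
- exact: mO.
- by move=> x [].
Qed.

(** The function M of the overview; [fine] loses nothing by [levelset_fin]. *)
Definition distr s : R := fine (mu (levelset s)).

Lemma distrE s : mu (levelset s) = (distr s)%:E.
Proof. by rewrite /distr fineK// ge0_fin_numE// levelset_fin. Qed.

Lemma distr_ge0 s : 0 <= distr s.
Proof. exact: fine_ge0. Qed.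

Lemma distr_homo s t : s <= t -> distr t <= distr s.
Proof.
move=> st; rewrite -lee_fin -!distrE; apply: le_measure; rewrite ?inE.
- exact: measurable_levelset.
- exact: measurable_levelset.
- by move=> x [Ox /= tx]; split=> //=; exact: le_lt_trans tx.
Qed.

Lemma distr_volume s : distr s <= volume Omega.
Proof.
rewrite -lee_fin -distrE /volume fineK; last by rewrite ge0_fin_numE.
apply: le_measure; rewrite ?inE; [exact: measurable_levelset|exact: mO|by move=> x []].
Qed.

(* [faber_krahn] with [N = 2 |A|] times the constant of [energy_le]. *)
Definition decay_constant : R :=
  16 * n%:R * (4 `^ n%:R^-1) ^+ 2 * (9 / (2 * alpha) * weak_constant m gam).

Lemma decay_constant_gt0 : 0 < decay_constant.
Proof.
have n0 : 0 < n%:R :> R by rewrite ltr0n (ltn_trans _ n2).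
apply: mulr_gt0; first by rewrite mulr_gt0 ?exprn_gt0 ?powR_gt0// mulr_gt0.
by rewrite mulr_gt0 ?weak_constant_gt0// divr_gt0// mulr_gt0.
Qed.

(** With [P = dpsi (u x)], [P <= (3 / d) (1 + |u|)^(- theta) <= 3 a / (alpha d)], so [(alpha d / 3)
    |Dv|^2 = (alpha d / 3) P^2 |Du|^2 <= a P |Du|^2], the integrand of the equation. On the
    right-hand side [|v| <= 3 / 2] and [v] vanishes off the level set, where [weak_integral_le] no
    longer has to be applied; [3 (3 / 2)] is the 9/2 of the constant. *)
Lemma energy_le s d : 0 <= s -> 0 < d -> 0 < distr s ->
  exists v Dv, [/\ sobolev12_0 Omega v Dv,
    Omega `&` [set x | v x != 0] `<=` levelset s,
    levelset (s + d) `<=` Omega `&` [set x | 3 / 2 <= `|v x|] &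
    (\sum_(i < n) \int[mu]_(x in Omega) (Dv x ord0 i ^+ 2)%:E <=
      (9 / (2 * alpha) * weak_constant m gam / d * distr s `^ (1 - m^-1))%:E)%E].
Proof.
move=> s0 d0 a0; have /andP[th0 th1] := th.
have [Du [sDu eqn]] := sol.
have [psi [dpsi [Dpsi cdpsi psi0 psiP]]] := cutoff_exists th1 s0 d0.
have dpsiB (t : R) : `|dpsi t| <= 3 / d.
  have [d1 d2 _ _ _] := psiP t; rewrite ger0_norm// (le_trans d2)//.
  rewrite ler_piMr ?divr_ge0 ?(ltW d0)//.
  have : (1 + `|t|) `^ (- theta) <= 1 `^ (- theta) by apply: le0_ler_powR => //; rewrite lerDl.
  by rewrite powR1.
have sv := sobolev_chain oO sDu Dpsi cdpsi dpsiB psi0.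
exists (fun x => psi (u x)), (fun x => dpsi (u x) *: Du x); split=> //.
- by move=> x [Ox /= px]; split=> //=; have [_ _ _ + _] := psiP (u x); exact.
- by move=> x [Ox /= px]; split=> //=; have [_ _ _ _] := psiP (u x); apply; exact: ltW.
have mA := measurable_levelset s.
have AO : levelset s `<=` Omega by move=> x [].
have mv : measurable_fun (Omega : set T) (fun x : T => psi (u x)).
  by case: sv => -[[]].
have mDv i : measurable_fun (Omega : set T) (fun x : T => (dpsi (u x) *: Du x) ord0 i).
  by case: sv => -[_ + _] _ => /(_ i)[].
have := eqn _ _ sv => {}eqn.
pose F (x : T) : \bar R := ((alpha * d / 3)%:E * \sum_(i < n) ((dpsi (u x) *: Du x) ord0 i ^+ 2)%:E)%E.
have mDv2 i : measurable_fun (Omega : set T) (fun x : T => ((dpsi (u x) *: Du x) ord0 i ^+ 2)%:E).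
  by apply/measurable_EFinP; exact: (measurable_funX 2 (mDv i)).
have sq0 i (x : T) : (0 <= ((dpsi (u x) *: Du x) ord0 i ^+ 2)%:E)%E by rewrite lee_fin sqr_ge0.
have ad0 : 0 <= alpha * d / 3 by rewrite divr_ge0 ?mulr_ge0 ?ltW.
have mS : measurable_fun (Omega : set T) (fun x : T => \sum_(i < n) ((dpsi (u x) *: Du x) ord0 i ^+
  2)%:E)%E.
  exact: (@emeasurable_sum _ T R Omega _ _ (fun (i : 'I_n) (x : T) => ((dpsi (u x) *: Du x) ord0 i
    ^+ 2)%:E) mDv2).
have S0 (x : T) : (0 <= \sum_(i < n) ((dpsi (u x) *: Du x) ord0 i ^+ 2)%:E)%E.
  by apply: sume_ge0 => i _; exact: sq0.
have low : ((alpha * d / 3)%:E * \sum_(i < n) \int[mu]_(x in Omega) ((dpsi (u x) *: Du x) ord0 i ^+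
  2)%:E
    <= \int[mu]_(x in Omega) (a x (u x) * dotprod (Du x) (dpsi (u x) *: Du x))%:E)%E.
  rewrite -(@ge0_integral_sum _ T R mu Omega mO _ (fun (i : 'I_n) (x : T) => ((dpsi (u x) *: Du x)
    ord0 i ^+ 2)%:E) mDv2 (fun i x _ => sq0 i x)).
  rewrite -(@ge0_integralZl_EFin _ T R mu Omega mO _ (fun x _ => S0 x) mS _ ad0).
  apply: (@ae_le_integral_nonmeasurable _ T R mu Omega _ _ mO).
  - exact: measurable_funeM.
  - by move=> x _; rewrite mule_ge0.
  have [N [mN N0 NS]] := aab; exists N; split=> //; apply: subset_trans NS => x /= nP H; apply: nP
    => Ox.
  have /andP[al _] := H Ox (u x).
  rewrite sumEFin -EFinM lee_fin.
  have [p0 p1 _ _ _] := psiP (u x).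
  set P := dpsi (u x) in p0 p1 *.
  have -> : \sum_(i < n) (P *: Du x) ord0 i ^+ 2 = P ^+ 2 * \sum_(i < n) (Du x ord0 i ^+ 2).
    by rewrite mulr_sumr; apply: eq_bigr => i _; rewrite mxE exprMn.
  have -> : dotprod (Du x) (P *: Du x) = P * \sum_(i < n) (Du x ord0 i ^+ 2).
    by rewrite /dotprod mulr_sumr; apply: eq_bigr => i _; rewrite mxE expr2; ring.
  have Q0 : 0 <= \sum_(i < n) (Du x ord0 i ^+ 2) by apply: sumr_ge0 => i _; exact: sqr_ge0.
  move: (\sum_(i < n) _) Q0 => Q Q0.
  have -> : alpha * d / 3 * (P ^+ 2 * Q) = alpha * (d / 3 * P) * (P * Q) by field.
  apply: ler_wpM2r; first exact: mulr_ge0.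
  apply: le_trans al; rewrite -powRN; apply: ler_wpM2l; first exact: ltW.
  have d3 : 0 < d / 3 by rewrite divr_gt0.
  by rewrite -ler_pdivlMl// invf_div.
have up : (\int[mu]_(x in Omega) (f x * psi (u x))%:E <=
    (3 / 2)%:E * (weak_constant m gam * distr s `^ (1 - m^-1))%:E)%E.
  have mfv : measurable_fun (Omega : set T) (fun x : T => (f x * psi (u x))%:E).
    by apply/measurable_EFinP; exact: (measurable_funM mf mv).
  have mfv' : measurable_fun (Omega : set T) (fun x : T => `|(f x * psi (u x))%:E|%E).
    exact: (measurableT_comp (@abse_measurable R setT) mfv).
  have mfa : measurable_fun (Omega : set T) (fun x : T => (`|f x|)%:E).
    by apply/measurable_EFinP; exact: (measurableT_comp (@normr_measurable R setT) mf).
  have psi32 x : `|psi (u x)| <= 3 / 2 by have [_ _ + _ _] := psiP (u x).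
  apply: (le_trans (lee_abs _)); apply: (le_trans (le_abse_integral _ mO mfv)).
  have -> : (\int[mu]_(x in Omega) `|(f x * psi (u x))%:E| =
      \int[mu]_(x in levelset s) `|(f x * psi (u x))%:E|)%E.
    rewrite integral_mkcond [RHS]integral_mkcond; congr (integral _ _ _).
    apply/funext => x; rewrite !patchE; case: ifPn => [/set_mem Ox|xO].
      case: ifPn => // /negP xA; have [p|p] := eqVneq (psi (u x)) 0.
        by rewrite p mulr0 abse0.
      exfalso; apply: xA; apply: mem_set; split=> //=.
      by have [_ _ _ + _] := psiP (u x); exact.
    case: ifPn => // /set_mem[Ox _]; exfalso; move/negP: xO; apply; exact: mem_set.
  have fA := @weak_integral_le _ T R mu Omega (levelset s) f m gam (distr s) mO mA AO mf m1 gam0 fw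
    a0 (distrE s).
  apply: (@le_trans _ _ ((3 / 2)%:E * \int[mu]_(x in levelset s) (`|f x|)%:E)%E).
    rewrite -(@ge0_integralZl_EFin _ T R mu _ mA _ _ _ (3 / 2)) ?divr_ge0//; last 1 first.
      exact: (measurable_funS mO AO mfa).
    apply: (@ge0_le_integral _ T R mu _ mA) => [x _|||x _].
    - exact: abse_ge0.
    - exact: (measurable_funS mO AO mfv').
    - by apply: measurable_funeM; exact: (measurable_funS mO AO mfa).
    - by rewrite abse_EFin -EFinM lee_fin normrM mulrC ler_wpM2r.
  by apply: lee_wpmul2l; [rewrite lee_fin divr_ge0|exact: fA].
rewrite -eqn in up; have := le_trans low up.
set S := (\sum_(i < n) _)%E => H.
have c0 : 0 < alpha * d / 3 by rewrite divr_gt0 ?mulr_gt0.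
have ci : (0 <= ((alpha * d / 3)^-1)%:E)%E by rewrite lee_fin invr_ge0 ltW.
have := lee_wpmul2l ci H.
rewrite muleA -EFinM mulVf ?gt_eqF// mul1e => /le_trans; apply.
rewrite -!EFinM lee_fin le_eqVlt; apply/orP; left; apply/eqP.
by field; rewrite !gt_eqF.
Qed.

Lemma decay s d : 0 <= s -> 0 < d ->
  distr (s + d) <= decay_constant / d * distr s `^ (1 + 2 / n%:R - m^-1).
Proof.
move=> s0 d0; have n0 : 0 < n%:R :> R by rewrite ltr0n (ltn_trans _ n2).
have D0 := decay_constant_gt0.
(* A null level set is treated apart, since [energy_le] and [faber_krahn] ask for positive
   measures. *)
have [a0|a0] := leP (distr s) 0.
  have -> : distr (s + d) = 0.
    apply/eqP; rewrite eq_le distr_ge0 andbT (le_trans _ a0)// distr_homo// lerDl ltW//.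
  by rewrite mulr_ge0 ?powR_ge0// divr_ge0 ?ltW.
have [v [Dv [sv vs vl En]]] := energy_le s0 d0 a0.
set A := distr s in a0 En *.
(* [faber_krahn] requires a strict upper bound for the measure of [{v <> 0}], which [A] itself need
   not be. *)
have A2 : 0 < 2 * A by rewrite mulr_gt0.
have mv : measurable_fun (Omega : set T) (v : T -> R) by case: sv => -[[]].
have vN : (mu (Omega `&` [set x | v x != 0]%R) < (2 * A)%:E)%E.
  apply: (@le_lt_trans _ _ (mu (levelset s))).
    apply: le_measure; rewrite ?inE; [|exact: measurable_levelset|exact: vs].
    rewrite (_ : [set x | _] = v @^-1` (~` [set 0])); last first.
      by apply/seteqP; split => x /= /eqP.
    by apply: mv; [exact: mO|exact: measurableC].
  rewrite distrE lte_fin -/A; lra.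
have FK := faber_krahn oO (ltn_trans (ltn0Sn _) n2) sv A2 vN.
rewrite -lee_fin -distrE.
apply: (@le_trans _ _ (mu (Omega `&` [set x | 3 / 2 <= `|v x|]%R))).
  apply: le_measure; rewrite ?inE; [exact: measurable_levelset| |exact: vl].
  exact: (measurable_level_ge (3 / 2) mO mv).
apply: (le_trans FK).
have c0 : (0 <= (16 * n%:R * ((2 * (2 * A)) `^ (n%:R^-1)) ^+ 2)%:E)%E.
  by rewrite lee_fin mulr_ge0 ?sqr_ge0// mulr_ge0// ltW.
apply: (le_trans (lee_wpmul2l c0 En)).
rewrite -EFinM lee_fin le_eqVlt; apply/orP; left; apply/eqP.
have -> : (2 * (2 * A)) `^ n%:R^-1 = 4 `^ n%:R^-1 * A `^ n%:R^-1.
  by rewrite -powRM ?(ltW a0)//; congr (_ `^ _); ring.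
have An : A != 0 by rewrite gt_eqF.
have -> : A `^ (1 + 2 / n%:R - m^-1) = (A `^ n%:R^-1) ^+ 2 * A `^ (1 - m^-1).
  rewrite -powR_mulrn ?powR_ge0// -powRrM -powRD; last by rewrite An implybT.
  by congr (_ `^ _); ring.
rewrite /decay_constant; field; rewrite !gt_eqF//.
Qed.

End decay.

(** * Weak norms and the regularity theorem *)

Section weak_norm.
Context (R : realType) (n : nat).
Local Notation E := 'rV[R]_n.

Lemma weak_bound_le (Omega : set E) (m g1 g2 : R) (f : E -> R) : g1 <= g2 ->
  weak_bound Omega m f g1 -> weak_bound Omega m f g2.
Proof.
move=> g12 w l l0; apply: le_trans (w l l0) _.
by rewrite lee_fin ler_wpM2r// invr_ge0 powR_ge0.
Qed.

(** The [+ 1] leaves room to pick an admissible [gamma] close to the infimum, so whether the infimum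
    is attained is not at issue. *)
Lemma weak_bound_norm (Omega : set E) (m : R) (f : E -> R) : 0 < m -> Lweak Omega m f ->
  weak_bound Omega m f (Lweak_norm Omega m f `^ m + 1).
Proof.
move=> m0 [mf [g wg]].
set S := [set gamma | 0 < gamma /\ weak_bound Omega m f gamma].
have S0 : S !=set0.
  exists (`|g| + 1); split; first by rewrite ltr_wpDl.
  by apply: weak_bound_le wg; rewrite (le_trans (ler_norm g))// lerDl.
have lbS : lbound S 0 by move=> x [/ltW].
have iS : has_inf S by split=> //; exists 0.
have i0 : 0 <= inf S by exact: lb_le_inf.
rewrite /Lweak_norm -/S -powRrM mulVf ?gt_eqF// powRr1//.
have [x [_ wx] xS] := inf_adherent ltr01 iS.
by apply: weak_bound_le wx; exact: ltW.
Qed.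

Lemma bounded_volume (Omega : set E) : open Omega -> bounded_set Omega ->
  (@lebesgue_rV R n Omega < +oo)%E.
Proof.
move=> oO [M [_ MB]].
have mB := @borel_measurable_ball R n (M + 1).
apply: (@le_lt_trans _ _ (@lebesgue_rV R n [set x | `|(x : E)| <= M + 1])).
  apply: le_measure; rewrite ?inE.
  - exact: measurable_open_lebesgue.
  - exact: lebesgue_rV_measurable.
  - by move=> x Ox; apply: (MB (M + 1)) => //; rewrite ltrDl.
by rewrite lebesgue_rV_borel// borel_lebesgue_ball_fin.
Qed.

End weak_norm.

Lemma arithmetic_level (R : realType) (c y : R) : 0 < c -> 0 < y ->
  exists j : nat, c * j%:R < y /\ y <= c * j.+1%:R.
Proof.
move=> c0 y0.
have [N HN] : exists N : nat, y <= c * N%:R.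
  exists (Num.truncn (y / c)).+1; rewrite mulrC -ler_pdivrMr//.
  by apply: ltW; exact: Num.Theory.truncnS_gt.
elim: N HN => [|N IH] HN; first by move: HN; rewrite mulr0 leNgt y0.
have [/IH//|h] := leP y (c * N%:R).
by exists N.
Qed.

Unset Implicit Arguments.

Theorem theorem2p1 (R : realType) :
  exists (L : nat -> R -> R -> R -> R -> R) (lam : nat -> R -> R -> R -> R),
  forall (n : nat) (Omega : set 'rV[R]_n) (theta alpha beta m : R)
    (a : 'rV[R]_n -> R -> R) (f u : 'rV[R]_n -> R),
  (2 < n)%N ->
  open Omega -> bounded_set Omega ->
  0 <= theta < 1 -> 0 < alpha -> 0 < beta ->
  caratheodory_function Omega a ->
  {ae @lebesgue_rV R n, forall x, Omega x -> forall s : R,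
     alpha / (1 + `|s|) `^ theta <= a x s <= beta} ->
  sobolev_exponent_conj R n < m ->
  Lweak Omega m f ->
  dirichlet_solution Omega a f u ->
  [/\ n%:R / 2 < m ->
        let L0 := L n alpha (Lweak_norm Omega m f) m (volume Omega) in
        0 < L0 /\
        {ae @lebesgue_rV R n, forall x, Omega x -> `|u x| <= 2 * L0},
      m = n%:R / 2 ->
        let lambda := lam n alpha (Lweak_norm Omega m f) m in
        0 < lambda /\
        (@lebesgue_rV R n).-integrable Omega
          (fun x => (expR (lambda * `|u x| `^ (1 - theta)))%:E) &
      m < n%:R / 2 ->
        Lweak Omega (double_star n m * (1 - theta)) u].
Proof.
pose C (n : nat) (alpha nm m : R) := @decay_constant R n alpha m (nm `^ m + 1).
pose b (n : nat) (m : R) := 1 + 2 / n%:R - m^-1.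
(* The threshold of [stampacchia_bounded], taken at [V + 1] because a positive bound is required
   there and the volume may be 0; the final [+ 1] makes [d0] itself positive. *)
pose d0 n alpha nm m V := 2 * C n alpha nm m * (V + 1) `^ (b n m - 1) * 2 `^ ((b n m - 1)^-1) + 1.
(* [H (|u|) <= d0] and [1 + t <= expR (H t)]: the exponential makes the bound
   independent of theta. For (ii), the levels [2 C j] have measure at most
   [V / 2^j] and [expR (lam * 2 C) = 3 / 2]. The bound [nm `^ m + 1] is positive
   even if the weak norm vanishes. *)
exists (fun n alpha nm m V => expR (d0 n alpha nm m V)),
  (fun n alpha nm m => ln (3 / 2) / (2 * C n alpha nm m)).
move=> n Omega theta alpha beta m a f u n2 oO bO th al0 be0 _ aab mconj Lf sol.
pose E := 'rV[R]_n; pose T := lebesgue_space R n.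
have mO : measurable (Omega : set T) := measurable_open_lebesgue oO.
have n0 : 0 < n%:R :> R by rewrite ltr0n (ltn_trans _ n2).
(* [2 n / (n + 2) >= 1] because [n >= 2]. With [m > 1], [weak_integral_le] applies to [f]. *)
have m1 : 1 < m.
  apply: le_lt_trans mconj; rewrite /sobolev_exponent_conj ler_pdivlMr ?addr_gt0// mul1r.
  have : 2 <= n%:R :> R by rewrite ler_nat ltnW.
  lra.
have m0 : 0 < m by lra.
have /andP[th0 th1] := th.
have fw := weak_bound_norm m0 Lf.
have [mf _] := Lf.
set nm := Lweak_norm Omega m f in fw *.
have gam0 : 0 < nm `^ m + 1 by rewrite ltr_wpDl// powR_ge0.
have fO := bounded_volume oO bO.
have dec := decay n2 oO fO th al0 m1 gam0 aab mf fw sol.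
have Cp : 0 < C n alpha nm m by exact: decay_constant_gt0.
rewrite -/(C n alpha nm m) -/(b n m) in dec.
set M := distr Omega theta u in dec.
have M0 s : 0 <= M s by exact: distr_ge0.
have Mh s t : s <= t -> M t <= M s by exact: (distr_homo theta oO fO sol).
have MV s : M s <= volume Omega by exact: (distr_volume theta oO fO sol).
have ME s := distrE theta oO fO sol s.
have mL s := measurable_levelset theta oO sol s.
have V0 : 0 <= volume Omega by exact: fine_ge0.
have b0 : 0 <= b n m.
  have : m^-1 <= 1 by rewrite invf_le1// ltW.
  have : 0 <= 2 / n%:R :> R by rewrite divr_ge0.
  by rewrite /b; lra.
split.
- move=> mn /=; split; first exact: expR_gt0.
  set V := volume Omega in V0 MV *.
  have b1 : 1 < b n m.
    have : m^-1 < 2 / n%:R by rewrite -[2 / _]invf_div ltf_pV2 ?posrE// divr_gt0.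
    by rewrite /b; lra.
  have V1 : 0 < V + 1 by rewrite ltr_wpDl.
  have D0 : 0 < d0 n alpha nm m V.
    rewrite /d0 ltr_wpDl//; apply: mulr_ge0; last exact: powR_ge0.
    by apply: mulr_ge0; [apply: mulr_ge0 => //; exact: ltW|exact: powR_ge0].
  have MV1 : M 0 <= V + 1 by rewrite (le_trans (MV 0))// lerDl.
  have Md : M (d0 n alpha nm m V) = 0.
    apply: (stampacchia_bounded M0 Mh MV1 (ltW Cp) b0 dec b1 V1 D0).
    by rewrite /d0 lerDl.
  (* Off this null set, [1 + |u| <= expR (H(|u|)) <= L0]. *)
  exists (levelset Omega theta u (d0 n alpha nm m V)); split.
  + exact: mL.
  + by rewrite ME -/M Md.
  + move=> x /= nx; have Ox : Omega x by apply: contrapT => nO; apply: nx => Ox; exfalso.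
    split=> //=; rewrite ltNge; apply/negP => Hx; apply: nx => _.
    have := Hprim_expR th1 (normr_ge0 (u x)).
    have : expR (Hprim theta `|u x|) <= expR (d0 n alpha nm m V) by rewrite ler_expR.
    have := expR_gt0 (d0 n alpha nm m V); lra.
- move=> mn /=; set lam := ln (3 / 2) / (2 * C n alpha nm m).
  set V := volume Omega in V0 MV *; set c := C n alpha nm m in lam Cp dec *.
  have b1 : b n m = 1 by rewrite /b mn invf_div addrK.
  (* Any number strictly between 1 and 2 could stand for 3/2: above 1 so that [lam > 0], below 2 so
     that the halving of the level sets prevails. *)
  have l32 : 0 < ln (3 / 2 : R) by apply: ln_gt0; lra.
  have lam0 : 0 < lam by rewrite divr_gt0// mulr_gt0.
  split=> //.
  pose g (x : E) := expR (lam * `|u x| `^ (1 - theta)).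
  have mu1 : measurable_fun (Omega : set T) (fun x : T => `|u x|).
    exact: (measurableT_comp (@normr_measurable R setT) (solution_measurable sol)).
  have mu2 := measurableT_comp (measurable_powR (1 - theta)) mu1.
  have mg : measurable_fun (Omega : set T) (g : T -> R).
    exact: (measurableT_comp (@measurable_expR R) (measurable_funM (@measurable_cst _ _ _ _ _ lam)
      mu2)).
  apply/integrableP; split; first exact/measurable_EFinP.
  have g0 (x : T) : 0 <= g x by exact: expR_ge0.
  have cj (j : nat) : 0 <= expR lam * (3 / 2) ^+ j.+1 :> R.
    by rewrite mulr_ge0 ?expR_ge0// exprn_ge0// divr_ge0.
  (* In [|u|^(1 - theta) <= 1 + H(|u|)] the 1 gives the factor [expR lam], and each step of length
     [2 c] in H a factor 3/2. *)
  have gc (x : T) : Omega x -> g x <= expR lam \/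
      exists j, levelset Omega theta u (2 * c * j%:R) x /\ g x <= expR lam * (3 / 2) ^+ j.+1.
    move=> Ox; have Hu := Hprim_powR th (normr_ge0 (u x)).
    have [y0|y0] := leP (Hprim theta `|u x|) 0; [left|right].
      by rewrite /g ler_expR ler_piMr ?(ltW lam0)//; lra.
    have c2 : 0 < 2 * c by rewrite mulr_gt0.
    have [j [j1 j2]] := arithmetic_level c2 y0.
    exists j; split; first by split.
    have -> : expR lam * (3 / 2) ^+ j.+1 = expR (lam * (1 + 2 * c * j.+1%:R)).
      rewrite mulrDr mulr1 expRD; congr (_ * _).
      rewrite (_ : lam * (2 * c * j.+1%:R) = j.+1%:R * ln (3 / 2)); last first.
        by rewrite /lam mulrA divfK ?gt_eqF// mulrC.
      by rewrite expRM_natl lnK// posrE.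
    by rewrite /g ler_expR ler_wpM2l ?(ltW lam0)//; lra.
  have := @integral_layers_le _ T R (@lebesgue_rV R n) Omega g (expR lam) (fun j => expR lam * (3 /
    2) ^+ j.+1)
    (fun j => levelset Omega theta u (2 * c * j%:R)) mO mg g0 (expR_ge0 _) cj (fun j => mL _) gc.
  have -> : (\int[@lebesgue_rV R n]_(x in Omega) `|(g x)%:E| = \int[@lebesgue_rV R n]_(x in Omega)
    (g x)%:E)%E.
    by apply: eq_integral => x _; rewrite abse_EFin ger0_norm.
  move=> H; apply: (le_lt_trans H).
  have fOn : @lebesgue_rV R n Omega \is a fin_num by rewrite ge0_fin_numE.
  apply: (@le_lt_trans _ _ ((expR lam * V)%:E + (expR lam * (3 / 2) * V / (1 - 3 / 4))%:E)%E); last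
    first.
    by rewrite -EFinD ltry.
  apply: leeD; first by rewrite EFinM /V /volume fineK.
  have k0 : 0 <= expR lam * (3 / 2) * V by rewrite mulr_ge0// mulr_ge0 ?expR_ge0// divr_ge0.
  (* The ratio 3/4 is the growth 3/2 of [g] from one layer to the next times the factor 1/2 in the
     bound on their measures. *)
  have k1 : 0 <= (3 / 4 : R) < 1 by rewrite divr_ge0//= ltr_pdivrMr// mul1r ltr_nat.
  apply: le_trans (nneseries_geometric_le k0 k1); apply: lee_nneseries => j.
    by move=> _ _; rewrite mule_ge0// lee_fin.
  move=> _ /=; rewrite [X in (_ * X)%E]ME -/M -EFinM lee_fin.
  have := stampacchia_exp M0 (MV 0) (ltW Cp) dec j b1 Cp.
  rewrite -/c => Mj; apply: (le_trans (ler_wpM2l (cj j) Mj)).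
  rewrite (_ : 3 / 4 = 3 / 2 * 2^-1 :> R); last by field.
  rewrite [X in _ <= _ * X]exprMn [_ ^+ j.+1]exprS.
  by rewrite le_eqVlt; apply/orP; left; apply/eqP; move: (_ ^+ j) (_ ^+ j) => y z; ring.
- move=> mn; split; first exact: (solution_measurable sol).
  have q0 : 0 < n%:R - 2 * m by lra.
  have p0 : 0 < double_star n m by rewrite /double_star divr_gt0// mulr_gt0.
  set p := double_star n m in p0 *.
  have pb : p * (1 - b n m) = 1.
    by rewrite /p /double_star /b; field; rewrite !gt_eqF.
  have [Z Z0 MZ] := stampacchia_poly M0 Mh (MV 0) (ltW Cp) b0 dec p0 pb.
  set V := volume Omega in V0 MV *.
  have r0 : 0 <= p * (1 - theta) by rewrite mulr_ge0 ?(ltW p0)//; lra.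
  (* [V] takes care of [l < 1], where a nonnegative power of [l] is at most 1. Of the 4, one factor
     2 comes from [Hprim_lower] and the other from halving the level. *)
  exists (V + Z * 4 `^ p) => l l0.
  have lr : 0 < l `^ (p * (1 - theta)) by rewrite powR_gt0.
  have Z4 : 0 <= Z * 4 `^ p by rewrite mulr_ge0// powR_ge0.
  have mA := measurable_level_gt l mO (solution_measurable sol).
  have [l1|l1] := leP 1 l; last first.
    apply: (@le_trans _ _ V%:E).
      rewrite /V /volume fineK ?ge0_fin_numE//.
      by apply: le_measure; rewrite ?inE; [exact: mA|exact: mO|move=> x []].
    rewrite lee_fin ler_pdivlMr//.
    have lr1 : l `^ (p * (1 - theta)) <= 1.
      have : l `^ (p * (1 - theta)) <= 1 `^ (p * (1 - theta)).
        by apply: ge0_ler_powR; rewrite ?nnegrE//; exact: ltW.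
      by rewrite powR1.
    by rewrite (@le_trans _ _ V)// ?ler_piMr// lerDl.
  have Hl := Hprim_lower th l1.
  have lt0 : 0 < l `^ (1 - theta) by rewrite powR_gt0.
  have Hl0 : 0 < Hprim theta l by apply: lt_le_trans Hl; rewrite divr_gt0.
  (* [Hprim_homo] is not strict whereas [levelset] is, hence a level strictly below
     [Hprim theta l]. *)
  set s := Hprim theta l / 2.
  have s0 : 0 < s by rewrite divr_gt0.
  apply: (@le_trans _ _ (@lebesgue_rV R n (levelset Omega theta u s))).
    apply: le_measure; rewrite ?inE; [exact: mA|exact: mL|].
    move=> x [Ox /= lx]; split=> //=.
    have := Hprim_homo th1 (ltW l0) (ltW lx); rewrite /s; lra.
  rewrite ME -/M lee_fin; apply: (le_trans (MZ s s0)).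
  have sl : l `^ (1 - theta) / 4 <= s by rewrite /s; lra.
  have sl0 : 0 < l `^ (1 - theta) / 4 by rewrite divr_gt0.
  apply: (@le_trans _ _ (Z * (l `^ (1 - theta) / 4) `^ (- p))).
    by rewrite ler_wpM2l//; apply: le0_ler_powR => //; exact: ltW.
  have -> : Z * (l `^ (1 - theta) / 4) `^ (- p) = Z * 4 `^ p / l `^ (p * (1 - theta)).
    rewrite powRM ?(ltW lt0) ?invr_ge0// -powRrM -powR_inv1// -powRrM mulN1r opprK.
    by rewrite mulrN powRN (mulrC (1 - theta)) [_^-1 * _]mulrC mulrA.
  by rewrite ler_pM2r ?invr_gt0// lerDr.
Qed.
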